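(* Let $d\ge1$, $\mathcal D=\{1,\dots,d\}$, and suppose that for every $j=1,\dots,d$ the pair $(\rho_j,\psi_j)$ satisfies $$\int_{-\infty}^{c}\frac{\Phi_j(t)}{\psi_j(t)}\,dt<\infty\quad\text{and}\quad\int_c^\infty\frac{1-\Phi_j(t)}{\psi_j(t)}\,dt<\infty\quad\text{for all finite }c .$$ Then the space $\mathcal W_d$ is embedded in $\mathcal L^2_{\boldsymbol\rho}$, with $$\|f\|_{\mathcal L^2_{\boldsymbol\rho}}^2\;\le\;\bigg(\sum_{\mathfrak u\subseteq\mathcal D}\gamma_{\mathfrak u}\prod_{j\in\mathfrak u}C(\rho_j,\psi_j)\bigg)\,\|f\|_{\mathcal W_d}^2\qquad\text{for all } f\in\mathcal W_d,$$ where $C(\rho_j,\psi_j)=\int_{-\infty}^\infty\frac{\Phi_j(t)(1-\Phi_j(t))}{\psi_j(t)}\,dt$.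
   Context: Let $\mathcal D=\{1,\dots,d\}$. For each $j\in\mathcal D$, $\rho_j:\mathbb R\to(0,\infty)$ is a strictly positive probability density function with distribution function $\Phi_j(x)=\int_{-\infty}^x\rho_j(t)\,dt$, and $\psi_j:\mathbb R\to(0,\infty)$ is a strictly positive locally integrable function such that $1/\psi_j$ is also locally integrable. For each $\mathfrak u\subseteq\mathcal D$ there is a weight parameter $\gamma_{\mathfrak u}>0$. Put $\boldsymbol\rho(\boldsymbol x)=\prod_{j=1}^d\rho_j(x_j)$ and $\|f\|_{\mathcal L^2_{\boldsymbol\rho}}^2=\int_{\mathbb R^d}|f(\boldsymbol x)|^2\boldsymbol\rho(\boldsymbol x)\,d\boldsymbol x$. Write $\boldsymbol x_{\mathfrak u}=(x_j)_{j\in\mathfrak u}$, $\boldsymbol\psi_{\mathfrak u}(\boldsymbol x_{\mathfrak u})=\prod_{j\in\mathfrak u}\psi_j(x_j)$, $\boldsymbol\rho_{\mathcal D\setminus\mathfrak u}(\boldsymbol x_{\mathcal D\setminus\mathfrak u})=\prod_{j\in\mathcal D\setminus\mathfrak u}\rho_j(x_j)$. Empty products equal $1$. $\partial^{\mathfrak u}f=\prod_{j\in\mathfrak u}\frac{\partial}{\partial x_j}f$ denotes the first-order mixed weak derivative: the locally integrable function with $\int_{\mathbb R^d}\partial^{\mathfrak u}f\,v\,d\boldsymbol x=(-1)^{|\mathfrak u|}\int_{\mathbb R^d}f\,\partial^{\mathfrak u}v\,d\boldsymbol x$ for all $v\in C_0^\infty(\mathbb R^d)$. $\mathcal W_d$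 consists of the locally integrable functions $f$ on $\mathbb R^d$ (identified when equal almost everywhere) with finite norm $$\|f\|_{\mathcal W_d}^2=\sum_{\mathfrak u\subseteq\mathcal D}\frac1{\gamma_{\mathfrak u}}\int_{\mathbb R^{|\mathfrak u|}}\bigg|\int_{\mathbb R^{d-|\mathfrak u|}}\partial^{\mathfrak u}f(\boldsymbol x)\,\boldsymbol\rho_{\mathcal D\setminus\mathfrak u}(\boldsymbol x_{\mathcal D\setminus\mathfrak u})\,d\boldsymbol x_{\mathcal D\setminus\mathfrak u}\bigg|^2\boldsymbol\psi_{\mathfrak u}(\boldsymbol x_{\mathfrak u})\,d\boldsymbol x_{\mathfrak u}.$$ Finiteness is understood to require that the weak derivatives $\partial^{\mathfrak u}f$, $\mathfrak u\subseteq\mathcal D$, exist and that the inner integrals are well defined as (absolutely convergent) Lebesgue integrals for almost all $\boldsymbol x_{\mathfrak u}$. *)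

(* Defs.v *)
From HB Require Import structures.
From mathcomp Require Import all_boot all_order all_algebra.
From mathcomp Require Import all_classical all_reals all_analysis.

Set Implicit Arguments.
Unset Strict Implicit.
Unset Printing Implicit Defensive.

Import Order.TTheory GRing.Theory Num.Theory.
Import numFieldNormedType.Exports.

Local Open Scope classical_set_scope.
Local Open Scope ring_scope.

(** R^n is ['rV[R]_n], which carries a topology and a norm but no measurable
    structure; it gets the product sigma-algebra, i.e. the Borel one. As for
    [lebesgue_measure] on [R], "measurable" therefore means Borel measurable. *)

Section rV_measurable.
Context {d : measure_display} {T : measurableType d}.
Variable n : nat.

Let coord : 'I_n -> 'rV[T]_n -> T := fun i x => x ord0 i.

Let rV_set0 : g_sigma_preimage coord set0.
Proof. exact: sigma_algebra0. Qed.

Let rV_setC A : g_sigma_preimage coord A -> g_sigma_preimage coord (~` A).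
Proof. exact: sigma_algebraC. Qed.

Let rV_bigcup (F : (set 'rV[T]_n)^nat) :
  (forall i, g_sigma_preimage coord (F i)) ->
  g_sigma_preimage coord (\bigcup_i (F i)).
Proof. exact: sigma_algebra_bigcup. Qed.

HB.instance Definition _ := @isMeasurable.Build (measure_tuple_display d)
  'rV[T]_n (g_sigma_preimage coord) rV_set0 rV_setC rV_bigcup.

End rV_measurable.

Section lebesgue_rV.
Context {R : realType}.

Definition rV_cons n (p : measurableTypeR R * 'rV[R]_n) : 'rV[R]_n.+1 :=
  row_mx (const_mx p.1 : 'rV_1) p.2.

Definition rV_uncons n (x : 'rV[R]_n.+1) : measurableTypeR R * 'rV[R]_n :=
  (x ord0 ord0, \row_i x ord0 (lift ord0 i)).

Lemma rV_cons0 n (p : measurableTypeR R * 'rV[R]_n) : rV_cons p ord0 ord0 = p.1.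
Proof.
transitivity (row_mx (const_mx p.1 : 'rV_1) p.2 ord0 (lshift n ord0)).
  by congr (row_mx _ _ _ _); exact/val_inj.
by rewrite row_mxEl mxE.
Qed.

Lemma rV_consS n (p : measurableTypeR R * 'rV[R]_n) i :
  rV_cons p ord0 (lift ord0 i) = p.2 ord0 i.
Proof.
transitivity (row_mx (const_mx p.1 : 'rV_1) p.2 ord0 (rshift 1 i)).
  by congr (row_mx _ _ _ _); exact/val_inj.
by rewrite row_mxEr.
Qed.

Lemma rV_uncons_consK n : cancel (@rV_cons n) (@rV_uncons n).
Proof.
move=> [t y]; congr pair; first exact: rV_cons0.
by apply/rowP => i; rewrite mxE rV_consS.
Qed.

Lemma rV_cons_unconsK n : cancel (@rV_uncons n) (@rV_cons n).
Proof.
move=> x; apply/rowP => i; case: (unliftP ord0 i) => [j|] ->.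
  by rewrite rV_consS mxE.
by rewrite rV_cons0.
Qed.

Lemma measurable_rV_coord n (i : 'I_n) :
  measurable_fun [set: 'rV[R]_n] (fun x => x ord0 i).
Proof.
move=> _ Y mY; rewrite setTI; apply: sub_sigma_algebra => /=.
rewrite -bigcup_seq/=; exists i => /=; first by rewrite mem_index_enum.
by exists Y => //; rewrite setTI.
Qed.

Lemma measurable_fun_rV d (T : measurableType d) n (f : T -> 'rV[R]_n) :
  (forall i, measurable_fun [set: T] (fun x => f x ord0 i)) ->
  measurable_fun [set: T] f.
Proof.
move=> mf.
suff: g_sigma_preimage (fun i => (fun x : 'rV[R]_n => x ord0 i) \o f) `<=`
    measurable.
  by rewrite g_sigma_preimage_comp => mS _ A mA; apply: mS; exists A.
apply: smallest_sub; first exact: sigma_algebra_measurable.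
case: n => [|n] in f mf *; first by rewrite big_ord0.
rewrite -bigcup_mkord_ord; apply: bigcup_sub => i Ii.
by move=> A [B mB <-]; exact: mf.
Qed.

Lemma measurable_rV_cons n : measurable_fun setT (@rV_cons n).
Proof.
apply: measurable_fun_rV => i; case: (unliftP ord0 i) => [j|] ->.
  apply: (eq_measurable_fun (fun p : measurableTypeR R * 'rV[R]_n => p.2 ord0 j)).
    by move=> p _; rewrite rV_consS.
  exact: measurableT_comp (measurable_rV_coord j) measurable_snd.
apply: (eq_measurable_fun (fun p : measurableTypeR R * 'rV[R]_n => p.1)).
  by move=> p _; rewrite rV_cons0.
exact: measurable_fst.
Qed.

Lemma measurable_rV_uncons n : measurable_fun setT (@rV_uncons n).
Proof.
apply: measurable_fun_pair; first exact: measurable_rV_coord.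
apply: measurable_fun_rV => i.
apply: (eq_measurable_fun (fun x : 'rV[R]_n.+1 => x ord0 (lift ord0 i))).
  by move=> p _; rewrite mxE.
exact: measurable_rV_coord.
Qed.

Section lebesgue_rV_succ.
Variables (n : nat) (m : {sigma_finite_measure set 'rV[R]_n -> \bar R}).

Definition lebesgue_rV_succ : set 'rV[R]_n.+1 -> \bar R :=
  pushforward (lebesgue_measure \x m)%E (@rV_cons n).

Let mcons : {mfun (measurableTypeR R * 'rV[R]_n)%type >-> 'rV[R]_n.+1} :=
  mfun_Sub (mem_set (@measurable_rV_cons n)).

Let lebesgue_rV_succ0 : lebesgue_rV_succ set0 = 0%E.
Proof. exact: (@measure0 _ _ _ (pushforward _ mcons)). Qed.

Let lebesgue_rV_succ_ge0 A : (0 <= lebesgue_rV_succ A)%E.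
Proof. exact: (@measure_ge0 _ _ _ (pushforward _ mcons)). Qed.

Let lebesgue_rV_succ_sigma_additive : semi_sigma_additive lebesgue_rV_succ.
Proof.
exact: (@measure_semi_sigma_additive _ _ _ (pushforward _ mcons)).
Qed.

HB.instance Definition _ := isMeasure.Build _ _ _ lebesgue_rV_succ
  lebesgue_rV_succ0 lebesgue_rV_succ_ge0 lebesgue_rV_succ_sigma_additive.

Let lebesgue_rV_succ_sigma_finite : sigma_finite setT lebesgue_rV_succ.
Proof.
have /sigma_finiteP[F [TF ndF Foo]] := sigma_finiteT (@lebesgue_measure R).
have /sigma_finiteP[G [TG ndG Goo]] := sigma_finiteT m.
exists (fun k => @rV_uncons n @^-1` (F k `*` G k)).
  rewrite -preimage_bigcup (_ : \bigcup_k _ = setT) ?preimage_setT//.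
  rewrite predeqE => -[x y]; split => // _.
  have [i _ Fx] : (\bigcup_i F i) x by rewrite -TF.
  have [j _ Gy] : (\bigcup_i G i) y by rewrite -TG.
  exists (maxn i j) => //; split => /=.
    by move: x Fx; exact/subsetPset/ndF/leq_maxl.
  by move: y Gy; exact/subsetPset/ndG/leq_maxr.
move=> k; have [mF Fk] := Foo k; have [mG Gk] := Goo k; split.
  rewrite -[X in measurable X]setTI; apply: measurable_rV_uncons => //.
  exact: measurableX.
rewrite /lebesgue_rV_succ /pushforward -comp_preimage.
rewrite (_ : _ \o _ = id) ?preimage_id; last first.
  by apply/funext => p; exact: rV_uncons_consK.
by rewrite product_measure1E// lte_mul_pinfty// ge0_fin_numE.
Qed.

HB.instance Definition _ := Measure_isSigmaFinite.Build _ _ _ lebesgue_rV_succ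
  lebesgue_rV_succ_sigma_finite.

End lebesgue_rV_succ.

(** For [n = 0] this is the unit mass at the only point of R^0. *)
Fixpoint lebesgue_rV n : {sigma_finite_measure set 'rV[R]_n -> \bar R} :=
  match n with
  | 0 => \d_(0 : 'rV[R]_0)
  | n'.+1 => lebesgue_rV_succ (lebesgue_rV n')
  end.

End lebesgue_rV.

Section test_functions.
Context {R : realType} {d : nat}.
Implicit Types (v : 'rV[R]_d -> R) (u : {set 'I_d}).

Definition pderiv (j : 'I_d) v : 'rV[R]_d -> R := 'D_(delta_mx ord0 j) v.

(** [mderiv u v] is the classical mixed derivative, differentiated once in each
    direction of [u]; it is only used for smooth [v], for which the order of
    differentiation is immaterial. *)
Definition mderiv u v : 'rV[R]_d -> R := foldr pderiv v (enum u).

Fixpoint continuously_diff (k : nat) v : Prop :=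
  continuous v /\
  match k with
  | 0 => True
  | k'.+1 => forall j : 'I_d,
      (forall x, derivable v x (delta_mx ord0 j)) /\
      continuously_diff k' (pderiv j v)
  end.

Definition test_function v : Prop :=
  (forall k, continuously_diff k v) /\ compact (closure [set x | v x != 0]).

End test_functions.

Section weak_derivative.
Context {R : realType} {d : nat}.
Implicit Types (f g : 'rV[R]_d -> R) (u : {set 'I_d}).

Local Notation mu := (@lebesgue_rV R d).

Definition locally_integrable_rV f : Prop :=
  measurable_fun setT f /\
  forall K : set 'rV[R]_d, compact K -> (\int[mu]_(x in K) `|f x|%:E < +oo)%E.

Definition is_weak_deriv u f g : Prop :=
  locally_integrable_rV g /\
  forall v, test_function v ->
    \int[mu]_x (g x * v x) = (-1) ^+ #|u| * \int[mu]_x (f x * mderiv u v x).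

(** A chosen representative of the weak derivative, which is unique almost
    everywhere; [0] when there is none. *)
Definition wderiv u f : 'rV[R]_d -> R := xget (fun=> 0) (is_weak_deriv u f).

End weak_derivative.

Section weighted_spaces.
Context {R : realType} {d : nat}.
Implicit Types (f : 'rV[R]_d -> R) (u : {set 'I_d}).

(** For [u : {set 'I_d}], [R^u] is ['rV[R]_#|u|], whose [i]-th coordinate stands
    for the coordinate [enum_val i : 'I_d]. [join_coord u y z] is the point [x] of
    [R^d] with [x_u = y] and [x_(D \ u) = z]. *)
Definition extend0 u (y : 'rV[R]_#|u|) : 'rV[R]_d :=
  \sum_(i < #|u|) y ord0 i *: delta_mx ord0 (enum_val i).

Definition join_coord u (y : 'rV[R]_#|u|) (z : 'rV[R]_#|~: u|) : 'rV[R]_d :=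
  extend0 y + extend0 z.

Definition tensor u (h : 'I_d -> R -> R) (y : 'rV[R]_#|u|) : R :=
  \prod_(i < #|u|) h (enum_val i) (y ord0 i).

Variables (rho psi : 'I_d -> R -> R) (gamma : {set 'I_d} -> R).

Definition L2_sqnorm f : \bar R :=
  (\int[lebesgue_rV d]_x (`|f x| ^+ 2 * \prod_(j < d) rho j (x ord0 j))%:E)%E.

Definition L2_space f : Prop :=
  measurable_fun setT f /\ (L2_sqnorm f < +oo)%E.

Definition W_integrand u f (y : 'rV[R]_#|u|) (z : 'rV[R]_#|~: u|) : R :=
  wderiv u f (join_coord y z) * tensor rho z.

Definition W_inner u f (y : 'rV[R]_#|u|) : R :=
  \int[lebesgue_rV #|~: u|]_z W_integrand f y z.

Definition W_sqnorm f : \bar R :=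
  (\sum_(u : {set 'I_d}) (gamma u)^-1%:E *
    \int[lebesgue_rV #|u|]_y (`|W_inner f y| ^+ 2 * tensor psi y)%:E)%E.

Definition W_space f : Prop :=
  [/\ locally_integrable_rV f,
      forall u, exists g, is_weak_deriv u f g,
      forall u, {ae lebesgue_rV #|u|, forall y,
        (lebesgue_rV #|~: u|).-integrable setT (EFin \o W_integrand f y)} &
      (W_sqnorm f < +oo)%E].

End weighted_spaces.

Section one_dimensional.
Context {R : realType}.
Implicit Types rho psi : R -> R.

Definition is_density rho : Prop :=
  [/\ measurable_fun setT rho, forall t, 0 < rho t &
      (\int[lebesgue_measure]_t (rho t)%:E = 1)%E].

Definition is_weight psi : Prop :=
  [/\ forall t, 0 < psi t, locally_integrable setT psi &
      locally_integrable setT (fun t => (psi t)^-1)].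

Definition distr_fun rho (x : R) : R :=
  \int[lebesgue_measure]_(t in `]-oo, x]) rho t.

Definition tail_condition rho psi : Prop := forall c : R,
  (\int[lebesgue_measure]_(t in `]-oo, c]) (distr_fun rho t / psi t)%:E
     < +oo)%E /\
  (\int[lebesgue_measure]_(t in `[c, +oo[) ((1 - distr_fun rho t) / psi t)%:E
     < +oo)%E.

Definition C_const rho psi : \bar R :=
  (\int[lebesgue_measure]_t
     (distr_fun rho t * (1 - distr_fun rho t) / psi t)%:E)%E.

End one_dimensional.

Definition embedding_const (R : realType) (d : nat)
    (rho psi : 'I_d -> R -> R) (gamma : {set 'I_d} -> R) : \bar R :=
  (\sum_(u : {set 'I_d}) (gamma u)%:E *
     \prod_(j in u) C_const (rho j) (psi j))%E.

(* Main.v *)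
(** For disjoint sets u, r of coordinates let E_r be integration of the
    coordinates in r against their densities, and put
    N(r, u) = int |E_r d^u f|^2 prod_(i in u) psi_i/rho_i dP, with P the product
    probability; N(D \ u, u) is the u-th term of the squared norm of W_d, up to
    the factor 1/gamma_u, and N({}, {}) is the squared norm of f in L^2.

    Let eta be a bump of integral 1. Testing the weak derivatives against tensor
    products of one-dimensional test functions, after moving the mean of the
    j-th factor onto eta, gives almost everywhere
    d^u f(x) = M(x) + int K(x_j, s) d^(u+j) f(x with s in place of x_j) ds,
    where K(t, s) = int_(-oo)^s eta - 1_(t < s) and M does not depend on x_j.
    Fubini carries this representation over to E_r d^u f, so that the weighted
    Poincare inequality int g^2 rho <= (int g rho)^2 + C int g'^2 psi on the line
    (Cauchy-Schwarz in the double integral of |g(a) - g(b)|^2) yields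
    N(r, u) <= N(r + j, u) + C_j N(r, u + j). Fubini requires d^(u+j) f to have
    N({}, u + j) < oo, hence a descending induction on u; inside it, the
    inequality is iterated over the coordinates outside u. *)

Require Import Defs.
From HB Require Import structures.
From mathcomp Require Import all_boot all_order all_algebra.
From mathcomp Require Import all_classical all_reals all_analysis.
From mathcomp Require Import measurable_realfun.
From mathcomp Require Import ring lra.

Set Implicit Arguments.
Unset Strict Implicit.
Unset Printing Implicit Defensive.

Import Order.TTheory GRing.Theory Num.Theory.
Import numFieldNormedType.Exports.

Local Open Scope classical_set_scope.
Local Open Scope ring_scope.

(** * Integration preliminaries *)

(** The obstacle is that the norm of W_d sees d^u f only after every coordinate outside u has been
    integrated out, while the pointwise formula can be averaged only if K d^(u+j) f is absolutely
    integrable. That is obtained from |K g| <= 1_J/psi_j + g^2 psi_j, J a bounded interval carrying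
    K(t, .): the first term uses local integrability of 1/psi_j, the second needs g^2 before any
    averaging. The form of K comes from integration by parts. A test function on the line has a
    compactly supported primitive only if its integral is 0, hence the correction by eta; the
    resulting K is bounded and compactly supported in s, so local integrability of the derivatives
    is enough. The constant C_j comes from a probability: for independent a, b of density rho_j, a
    point s lies between them with probability 2 Phi_j(s)(1 - Phi_j(s)). The double integral of
    |g(a) - g(b)|^2 is twice the variance, and the factors 2 cancel. Averages are kept as functions
    on all of R^d by resampling the coordinates in r from an independent point ([mix]); the spaces
    R^u return only in the comparison with the norm. *)

Section product_measure_lemmas.
Local Open Scope ereal_scope.
Context d1 d2 (T1 : measurableType d1) (T2 : measurableType d2) (R : realType).
Variable m1 : {sigma_finite_measure set T1 -> \bar R}.
Variable m2 : {sigma_finite_measure set T2 -> \bar R}.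

Lemma measurable_fun_integral2 (F : T1 * T2 -> \bar R) :
  measurable_fun [set: T1 * T2] F ->
  measurable_fun setT (fun x => \int[m2]_y F (x, y)).
Proof.
move=> mF.
rewrite (_ : (fun _ => _) = (fun x => \int[m2]_y (funepos F) (x, y)) \-
    (fun x => \int[m2]_y (funeneg F) (x, y))); last first.
  apply/funext => x; rewrite integralE; congr (_ - _).
    by apply: eq_integral => y _; rewrite !funeposE.
  by apply: eq_integral => y _; rewrite !funenegE.
apply: emeasurable_funB.
- apply: (measurable_fun_fubini_tonelli_F (funepos F)) => //.
  exact: measurable_funepos.
- apply: (measurable_fun_fubini_tonelli_F (funeneg F)) => //.
  exact: measurable_funeneg.
Qed.

(** The measure of a null set is the integral of the measures of its sections, so almost every
    section is null. *)
Lemma ae_product (Q : T1 * T2 -> Prop) :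
  {ae m1 \x m2, forall z, Q z} -> {ae m1, forall x, {ae m2, forall y, Q (x, y)}}.
Proof.
move=> [N [mN N0 QN]].
have m0 : \int[m1]_x `|m2 (xsection N x)| = 0.
  by rewrite -[RHS]N0; apply: eq_integral => x _; rewrite gee0_abs.
have mx : measurable_fun setT (fun x => m2 (xsection N x)).
  exact: measurable_fun_xsection.
have := (ae_eq_integral_abs m1 measurableT mx).1 m0.
apply: filterS => x /(_ I) Nx.
exists (xsection N x); split => //; first exact: measurable_xsection.
by move=> y /= nQ; rewrite /xsection/= inE; exact: QN.
Qed.

End product_measure_lemmas.

Section measure_preserving.
Local Open Scope ereal_scope.
Context d1 d2 (T1 : measurableType d1) (T2 : measurableType d2) (R : realType).
Variable m1 : {measure set T1 -> \bar R}.
Variable m2 : {measure set T2 -> \bar R}.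
Variable phi : T1 -> T2.
Hypothesis mphi : measurable_fun setT phi.
Hypothesis pphi : forall A, measurable A -> m1 (phi @^-1` A) = m2 A.

Let ge0_integral_preserving (F : T2 -> \bar R) : measurable_fun setT F -> (forall y, 0 <= F y) ->
  \int[m1]_x F (phi x) = \int[m2]_y F y.
Proof.
move=> mF F0.
rewrite -[LHS]/(\int[m1]_(x in phi @^-1` setT) (F \o phi) x).
rewrite -ge0_integral_pushforward//.
by apply: (@eq_measure_integral _ _ _ setT m2
  (pushforward m1 (mfun_Sub (mem_set mphi) : {mfun T1 >-> T2}))) => A mA _; exact: pphi.
Qed.

(** Both sides are differences of integrals of the positive and negative parts, so no integrability
    is required. *)
Lemma integral_preserving (F : T2 -> \bar R) : measurable_fun setT F ->
  \int[m1]_x F (phi x) = \int[m2]_y F y.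
Proof.
move=> mF; rewrite integralE [RHS]integralE; congr (_ - _).
- rewrite -ge0_integral_preserving//; last exact: measurable_funepos.
  by apply: eq_integral => x _; rewrite !funeposE.
- rewrite -ge0_integral_preserving//; last exact: measurable_funeneg.
  by apply: eq_integral => x _; rewrite !funenegE.
Qed.

Lemma ae_preserving (Q : T2 -> Prop) :
  {ae m2, forall y, Q y} -> {ae m1, forall x, Q (phi x)}.
Proof.
move=> [N [mN N0 QN]]; exists (phi @^-1` N); split.
- by rewrite -[X in measurable X]setTI; exact: mphi.
- by rewrite -[RHS]N0; exact: pphi.
- by move=> x /= nQ; exact: QN.
Qed.

End measure_preserving.

Section density_measure.
Local Open Scope ereal_scope.
Context d (T : measurableType d) (R : realType).
Variables (m : {measure set T -> \bar R}) (p : T -> R).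
Hypotheses (mp : measurable_fun setT p) (p0 : forall x, (0 <= p x)%R).

(* The proofs are an argument so that the measure instance below, which needs
   them, can be attached to the constant. *)
Definition density_measure (mp0 : measurable_fun setT p * (forall x, (0 <= p x)%R))
  (A : set T) : \bar R := \int[m]_(x in A) (p x)%:E.

Local Notation nu := (density_measure (mp, p0)).

Let nu_set0 : nu set0 = 0.
Proof. exact: integral_set0. Qed.

Let nu_ge0 A : 0 <= nu A.
Proof. by apply: integral_ge0 => x _; rewrite lee_fin. Qed.

Let nu_sigma_additive : semi_sigma_additive nu.
Proof.
move=> /= F mF tF mUF; rewrite /density_measure; apply: cvg_toP.
  apply: ereal_nondecreasing_is_cvgn => k n kn.
  apply: lee_sum_nneg_natr => // i _ _.
  by apply: integral_ge0 => /= x _; rewrite lee_fin.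
rewrite ge0_integral_bigcup//=.
- by apply: measurable_funTS; exact/measurable_EFinP.
- by move=> x _; rewrite lee_fin.
Qed.

HB.instance Definition _ := isMeasure.Build _ _ _ nu
  nu_set0 nu_ge0 nu_sigma_additive.

Import HBNNSimple.

(** On an indicator this is the definition of [nu]; simple functions follow by linearity, and the
    general case by monotone convergence along [nnsfun_approx]. *)
Lemma integral_density (F : T -> \bar R) : measurable_fun setT F -> (forall x, 0 <= F x) ->
  \int[nu]_x F x = \int[m]_x (F x * (p x)%:E).
Proof.
move=> mF F0; have mp' := (measurable_EFinP setT p).2 mp.
have indicE A : measurable A ->
    \int[nu]_x (\1_A x)%:E = \int[m]_x ((\1_A x)%:E * (p x)%:E).
  move=> mA; rewrite integral_indic//= setIT /density_measure integral_mkcond/=.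
  apply: eq_integral => x _; rewrite patchE indicE.
  by case: ifPn => _; rewrite ?mul1e ?mul0e.
have sfunE (f : {nnsfun T >-> R}) :
    \int[nu]_x (f x)%:E = \int[m]_x ((f x)%:E * (p x)%:E).
  under [LHS]eq_integral do rewrite fimfunE -fsumEFin//.
  rewrite ge0_integral_fsum//; last 2 first.
    by move=> r; exact/measurable_EFinP/measurableT_comp.
    by move=> r x _; rewrite EFinM nnfun_muleindic_ge0.
  under [RHS]eq_integral.
    move=> x _; rewrite fimfunE -fsumEFin// ge0_mule_fsuml; last first.
      by move=> r; rewrite EFinM nnfun_muleindic_ge0.
    over.
  rewrite ge0_integral_fsum//; last 2 first.
    move=> r; apply: emeasurable_funM => //.
    exact/measurable_EFinP/measurableT_comp.
    move=> r x _; apply: mule_ge0; last by rewrite lee_fin.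
    by rewrite EFinM nnfun_muleindic_ge0.
  apply: eq_fsbigr => r /[!inE] -[y _ yr].
  have r0 : (0 <= r)%R by rewrite -yr.
  under eq_integral do rewrite EFinM.
  rewrite ge0_integralZl//; last by apply/measurable_EFinP/measurable_indic.
  rewrite indicE//.
  under [RHS]eq_integral do rewrite EFinM -muleA.
  rewrite ge0_integralZl//.
    by apply: emeasurable_funM => //; exact/measurable_EFinP/measurable_indic.
  by move=> x _; rewrite mule_ge0// lee_fin.
pose f_ := nnsfun_approx measurableT mF.
transitivity (lim (\int[nu]_x (f_ n x)%:E @[n --> \oo])).
  rewrite -monotone_convergence//=.
  - apply: eq_integral => x _; apply/esym/cvg_lim => //=.
    exact: cvg_nnsfun_approx.
  - by move=> n; exact/measurable_EFinP/measurable_funTS.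
  - by move=> n ? _; rewrite lee_fin.
  - by move=> ? _ ? ? mn; rewrite lee_fin; exact/lefP/nd_nnsfun_approx.
transitivity (lim (\int[m]_x ((f_ n x)%:E * (p x)%:E) @[n --> \oo])).
  by apply: congr_lim; apply/funext => n; exact: sfunE.
rewrite -monotone_convergence//=.
- apply: eq_integral => x _; apply/cvg_lim => //=.
  apply: cvgeZr => //.
  exact: cvg_nnsfun_approx.
- move=> n; apply: emeasurable_funM => //.
  exact/measurable_EFinP/measurable_funTS.
- by move=> n ? _; rewrite mule_ge0// lee_fin.
- move=> x _ a b ab; rewrite lee_wpmul2r ?lee_fin//.
  exact/lefP/nd_nnsfun_approx.
Qed.

End density_measure.

(** * Replacing coordinates *)

Section coordinates.
Context {R : realType}.
Implicit Types n : nat.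
Local Notation l1 := (@lebesgue_measure R).
Local Notation leb n := (@lebesgue_rV R n).

Definition upd n (j : 'I_n) (x : 'rV[R]_n) (t : R) : 'rV[R]_n :=
  \row_i (if i == j then t else x ord0 i).

(** Integrating over [z] averages out the coordinates in [r] and leaves a function of the full
    vector [x]. Thus all subsets [r] are treated on one space, without reindexing. *)
Definition mix n (r : {set 'I_n}) (x z : 'rV[R]_n) : 'rV[R]_n :=
  \row_i (if i \in r then z ord0 i else x ord0 i).

Definition proj_coord n d (e : 'I_n -> 'I_d) (x : 'rV[R]_d) : 'rV[R]_n :=
  \row_i x ord0 (e i).

Lemma measurable_coord_comp d (T : measurableType d) n (i : 'I_n)
    (f : T -> 'rV[R]_n) :
  measurable_fun setT f -> measurable_fun setT (fun x => f x ord0 i).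
Proof. by move=> mf; exact: measurableT_comp (measurable_rV_coord i) mf. Qed.

Lemma measurable_upd d (T : measurableType d) n (j : 'I_n) (f : T -> 'rV[R]_n)
    (g : T -> R) : measurable_fun setT f -> measurable_fun setT g ->
  measurable_fun setT (fun x => upd j (f x) (g x)).
Proof.
move=> mf mg; apply: measurable_fun_rV => i.
rewrite (_ : (fun _ => _) = if i == j then g else fun x => f x ord0 i).
  by case: ifP => // _; exact: measurable_coord_comp.
by apply/funext => x; rewrite mxE; case: ifP.
Qed.

Lemma measurable_mix d (T : measurableType d) n (r : {set 'I_n})
    (f g : T -> 'rV[R]_n) : measurable_fun setT f -> measurable_fun setT g ->
  measurable_fun setT (fun x => mix r (f x) (g x)).
Proof.
move=> mf mg; apply: measurable_fun_rV => i.
rewrite (_ : (fun _ => _) =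
  if i \in r then fun x => g x ord0 i else fun x => f x ord0 i).
  by case: ifP => // _; exact: measurable_coord_comp.
by apply/funext => x; rewrite mxE; case: ifP.
Qed.

Lemma measurable_proj_coord d (T : measurableType d) n k (e : 'I_n -> 'I_k)
    (f : T -> 'rV[R]_k) : measurable_fun setT f ->
  measurable_fun setT (fun x => proj_coord e (f x)).
Proof.
move=> mf; apply: measurable_fun_rV => i.
rewrite (_ : (fun _ => _) = fun x => f x ord0 (e i)).
  exact: measurable_coord_comp.
by apply/funext => x; rewrite mxE.
Qed.

Lemma measurable_cons_comp d (T : measurableType d) n (f : T -> R)
    (g : T -> 'rV[R]_n) : measurable_fun setT f -> measurable_fun setT g ->
  measurable_fun setT (fun x => rV_cons (f x, g x)).
Proof.
move=> mf mg.
exact: (measurableT_comp (@measurable_rV_cons R n) (measurable_fun_pair mf mg)).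
Qed.

Local Open Scope ereal_scope.

Lemma integral_rVS n (F : 'rV[R]_n.+1 -> \bar R) :
  measurable_fun setT F -> (forall x, 0 <= F x) ->
  \int[leb n.+1]_x F x = \int[l1]_t \int[leb n]_y F (rV_cons (t, y)).
Proof.
move=> mF F0.
rewrite (_ : \int[leb n.+1]_x F x =
  \int[pushforward (l1 \x leb n) (@rV_cons R n)]_x F x)//.
rewrite ge0_integral_pushforward//; last exact: measurable_rV_cons.
rewrite preimage_setT fubini_tonelli1//=.
exact: (measurableT_comp mF (@measurable_rV_cons R n)).
Qed.

Lemma integral_rV0 (F : 'rV[R]_0 -> \bar R) : measurable_fun setT F ->
  \int[leb 0]_x F x = F 0%R.
Proof. by move=> mF; rewrite /= integral_dirac// diracT mul1e. Qed.

Lemma upd_cons0 n (a t : R) (y : 'rV[R]_n) :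
  upd ord0 (rV_cons (a, y)) t = rV_cons (t, y).
Proof.
apply/rowP => i; rewrite mxE; case: (unliftP ord0 i) => [k|] ->.
  by rewrite lift_eqF !rV_consS.
by rewrite eqxx !rV_cons0.
Qed.

Lemma upd_consS n (j : 'I_n) (a t : R) (y : 'rV[R]_n) :
  upd (lift ord0 j) (rV_cons (a, y)) t = rV_cons (a, upd j y t).
Proof.
apply/rowP => i; rewrite mxE; case: (unliftP ord0 i) => [k|] ->.
  by rewrite (inj_eq lift_inj) !rV_consS mxE.
by rewrite eq_liftF !rV_cons0.
Qed.

Lemma mix_cons n (r : {set 'I_n.+1}) (a b : R) (y z : 'rV[R]_n) :
  mix r (rV_cons (a, y)) (rV_cons (b, z)) =
  rV_cons (if ord0 \in r then b else a, mix [set i | lift ord0 i \in r] y z).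
Proof.
apply/rowP => i; rewrite mxE; case: (unliftP ord0 i) => [k|] ->.
  by rewrite !rV_consS mxE inE.
by rewrite !rV_cons0.
Qed.

End coordinates.

#[local] Opaque lebesgue_rV.

Ltac mfun := repeat first
  [ exact: measurable_fst | exact: measurable_snd | exact: measurable_id
  | exact: measurable_cst
  | apply: measurable_cons_comp | apply: measurable_upd | apply: measurable_mix
  | apply: measurable_coord_comp | apply: measurable_proj_coord
  | apply: measurable_fun_pair
  | match goal with
    | |- measurable_fun _ (fun x => (fst (@?f x))) =>
       apply: (measurableT_comp measurable_fst)
    | |- measurable_fun _ (fun x => (snd (@?f x))) =>
       apply: (measurableT_comp measurable_snd)
    end ].

(** * Invariance of Lebesgue measure under exchange of coordinates *)

Section coordinate_swaps.
Context {R : realType}.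
Implicit Types n : nat.
Local Notation l1 := (@lebesgue_measure R).
Local Notation leb n := (@lebesgue_rV R n).
Local Open Scope ereal_scope.

(** The map exchanging the [j]-th coordinate with the spare variable preserves the product measure.
    The induction peels off the first coordinate; when that is the one exchanged, Tonelli is applied
    three times to transpose it with [t] across the remaining variables. *)
Lemma integral_swap_coord n (j : 'I_n) (G : 'rV[R]_n * R -> \bar R) :
  measurable_fun setT G -> (forall x, 0 <= G x) ->
  \int[leb n]_x \int[l1]_t G (upd j x t, x ord0 j) =
  \int[leb n]_x \int[l1]_t G (x, t).
Proof.
elim: n => [|n IH] in j G *; first by case: j.
move=> mG G0.
have mG1 : measurable_fun setT (fun x => \int[l1]_t G (upd j x t, x ord0 j)).
  apply: (measurable_fun_integral2 (l1)
    (F := fun p => G (upd j p.1 p.2, p.1 ord0 j))).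
  by apply: (measurableT_comp mG); mfun.
have mG2 : measurable_fun setT (fun x => \int[l1]_t G (x, t)).
  by apply: (measurable_fun_integral2 (l1) (F := G)).
rewrite (integral_rVS mG2); last by move=> x; apply: integral_ge0.
rewrite (integral_rVS mG1); last by move=> x; apply: integral_ge0.
case: (unliftP ord0 j) => [k|] ->.
  apply: eq_integral => a _.
  under eq_integral => y _.
    under eq_integral do rewrite upd_consS rV_consS.
    over.
  rewrite (IH k (fun p => G (rV_cons (a, p.1), p.2)))//.
  by apply: (measurableT_comp mG); mfun.
under eq_integral => a _.
  under eq_integral => y _.
    under eq_integral do rewrite upd_cons0 rV_cons0.
    over.
  rewrite (fubini_tonelli (m1 := leb n) (m2 := l1)
    (fun p => G (rV_cons (p.2, p.1), a)))//; last first.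
    by apply: (measurableT_comp mG); mfun.
  over.
rewrite (fubini_tonelli (m1 := l1) (m2 := l1)
    (fun p => \int[leb n]_y G (rV_cons (p.2, y), p.1)))/=; last 2 first.
  - apply: (measurable_fun_integral2 (leb n)
      (F := fun q : (R * R) * 'rV[R]_n => G (rV_cons (q.1.2, q.2), q.1.1))).
    by apply: (measurableT_comp mG); mfun.
  - by move=> x; apply: integral_ge0.
apply: eq_integral => a _.
rewrite (fubini_tonelli (m1 := leb n) (m2 := l1)
    (fun p => G (rV_cons (a, p.1), p.2)))//.
by apply: (measurableT_comp mG); mfun.
Qed.

End coordinate_swaps.

Section coordinate_swaps_mix.
Context {R : realType}.
Implicit Types n : nat.
Local Notation l1 := (@lebesgue_measure R).
Local Notation leb n := (@lebesgue_rV R n).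
Local Open Scope ereal_scope.

(** Two points exchange their coordinates in [r]. Once the two first coordinates are pulled to the
    front, they are either left alone or transposed by Tonelli, and the induction hypothesis handles
    the others. *)
Lemma integral_swap_mix n (r : {set 'I_n}) (G : 'rV[R]_n * 'rV[R]_n -> \bar R) :
  measurable_fun setT G -> (forall x, 0 <= G x) ->
  \int[leb n]_x \int[leb n]_z G (mix r x z, mix r z x) =
  \int[leb n]_x \int[leb n]_z G (x, z).
Proof.
elim: n => [|n IH] in r G *.
  move=> mG G0; apply: eq_integral => x _; apply: eq_integral => z _.
  by congr (G (_, _)); apply/rowP => -[].
move=> mG G0.
have expand (H : 'rV[R]_n.+1 * 'rV[R]_n.+1 -> \bar R) :
    measurable_fun setT H -> (forall x, 0 <= H x) ->
    \int[leb n.+1]_x \int[leb n.+1]_z H (x, z) =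
    \int[l1]_a \int[l1]_b \int[leb n]_y \int[leb n]_z
      H (rV_cons (a, y), rV_cons (b, z)).
  move=> mH H0.
  have mH' : measurable_fun setT (fun x => \int[leb n.+1]_z H (x, z)).
    by apply: (measurable_fun_integral2 (leb n.+1)).
  rewrite (integral_rVS mH'); last by move=> x; apply: integral_ge0.
  apply: eq_integral => a _.
  under eq_integral => y _.
    rewrite (@integral_rVS _ n)//; last first.
      by apply: (measurableT_comp mH); mfun.
    over.
  rewrite (fubini_tonelli (m1 := leb n) (m2 := l1)
    (fun p => \int[leb n]_z H (rV_cons (a, p.1), rV_cons (p.2, z))))//.
  - apply: (measurable_fun_integral2 (leb n)
      (F := fun q : ('rV[R]_n * R) * 'rV[R]_n =>
        H (rV_cons (a, q.1.1), rV_cons (q.1.2, q.2)))).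
    by apply: (measurableT_comp mH); mfun.
  - by move=> x; apply: integral_ge0.
have mGr : measurable_fun [set: 'rV[R]_n.+1 * 'rV[R]_n.+1]
    (fun p => G (mix r p.1 p.2, mix r p.2 p.1)).
  by apply: (measurableT_comp mG); mfun.
apply: (etrans (expand _ mGr (fun=> G0 _))).
apply: (etrans _ (esym (expand _ mG G0))) => /=.
pose c (a b : R) := if ord0 \in r then b else a.
transitivity (\int[l1]_a \int[l1]_b \int[leb n]_y \int[leb n]_z
    G (rV_cons (c a b, y), rV_cons (c b a, z))).
  apply: eq_integral => a _; apply: eq_integral => b _.
  pose r' := [set i | lift ord0 i \in r]%SET.
  transitivity (\int[leb n]_y \int[leb n]_z
      G (rV_cons (c a b, mix r' y z), rV_cons (c b a, mix r' z y))).
    apply: eq_integral => y _; apply: eq_integral => z _.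
    by rewrite !mix_cons.
  apply: (IH r' (fun p => G (rV_cons (c a b, p.1), rV_cons (c b a, p.2)))) => //.
  by apply: (measurableT_comp mG); mfun.
have [r0|r0] := boolP (ord0 \in r); last first.
  suff -> : c = fun a _ => a by [].
  by apply/funext => a; apply/funext => b; rewrite /c (negbTE r0).
have -> : c = fun _ b => b.
  by apply/funext => a; apply/funext => b; rewrite /c r0.
apply: (fubini_tonelli (m1 := l1) (m2 := l1)
    (fun p => \int[leb n]_y \int[leb n]_z
      G (rV_cons (p.2, y), rV_cons (p.1, z)))).
- apply: (measurable_fun_integral2 (leb n)
    (F := fun q : (R * R) * 'rV[R]_n => \int[leb n]_z
      G (rV_cons (q.1.2, q.2), rV_cons (q.1.1, z)))).
  apply: (measurable_fun_integral2 (leb n)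
    (F := fun q : ((R * R) * 'rV[R]_n) * 'rV[R]_n =>
      G (rV_cons (q.1.1.2, q.1.2), rV_cons (q.1.1.1, q.2)))).
  by apply: (measurableT_comp mG); mfun.
- by move=> x; apply: integral_ge0 => y _; apply: integral_ge0.
Qed.

End coordinate_swaps_mix.

Lemma measurable_fun_bigprod d (T : measurableType d) (R : realType)
    (I : Type) (s : seq I) (P : pred I) (f : I -> T -> R) :
  (forall i, measurable_fun setT (f i)) ->
  measurable_fun setT (fun x => \prod_(i <- s | P i) f i x).
Proof.
move=> mf; elim: s => [|i s IH].
  by under eq_fun do rewrite big_nil; exact: measurable_cst.
under eq_fun do rewrite big_cons.
by case: (P i) => //; exact: measurable_funM.
Qed.

(** * Marginals of product densities *)

Section marginals.
Context {R : realType}.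
Implicit Types n : nat.
Local Notation l1 := (@lebesgue_measure R).
Local Notation leb n := (@lebesgue_rV R n).

Definition wprod n (q : 'I_n -> R -> R) (x : 'rV[R]_n) : R :=
  \prod_(i < n) q i (x ord0 i).

Lemma measurable_wprod n (q : 'I_n -> R -> R) :
  (forall i, measurable_fun setT (q i)) -> measurable_fun setT (wprod q).
Proof.
move=> mq; apply: measurable_fun_bigprod => i.
exact: measurableT_comp (mq i) (measurable_rV_coord i).
Qed.

Lemma wprod_ge0 n (q : 'I_n -> R -> R) :
  (forall i t, 0 <= q i t) -> forall x, 0 <= wprod q x.
Proof. by move=> q0 x; exact: prodr_ge0. Qed.

Lemma wprod_mix n (q : 'I_n -> R -> R) (r : {set 'I_n}) x z :
  wprod q (mix r x z) * wprod q (mix r z x) = wprod q x * wprod q z.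
Proof.
rewrite /wprod -!big_split/=; apply: eq_bigr => i _; rewrite !mxE.
by case: ifP => // _; rewrite mulrC.
Qed.

Local Open Scope ereal_scope.

Lemma integral_wprod n (rho : 'I_n -> R -> R) :
  (forall i, is_density (rho i)) -> \int[leb n]_x (wprod rho x)%:E = 1.
Proof.
elim: n => [|n IH] in rho *; move=> drho.
  rewrite integral_rV0; last first.
    by apply/measurable_EFinP; apply: measurable_wprod => i; case: (drho i).
  by rewrite /wprod big_ord0.
have rho0 i t : (0 <= rho i t)%R by apply: ltW; case: (drho i).
have mrho i : measurable_fun setT (rho i) by case: (drho i).
rewrite integral_rVS//; last 2 first.
- apply/measurable_EFinP; exact: measurable_wprod.
- by move=> x; rewrite lee_fin; exact: wprod_ge0.
have [_ _ <-] := drho ord0; apply: eq_integral => t _.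
transitivity (\int[leb n]_y ((rho ord0 t)%:E *
    (wprod (fun i => rho (lift ord0 i)) y)%:E)).
  apply: eq_integral => y _; rewrite /wprod big_ord_recl rV_cons0 EFinM.
  by congr (_ * _%:E)%E; apply: eq_bigr => i _; rewrite rV_consS.
rewrite ge0_integralZl//.
- by rewrite IH ?mule1.
- apply/measurable_EFinP; exact: measurable_wprod.
- by move=> y _; rewrite lee_fin; exact: wprod_ge0.
- by rewrite lee_fin.
Qed.

(** Multiply by the integral 1 of [rho] in a spare variable, then exchange that variable with the
    [j]-th coordinate. A coordinate is thereby integrated out without lowering the dimension: a
    dummy coordinate of density [rho] takes its place. *)
Lemma integral_freeze n (j : 'I_n) (rho : R -> R) (F : 'rV[R]_n -> \bar R) :
  is_density rho -> measurable_fun setT F -> (forall x, 0 <= F x) ->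
  \int[leb n]_x F x =
  \int[leb n]_x ((\int[l1]_t F (upd j x t)) * (rho (x ord0 j))%:E).
Proof.
move=> [mrho rho_gt0 rho1] mF F0.
have rho0 t : (0 <= rho t)%R by exact: ltW.
transitivity (\int[leb n]_x \int[l1]_t (F x * (rho t)%:E)).
  apply: eq_integral => x _; rewrite ge0_integralZl//.
  - by rewrite [X in _ * X]rho1 mule1.
  - exact/measurable_EFinP.
  - by move=> t _; rewrite lee_fin.
transitivity (\int[leb n]_x \int[l1]_t
    (F (upd j x t) * (rho (x ord0 j))%:E)).
  apply/esym; apply: (integral_swap_coord j (G := fun p => F p.1 * (rho p.2)%:E)).
    apply: emeasurable_funM.
      exact: (measurableT_comp mF measurable_fst).
    apply/measurable_EFinP; apply: (measurableT_comp mrho); exact: measurable_snd.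
  by move=> p; rewrite mule_ge0// lee_fin.
apply: eq_integral => x _; rewrite ge0_integralZr//.
- apply: (measurableT_comp mF); mfun.
- by rewrite lee_fin.
Qed.

(** The coordinates that [e] misses carry probability densities and integrate to 1. Allowing [q] to
    differ from [rho] on the range of [e] is what lets the induction on [n] move one coordinate at a
    time from the first kind to the second. *)
Lemma integral_marginal n d (e : 'I_n -> 'I_d) (q rho : 'I_d -> R -> R)
    (F : 'rV[R]_n -> \bar R) : injective e ->
  (forall j, is_density (rho j)) ->
  (forall j, measurable_fun setT (q j)) -> (forall j t, 0 <= q j t)%R ->
  (forall j, (forall i, e i != j) -> q j = rho j) ->
  measurable_fun setT F -> (forall x, 0 <= F x) ->
  \int[leb d]_x (F (proj_coord e x) * (wprod q x)%:E) =
  \int[leb n]_y (F y * (wprod (q \o e) y)%:E).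
Proof.
move=> + drho; elim: n => [|n IH] in e q F *; move=> inj_e mq q0 qE mF F0.
  have -> : q = rho by apply/funext => j; apply: qE => -[].
  rewrite integral_rV0; last first.
    apply: emeasurable_funM => //; apply/measurable_EFinP.
    by apply: measurable_wprod => -[].
  rewrite {2}/wprod big_ord0 mule1.
  transitivity (\int[leb d]_x (F 0%R * (wprod rho x)%:E)).
    apply: eq_integral => x _; congr (F _ * _); by apply/rowP => -[].
  have rho0 i t : (0 <= rho i t)%R by apply: ltW; case: (drho i).
  rewrite ge0_integralZl// ?integral_wprod ?mule1//.
  - by apply/measurable_EFinP; apply: measurable_wprod => j; case: (drho j).
  - by move=> x _; rewrite lee_fin; exact: wprod_ge0.
pose j := e ord0; pose e' i := e (lift ord0 i).
have e'j i : e' i != j by rewrite (inj_eq inj_e) -(inj_eq val_inj).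
have inj_e' : injective e' by move=> a b /inj_e /lift_inj.
(* The coordinate [j] is frozen: its weight [q j] is absorbed into [F'], and the dummy density
   [rho j] replaces it, so that [q'] agrees with [rho] off the range of [e']. *)
pose q' k := if k == j then rho j else q k.
pose F' y := \int[l1]_t (F (rV_cons (t, y)) * (q j t)%:E).
have mFq : measurable_fun [set: 'rV[R]_d]
    (fun x => F (proj_coord e x) * (wprod q x)%:E).
  apply: emeasurable_funM; first by apply: (measurableT_comp mF); mfun.
  apply/measurable_EFinP; exact: measurable_wprod.
rewrite (integral_freeze j (drho j) mFq); last first.
  by move=> x; rewrite mule_ge0// lee_fin wprod_ge0.
transitivity (\int[leb d]_x (F' (proj_coord e' x) * (wprod q' x)%:E)).
  apply: eq_integral => x _.
  pose w := (\prod_(i < d | i != j) q i (x ord0 i))%R.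
  have w0 : (0 <= w)%R by exact: prodr_ge0.
  have -> : wprod q' x = (w * rho j (x ord0 j))%R.
    rewrite /wprod (bigD1 j)//= /q' eqxx mulrC; congr (_ * _)%R.
    by apply: eq_bigr => i /negbTE ->.
  rewrite EFinM muleA; congr (_ * _).
  rewrite /F' -ge0_integralZr//; last 2 first.
  - apply: emeasurable_funM; first by apply: (measurableT_comp mF); mfun.
    by apply/measurable_EFinP; exact: (mq j).
  - by move=> t _; rewrite mule_ge0// lee_fin.
  apply: eq_integral => t _; rewrite -muleA -EFinM; congr (F _ * _%:E).
  - apply/rowP => i; rewrite 2!mxE; case: (unliftP ord0 i) => [k|] ->.
      by rewrite rV_consS mxE (negbTE (e'j k)).
    by rewrite rV_cons0 eqxx.
  - rewrite /wprod (bigD1 j)//= mxE eqxx; congr (_ * _)%R.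
    by apply: eq_bigr => i /negbTE ij; rewrite mxE ij.
rewrite (IH e' q' F')//; last 5 first.
- by move=> k; rewrite /q'; case: ifP => // _; case: (drho j).
- move=> k t; rewrite /q'; case: ifP => // _.
  by apply: ltW; case: (drho j).
- move=> k ek; rewrite /q'; case: eqP => [->//|/eqP kj]; apply: qE => i.
  by case: (unliftP ord0 i) => [i'|] ->; [exact: ek|rewrite eq_sym].
- apply: (measurable_fun_integral2 l1
    (F := fun p : 'rV[R]_n * R => F (rV_cons (p.2, p.1)) * (q j p.2)%:E)).
  apply: emeasurable_funM; first by apply: (measurableT_comp mF); mfun.
  apply/measurable_EFinP; apply: (measurableT_comp (mq j)); exact: measurable_snd.
- by move=> y; apply: integral_ge0 => t _; rewrite mule_ge0// lee_fin.
have mFe : measurable_fun setT (fun y => F y * (wprod (q \o e) y)%:E).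
  apply: emeasurable_funM => //; apply/measurable_EFinP.
  by apply: measurable_wprod => i; exact: mq.
rewrite (integral_rVS mFe); last first.
  by move=> y; rewrite mule_ge0// lee_fin; apply: wprod_ge0 => i t; exact: q0.
pose w' (y : 'rV[R]_n) := wprod (q' \o e') y.
have w'0 y : (0 <= w' y)%R.
  apply: wprod_ge0 => i t; rewrite /= /q' (negbTE (e'j i)); exact: q0.
transitivity (\int[leb n]_y \int[l1]_t
   (F (rV_cons (t, y)) * (q j t)%:E * (w' y)%:E)).
  apply: eq_integral => y _; rewrite /F' ge0_integralZr//.
  - apply: emeasurable_funM; first by apply: (measurableT_comp mF); mfun.
    by apply/measurable_EFinP; exact: (mq j).
  - by move=> t _; rewrite mule_ge0// lee_fin.
  - by rewrite lee_fin.
apply: etrans (fubini_tonelli (m1 := leb n) (m2 := l1)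
  (fun p => F (rV_cons (p.2, p.1)) * (q j p.2)%:E * (w' p.1)%:E) _ _) _.
- apply: emeasurable_funM; last first.
    apply/measurable_EFinP; apply: (measurableT_comp (f := w')) => //.
    apply: measurable_wprod => i; rewrite /= /q' (negbTE (e'j i)); exact: mq.
  apply: emeasurable_funM; first by apply: (measurableT_comp mF); mfun.
  apply/measurable_EFinP; apply: (measurableT_comp (mq j)); exact: measurable_snd.
- by move=> p; rewrite !mule_ge0// lee_fin.
- apply: eq_integral => t _; apply: eq_integral => y _.
  rewrite -muleA -EFinM /wprod big_ord_recl/= rV_cons0; congr (_ * (_ * _)%:E).
  by apply: eq_bigr => i _; rewrite rV_consS /= /q' (negbTE (e'j i)).
Qed.

End marginals.

(** * The product probability *)

Section product_probability.
Context {R : realType}.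
Variables (d : nat) (rho : 'I_d -> R -> R).
Hypothesis rho_density : forall j, is_density (rho j).
Local Notation l1 := (@lebesgue_measure R).
Local Notation X := 'rV[R]_d.

Lemma density_gt0 j t : 0 < rho j t.
Proof. by case: (rho_density j). Qed.

Lemma measurable_density j : measurable_fun setT (rho j).
Proof. by case: (rho_density j). Qed.

Lemma measurable_wprod_density : measurable_fun setT (wprod rho).
Proof. by apply: measurable_wprod => j; exact: measurable_density. Qed.

Lemma wprod_density_gt0 x : 0 < wprod rho x.
Proof. by apply: prodr_gt0 => i _; exact: density_gt0. Qed.

Lemma wprod_density_ge0 x : 0 <= wprod rho x.
Proof. exact/ltW/wprod_density_gt0. Qed.

Definition prodP : set X -> \bar R := density_measure (lebesgue_rV d)
  (measurable_wprod_density, wprod_density_ge0).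

HB.instance Definition _ := Measure.on prodP.

Local Open Scope ereal_scope.

Lemma integral_prodP (F : X -> \bar R) :
  measurable_fun setT F -> (forall x, 0 <= F x) ->
  \int[prodP]_x F x = \int[lebesgue_rV d]_x (F x * (wprod rho x)%:E).
Proof. exact: integral_density. Qed.

Let prodP_setT : prodP setT = 1.
Proof. by rewrite -(integral_wprod rho_density). Qed.

HB.instance Definition _ := @Measure_isProbability.Build _ _ R
  prodP prodP_setT.

(** The return direction, from the probability to Lebesgue measure, rests on the strict positivity
    of the densities: an integral of [wprod rho] over [N] can vanish only if [N] is null. *)
Lemma ae_prodP (Q : X -> Prop) :
  {ae lebesgue_rV d, forall x, Q x} <-> {ae prodP, forall x, Q x}.
Proof.
have mp : measurable_fun setT (fun x : X => (wprod rho x)%:E).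
  by apply/measurable_EFinP; exact: measurable_wprod_density.
split=> -[N [mN N0 QN]]; exists N; split=> //.
  rewrite [LHS]/(density_measure _ _ _) /density_measure.
  by apply: null_set_integral => //; exact: measurable_funTS.
have : \int[lebesgue_rV d]_(x in N) `|(wprod rho x)%:E| = 0.
  rewrite -[RHS]N0; apply: eq_integral => x _.
  by rewrite gee0_abs// lee_fin wprod_density_ge0.
have mpN : measurable_fun N (fun x : X => (wprod rho x)%:E).
  exact: measurable_funTS.
move=> /(ae_eq_integral_abs (lebesgue_rV d) mN mpN).1 -[M [mM M0 NM]].
apply/eqP; rewrite -measure_le0 -M0; apply: le_measure; rewrite ?inE//.
move=> x Nx; apply: NM => /= /(_ Nx)/eqP; rewrite eqe.
by rewrite gt_eqF// wprod_density_gt0.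
Qed.

(** Mixing two independent points of the product probability gives a point of the same law: by
    [wprod_mix] the joint density is unchanged when the coordinates in [r] are exchanged, and
    [integral_swap_mix] says the same of Lebesgue measure. *)
Lemma prodP_preserving_mix (r : {set 'I_d}) (A : set X) : measurable A ->
  (prodP \x prodP) ((fun p => mix r p.1 p.2) @^-1` A) = prodP A.
Proof.
move=> mA.
have mmix : measurable_fun setT (fun p : X * X => mix r p.1 p.2) by mfun.
pose F (x : X) : \bar R := (\1_A x)%:E.
have mF : measurable_fun setT F by apply/measurable_EFinP/measurable_indic.
have F0 x : 0 <= F x by rewrite lee_fin.
have mFm : measurable_fun [set: X * X] (fun p => F (mix r p.1 p.2)).
  exact: measurableT_comp mF mmix.
have mwp1 : measurable_fun [set: X * X] (fun p => (wprod rho p.1)%:E).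
  by apply/measurable_EFinP; apply: (measurableT_comp measurable_wprod_density).
have mwp2 : measurable_fun [set: X * X] (fun p => (wprod rho p.2)%:E).
  by apply/measurable_EFinP; apply: (measurableT_comp measurable_wprod_density).
have wp0 x : 0 <= (wprod rho x)%:E by rewrite lee_fin wprod_density_ge0.
transitivity (\int[prodP \x prodP]_p F (mix r p.1 p.2)).
  rewrite -[RHS]/(\int[prodP \x prodP]_p
    (\1_((fun p => mix r p.1 p.2) @^-1` A) p)%:E) integral_indic ?setIT//.
  by rewrite -[X in measurable X]setTI; exact: mmix.
transitivity (\int[prodP]_x F x); last by rewrite integral_indic ?setIT.
rewrite (fubini_tonelli1 (fun p => F (mix r p.1 p.2)))// /fubini_F.
have mI : measurable_fun setT (fun x : X => \int[prodP]_z F (mix r x z)).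
  exact: (measurable_fun_integral2 prodP mFm).
rewrite (integral_prodP mI); last by move=> x; apply: integral_ge0.
transitivity (\int[lebesgue_rV d]_x \int[lebesgue_rV d]_z
    (F (mix r x z) * (wprod rho (mix r x z))%:E * (wprod rho (mix r z x))%:E)).
  apply: eq_integral => x _ /=; rewrite integral_prodP//; last first.
    by apply: (measurableT_comp mF); mfun.
  rewrite -ge0_integralZr//.
  - apply: eq_integral => z _; rewrite -!muleA -!EFinM.
    by rewrite wprod_mix; congr (_ * _)%:E; rewrite mulrC.
  - apply: emeasurable_funM; first by apply: (measurableT_comp mF); mfun.
    by apply/measurable_EFinP; exact: measurable_wprod_density.
  - by move=> z _; rewrite mule_ge0.
apply: etrans (integral_swap_mix r (G := fun p =>
  F p.1 * (wprod rho p.1)%:E * (wprod rho p.2)%:E) _ _) _.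
- apply: emeasurable_funM => //; apply: emeasurable_funM => //.
  exact: (measurableT_comp mF).
- by move=> p; rewrite !mule_ge0.
rewrite integral_prodP//; apply: eq_integral => x _ /=.
rewrite ge0_integralZl//.
- by rewrite integral_wprod// mule1.
- by apply/measurable_EFinP; exact: measurable_wprod_density.
- by rewrite mule_ge0.
Qed.

(** A version, defined at every point, of the conditional expectation given the coordinates outside
    [r]. *)
Definition cexp (r : {set 'I_d}) (F : X -> \bar R) (x : X) : \bar R :=
  \int[prodP]_z F (mix r x z).

Lemma measurable_cexp r (F : X -> \bar R) :
  measurable_fun [set: X] F -> measurable_fun setT (cexp r F).
Proof.
move=> mF; apply: (measurable_fun_integral2 prodP
  (F := fun p => F (mix r p.1 p.2))).
by apply: (measurableT_comp mF); mfun.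
Qed.

Lemma cexp_ge0 r (F : X -> \bar R) : (forall x, 0 <= F x) -> forall x, 0 <= cexp r F x.
Proof. by move=> F0 x; apply: integral_ge0. Qed.

Lemma integral_cexp r (F : X -> \bar R) : measurable_fun [set: X] F -> (forall x, 0 <= F x) ->
  \int[prodP]_x cexp r F x = \int[prodP]_x F x.
Proof.
move=> mF F0.
have mmix : measurable_fun setT (fun p : X * X => mix r p.1 p.2) by mfun.
rewrite -(integral_preserving mmix (@prodP_preserving_mix r) mF).
rewrite (fubini_tonelli1 (fun p => F (mix r p.1 p.2)))//.
exact: (measurableT_comp mF).
Qed.

Lemma ae_mix r (Q : X -> Prop) : {ae prodP, forall x, Q x} ->
  {ae prodP, forall x, {ae prodP, forall z, Q (mix r x z)}}.
Proof.
move=> aeQ.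
have mmix : measurable_fun setT (fun p : X * X => mix r p.1 p.2) by mfun.
have := ae_preserving mmix (@prodP_preserving_mix r) aeQ.
exact: (@ae_product _ _ _ _ _ prodP prodP (fun p => Q (mix r p.1 p.2))).
Qed.

(** The right side integrates over one point; by [integral_cexp] that point may itself be taken as a
    mixture over [r] of two independent ones, which are then the two points on the left. *)
Lemma cexp_cexp r s (F : X -> \bar R) : measurable_fun [set: X] F -> (forall x, 0 <= F x) ->
  forall x, cexp s (cexp r F) x = cexp (s :|: r) F x.
Proof.
move=> mF F0 x.
have mFx : measurable_fun setT (fun z => F (mix (s :|: r) x z)).
  by apply: (measurableT_comp mF); mfun.
rewrite [RHS]/cexp -[RHS](@integral_cexp r _ mFx)//.
apply: eq_integral => z' _; apply: eq_integral => z _; congr F.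
apply/rowP => i; rewrite !mxE inE.
by case: (i \in r); case: (i \in s).
Qed.

Lemma integral_prodP_proj n (e : 'I_n -> 'I_d) (F : 'rV[R]_n -> \bar R) :
  injective e -> measurable_fun setT F -> (forall y, 0 <= F y) ->
  \int[prodP]_x F (proj_coord e x) =
  \int[lebesgue_rV n]_y (F y * (wprod (rho \o e) y)%:E).
Proof.
move=> inj_e mF F0; rewrite integral_prodP//; last first.
  by apply: (measurableT_comp mF); mfun.
apply: (integral_marginal inj_e rho_density) => //.
- exact: measurable_density.
- by move=> j t; exact/ltW/density_gt0.
Qed.

Lemma integral_prodP_coord j (F : R -> \bar R) :
  measurable_fun setT F -> (forall t, 0 <= F t) ->
  \int[prodP]_x F (x ord0 j) = \int[l1]_t (F t * (rho j t)%:E).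
Proof.
move=> mF F0.
have mF1 : measurable_fun setT (fun y : 'rV[R]_1 => F (y ord0 ord0)).
  exact: measurableT_comp mF (measurable_rV_coord _).
transitivity (\int[prodP]_x
    (fun y : 'rV[R]_1 => F (y ord0 ord0)) (proj_coord (fun=> j) x)).
  by apply: eq_integral => x _; rewrite mxE.
rewrite (integral_prodP_proj _ mF1)//; last by move=> a b _; rewrite !ord1.
have mG : measurable_fun setT (fun y : 'rV[R]_1 =>
    F (y ord0 ord0) * (wprod (rho \o (fun=> j)) y)%:E).
  apply: emeasurable_funM => //; apply/measurable_EFinP.
  by apply: measurable_wprod => i; exact: measurable_density.
rewrite (integral_rVS mG); last first.
  move=> y; rewrite mule_ge0// lee_fin; apply: wprod_ge0 => i t.
  exact/ltW/density_gt0.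
apply: eq_integral => t _; rewrite integral_rV0.
  by rewrite /wprod big_ord1 rV_cons0.
by apply: (measurableT_comp mG); mfun.
Qed.

Lemma cexp1 j (F : X -> \bar R) : measurable_fun [set: X] F -> (forall x, 0 <= F x) ->
  forall x, cexp [set j] F x = \int[l1]_t (F (upd j x t) * (rho j t)%:E).
Proof.
move=> mF F0 x.
rewrite -(@integral_prodP_coord j (fun t => F (upd j x t)))//.
  apply: eq_integral => z _; congr F; apply/rowP => i; rewrite !mxE inE.
  by case: eqP => // ->.
by apply: (measurableT_comp mF); mfun.
Qed.

End product_probability.

(** * Smooth functions of compact support *)

Section smooth_functions.
Context {R : realType}.
Implicit Types (f g : R -> R) (k m n : nat) (a b t : R).

(** Continuity is required of the last derivative only; the earlier ones inherit it from
    differentiability. *)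
Fixpoint Ck k f : Prop :=
  if k is k'.+1 then (forall t, derivable f t 1) /\ Ck k' (derive1 f)
  else continuous f.

Lemma derivable1_continuous f : (forall t, derivable f t 1) -> continuous f.
Proof.
by move=> df t; apply/differentiable_continuous/derivable1_diffP.
Qed.

Lemma Ck_S k f : Ck k.+1 f -> Ck k f.
Proof.
elim: k f => [|k IH] f; first by move=> [/derivable1_continuous].
by move=> [df /IH].
Qed.

Lemma Ck_D k f g : Ck k f -> Ck k g -> Ck k (f \+ g).
Proof.
elim: k f g => [|k IH] f g.
  by move=> cf cg t; apply: cvgD; [exact: cf|exact: cg].
move=> [df cf] [dg cg]; split; first by move=> t; exact: derivableD.
rewrite (_ : derive1 _ = derive1 f \+ derive1 g); first exact: IH.
by apply/funext => t; rewrite /= !derive1E; exact: deriveD.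
Qed.

Lemma Ck_Z k c f : Ck k f -> Ck k (fun t => c * f t).
Proof.
elim: k f => [|k IH] f.
  by move=> cf t; apply: cvgM; [exact: cvg_cst|exact: cf].
move=> [df cf]; split.
  by move=> t; apply: (@derivableM _ _ (cst c) f) => //; exact: derivable_cst.
rewrite (_ : derive1 _ = (fun t => c * derive1 f t)); first exact: IH.
by apply/funext => t; rewrite derive1Ml.
Qed.

Lemma Ck_M k f g : Ck k f -> Ck k g -> Ck k (f \* g).
Proof.
elim: k f g => [|k IH] f g.
  by move=> cf cg t; apply: cvgM; [exact: cf|exact: cg].
move=> cf cg; have [df cf'] := cf; have [dg cg'] := cg.
split; first by move=> t; exact: derivableM.
rewrite (_ : derive1 _ = (f \* derive1 g) \+ (g \* derive1 f)).
  by apply: Ck_D; apply: IH => //; exact: Ck_S.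
by apply/funext => t; rewrite /= !derive1E; exact: deriveM.
Qed.

Lemma is_derive_comp1 f g t df dg :
  is_derive t 1 f df -> is_derive (f t) 1 g dg ->
  is_derive t 1 (g \o f) (dg * df).
Proof.
move=> [df1 <-] [dg1 <-]; apply: DeriveDef.
  apply/derivable1_diffP/differentiable_comp; exact/derivable1_diffP.
by have := derive1_comp df1 dg1; rewrite !derive1E.
Qed.

Lemma is_derive_affine a b t : is_derive t 1 (fun s => a * s + b) a.
Proof.
have -> : (fun s => a * s + b) = (a \*: id) + cst b by [].
by apply: is_derive_eq; rewrite addr0 /GRing.scale/= mulr1.
Qed.

Lemma Ck_affine k f a b : Ck k f -> Ck k (fun t => f (a * t + b)).
Proof.
elim: k f => [|k IH] f.
  move=> cf t; apply: (@continuous_comp _ _ _ (fun t => a * t + b) f).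
    apply: derivable1_continuous => s.
    by have [] := is_derive_affine a b s.
  exact: cf.
move=> [df cf]; have d t : is_derive t 1 (fun t => f (a * t + b))
    (derive1 f (a * t + b) * a).
  apply: (@is_derive_comp1 (fun s => a * s + b) f); first exact: is_derive_affine.
  by apply: DeriveDef; [exact: df|rewrite derive1E].
split; first by move=> t; have [] := d t.
rewrite (_ : derive1 _ = (fun t => a * derive1 f (a * t + b))).
  exact/Ck_Z/IH.
by apply/funext => t; have [_] := d t; rewrite -derive1E => ->; rewrite mulrC.
Qed.

(** The classical exp(-1/t) is the case [m = 0]. The powers of 1/t are included so that the family
    is closed under differentiation up to linear combinations, which gives smoothness of every
    member by induction. *)
Definition flat m t : R := if 0 < t then t^-1 ^+ m * expR (- t^-1) else 0.

Lemma flat_ge0 m t : 0 <= flat m t.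
Proof.
rewrite /flat; case: ifPn => // t0.
by rewrite mulr_ge0 ?expR_ge0// exprn_ge0// invr_ge0 ltW.
Qed.

Lemma flat0 m t : t <= 0 -> flat m t = 0.
Proof. by rewrite /flat ltNge => ->. Qed.

Lemma flat_gt0 m t : 0 < t -> 0 < flat m t.
Proof. by move=> t0; rewrite /flat t0 mulr_gt0 ?expR_gt0// exprn_gt0// invr_gt0. Qed.

Lemma flat0_le1 t : flat 0 t <= 1.
Proof.
rewrite /flat expr0 mul1r; case: ifPn => // t0.
by rewrite expR_le1 oppr_le0 invr_ge0 ltW.
Qed.

Lemma flat_le m t : flat m t <= (m.+1)`!%:R * `|t|.
Proof.
rewrite /flat; case: ifPn => [t0|]; last by move=> _; rewrite mulr_ge0.
have ti0 : 0 <= t^-1 by rewrite invr_ge0 ltW.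
have /(le_trans _) h := expR_ge1Dxn m ti0.
have {}h : t^-1 ^+ m.+1 / m.+1`!%:R <= expR t^-1.
  by apply: h; rewrite lerDr.
rewrite expRN ler_pdivrMr ?expR_gt0// gtr0_norm// -mulrA mulrC.
rewrite -ler_pdivrMr ?ltr0n ?fact_gt0//.
apply: le_trans (ler_wpM2l (ltW t0) h).
by rewrite exprS !mulrA divff ?mul1r ?gt_eqF.
Qed.

Lemma flatS m t : t^-1 * flat m t = flat m.+1 t.
Proof. by rewrite /flat; case: ifPn => _; rewrite ?mulr0// mulrA -exprS. Qed.

(** At 0 the difference quotient of [flat m] is [flat m.+1], and [flat_le] squeezes it to 0;
    elsewhere the function is locally zero or the chain rule applies to 1/t. *)
Lemma is_derive_flat m t :
  is_derive t 1 (flat m) (- m%:R * flat m.+1 t + flat m.+2 t).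
Proof.
have [t0|t0|->] := ltgtP t 0.
- apply: (@near_eq_is_derive _ _ _ (cst 0)).
    near=> s; rewrite flat0// ltW//.
    by near: s; exact: lt_nbhsl.
  by rewrite !flat0 ?ltW// mulr0 addr0; exact: is_derive_cst.
- pose G (s : R) := s ^+ m * expR (- s).
  apply: (@near_eq_is_derive _ _ _ (G \o GRing.inv)).
    near=> s; rewrite /flat /G/= ifT//.
    by near: s; exact: lt_nbhsr.
  have dinv : is_derive t 1 GRing.inv (- t^-1 ^+ 2).
    have dt : derivable (id : R -> R) t 1 by exact: derivable_id.
    have tn0 : (id : R -> R) t != 0 by rewrite gt_eqF.
    apply: DeriveDef; first exact: (derivableV tn0 dt).
    apply: (etrans (deriveV tn0 dt)).
    by rewrite derive_id /GRing.scale/= mulr1 exprVn.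
  have dG (s : R) : is_derive s 1 G (m%:R * s ^+ m.-1 * expR (- s) - s ^+ m * expR (- s)).
    have dexp : is_derive s 1 (fun s => expR (- s)) (expR (- s) * - 1).
      exact: (@is_derive_comp1 -%R expR).
    have dX : is_derive s 1 (fun s => s ^+ m) (m%:R * s ^+ m.-1).
      apply: DeriveDef; first exact: exprn_derivable.
      by rewrite exp_derive /GRing.scale/= mulr1.
    have [h1 h2] := is_deriveM dX dexp.
    apply: DeriveDef; [exact: h1|apply: (etrans h2)].
    by rewrite /GRing.scale/= mulrN1 mulrN addrC mulrC.
  have [h1 h2] := is_derive_comp1 dinv (dG t^-1).
  apply: DeriveDef; [exact: h1|apply: (etrans h2)].
  rewrite /flat t0; set u := t^-1.
  clear; case: m => [|m].
    by rewrite !mul0r oppr0 !mul0r !add0r expr0 mul1r mulrNN mulrC.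
  by rewrite /= !exprS; ring.
- rewrite !flat0// mulr0 addr0.
  have cv : h^-1 *: (flat m (h *: 1 + 0) - flat m 0) @[h --> (0 : R)^'] --> (0 : R).
    rewrite (_ : (fun h => _) = flat m.+1); last first.
      apply/funext => h; rewrite [flat m 0]flat0// subr0 addr0.
      by rewrite /GRing.scale/= mulr1 flatS.
    have cv0 : (m.+2)`!%:R * `|h| @[h --> (0 : R)^'] --> (0 : R).
      rewrite -[X in _ --> X](mulr0 (m.+2)`!%:R); apply: cvgM; first exact: cvg_cst.
      rewrite -[X in _ --> X](@normr0 _ R); apply: cvg_norm.
      exact: cvg_within.
    apply: (@squeeze_cvgr _ _ _ _ (cst 0) _ _ _ _ _ cv0); last exact: cvg_cst.
    by near=> h; rewrite flat_ge0 flat_le.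
  apply: DeriveDef; first by apply/cvg_ex; exists 0.
  by rewrite /derive; apply/cvg_lim.
Unshelve. all: by end_near. Qed.

Lemma Ck_flat k m : Ck k (flat m).
Proof.
have d m' t : derivable (flat m') t 1 by have [] := is_derive_flat m' t.
elim: k m => [|k IH] m; first exact: derivable1_continuous.
split => //.
rewrite (_ : derive1 _ = (fun t => - m%:R * flat m.+1 t) \+ flat m.+2).
  by apply: Ck_D => //; exact: Ck_Z.
by apply/funext => t; rewrite derive1E; have [_ ->] := is_derive_flat m t.
Qed.

Definition test1 f := (forall k, Ck k f) /\
  exists2 M, 0 < M & forall t, M < `|t| -> f t = 0.

Lemma test1_continuous f : test1 f -> continuous f.
Proof. by move=> [/(_ 0%N)]. Qed.

Lemma test1_bounded f : test1 f -> exists2 B, 0 < B & forall t, `|f t| <= B.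
Proof.
move=> tf; have [_ [M M0 fM]] := tf; have cf := test1_continuous tf.
have ab : - M <= M by lra.
have cnf : {within `[- M, M], continuous (fun t => `|f t|)}.
  by apply: continuous_subspaceT => t; apply: cvg_norm; exact: cf.
have [c _ fc] := EVT_max ab cnf.
exists (`|f c| + 1); first by rewrite ltr_wpDl.
move=> t; have [tM|/fM ->] := leP `|t| M; last by rewrite normr0 addr_ge0.
have /fc : t \in `[- M, M] by rewrite in_itv/= -ler_norml.
by move=> /le_trans; apply; rewrite lerDl.
Qed.

(** A smooth approximation of the indicator of ]a, b[: for c > 0 the value exp(-1/((n + 1) c)) tends
    to 1, while the set of nonvanishing does not depend on [n]. *)
Definition bump a b n t := flat 0 (n.+1%:R * (t - a)) * flat 0 (n.+1%:R * (b - t)).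

Lemma bump_ge0 a b n t : 0 <= bump a b n t.
Proof. by rewrite mulr_ge0 ?flat_ge0. Qed.

Lemma bump_le1 a b n t : bump a b n t <= 1.
Proof. by rewrite mulr_ile1 ?flat_ge0 ?flat0_le1. Qed.

Lemma bump_out a b n t : ~~ (a < t < b) -> bump a b n t = 0.
Proof.
rewrite negb_and -!leNgt => /orP[ta|bt]; rewrite /bump.
  by rewrite [X in X * _]flat0 ?mul0r// pmulr_rle0 ?subr_le0// ltr0n.
by rewrite [X in _ * X]flat0 ?mulr0// pmulr_rle0 ?subr_le0// ltr0n.
Qed.

Lemma bump_gt0 a b n t : a < t < b -> 0 < bump a b n t.
Proof.
move=> /andP[ta tb].
by rewrite /bump mulr_gt0// flat_gt0// mulr_gt0 ?ltr0n// subr_gt0.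
Qed.

Lemma test1_bump a b n : test1 (bump a b n).
Proof.
split=> [k|].
  rewrite (_ : bump a b n = (fun t => flat 0 (n.+1%:R * t + - (n.+1%:R * a))) \*
    (fun t => flat 0 (- n.+1%:R * t + n.+1%:R * b))).
    by apply: Ck_M; apply: Ck_affine; exact: Ck_flat.
  by apply/funext => t; rewrite /bump/= mulrBr; congr (_ * flat _ _); ring.
exists (`|a| + `|b| + 1) => [|t]; first by rewrite ltr_wpDl// addr_ge0.
have := ler_norm a; have := ler_norm b; have := ler_norm (- a).
have := ler_norm (- b); rewrite !normrN => b1 a1 b2 a2.
rewrite lter_normr => tM; apply: bump_out; apply/negP => /andP[at_ tb].
by move: tM => /orP[]; lra.
Qed.

Lemma bump_cvg a b t :
  bump a b n t @[n --> \oo] --> (\1_`]a, b[%classic t : R).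
Proof.
rewrite indicE; have [tab|] := boolP (t \in `]a, b[%classic); last first.
  rewrite notin_setE/= in_itv/= => /negP tab.
  by apply: cvg_near_cst; apply: nearW => n; exact: bump_out.
have flat1 (c : R) : 0 < c -> flat 0 (n.+1%:R * c) @[n --> \oo] --> (1 : R).
  move=> c0; rewrite (_ : (fun n => _) = (fun n => expR (- (c^-1 * n.+1%:R^-1)))).
    rewrite -[X in _ --> X]expR0.
    apply: (@continuous_cvg _ _ _ _ _ _ expR); first exact: continuous_expR.
    rewrite -[X in _ --> X]oppr0; apply: cvgN.
    rewrite -[X in _ --> X](mulr0 c^-1); apply: cvgM; first exact: cvg_cst.
    exact: cvg_harmonic.
  apply/funext => n; rewrite /flat mulr_gt0 ?ltr0n// expr0 mul1r invfM mulrC.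
  by [].
move: tab; rewrite inE/= in_itv/= => /andP[ta tb].
rewrite -[X in _ --> X](mulr1 1).
by apply: cvgM; apply: flat1; rewrite subr_gt0.
Qed.

End smooth_functions.

(** * One-dimensional test functions and their primitives *)

Section smooth_integrals.
Context {R : realType}.
Local Notation l1 := (@lebesgue_measure R).
Implicit Types (f g : R -> R).

Lemma test1_measurable f : test1 f -> measurable_fun setT f.
Proof. by move=> /test1_continuous; exact: continuous_measurable_fun. Qed.

Lemma bounded_support_integrable f (M B : R) : measurable_fun setT f ->
  (forall t, `|f t| <= B) -> (forall t, M < `|t| -> f t = 0) ->
  l1.-integrable setT (EFin \o f).
Proof.
move=> mf fB fM.
have B0 : 0 <= B by apply: le_trans (fB 0).
apply: (@le_integrable _ _ _ l1 setT measurableT (EFin \o f)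
    (fun t : R => (B * \1_`[- M, M]%classic t)%:E)) => //.
- exact/measurable_EFinP.
- move=> t _; rewrite /= lee_fin indicE.
  have [tM|/fM ->] := leP `|t| M.
    rewrite mem_set /= ?in_itv/= -?ler_norml// mulr1 (ger0_norm B0).
    exact: fB.
  by rewrite normr0.
- under eq_fun do rewrite EFinM.
  apply: integrableZl => //.
  exact: integrable_indic_itv.
Qed.

Lemma test1_integrable f : test1 f -> l1.-integrable setT (EFin \o f).
Proof.
move=> tf; have [_ [M _ fM]] := tf; have [B _ fB] := test1_bounded tf.
exact: (bounded_support_integrable (test1_measurable tf) fB fM).
Qed.

Lemma test1_lincomb a f g :
  test1 f -> test1 g -> test1 (fun t => f t - a * g t).
Proof.
move=> [cf [M M0 fM]] [cg [N N0 gN]]; split.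
  move=> k; rewrite (_ : (fun _ => _) = f \+ (fun t => (- a) * g t)).
    by apply: Ck_D => //; exact: Ck_Z.
  by apply/funext => t /=; rewrite mulNr.
exists (M + N); first exact: addr_gt0.
by move=> t MNt; rewrite fM ?gN ?mulr0 ?subr0//; lra.
Qed.

Lemma Rintegral_bump_gt0 (a b : R) n : a < b -> 0 < \int[l1]_t bump a b n t.
Proof.
move=> ab; have ib := test1_integrable (test1_bump a b n).
have b0 t : 0 <= bump a b n t by exact: bump_ge0.
rewrite lt_neqAle Rintegral_ge0// andbT eq_sym; apply/negP => /eqP I0.
have mb : measurable_fun setT (EFin \o bump a b n) by case/integrableP: ib.
have : (\int[l1]_t `|(bump a b n t)%:E| = 0)%E.
  transitivity (\int[l1]_t (bump a b n t)%:E)%E.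
    by apply: eq_integral => t _; rewrite gee0_abs// lee_fin.
  by rewrite -(fineK (integrable_fin_num measurableT ib)) [fine _]I0.
move=> h0; have [N [mN N0 bN]] := (ae_eq_integral_abs l1 measurableT mb).1 h0.
have : (l1 `]a, b[%classic <= l1 N)%E.
  apply: le_measure; rewrite ?inE// => t /=; rewrite in_itv/= => tab.
  apply: bN => /= /(_ I) [] /eqP; apply/negP.
  by rewrite gt_eqF// bump_gt0.
rewrite N0 lebesgue_measure_itv/= lte_fin ab -EFinB lee_fin.
by rewrite leNgt subr_gt0 ab.
Qed.

Definition primitive f t := \int[l1]_(s in `]-oo, t]) f s.

Lemma is_derive_primitive f t : l1.-integrable setT (EFin \o f) ->
  continuous f -> derivable (primitive f) t 1 /\ derive1 (primitive f) t = f t.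
Proof.
move=> fi cf.
have fi' : l1.-integrable [set` Interval -oo%O (BRight (t + 1))] (EFin \o f).
  exact: integrableS fi.
have tt1 : t < t + 1 by rewrite ltrDl.
by apply: (continuous_FTC1 tt1 fi' _ (cf t)); rewrite ltNyr.
Qed.

(** To the left of the support the primitive vanishes in any case; to the right it equals the total
    integral, which is why the mean has to be 0. *)
Lemma primitive_out f M t : l1.-integrable setT (EFin \o f) ->
  (forall s, M < `|s| -> f s = 0) -> \int[l1]_s f s = 0 ->
  M < `|t| -> primitive f t = 0.
Proof.
move=> fi fM f0; rewrite lter_normr => /orP[Mt|Mt].
  rewrite -f0 /primitive Rintegral_mkcond; apply: eq_Rintegral => s _.
  rewrite patchE; case: ifPn => //; rewrite notin_setE/= in_itv/= => /negP.
  rewrite -ltNge => ts; rewrite fM// lter_normr (lt_trans Mt)//.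
rewrite /primitive Rintegral_mkcond /Rintegral integral0_eq// => s _.
rewrite patchE; case: ifPn => //; rewrite inE/= in_itv/= => st.
by rewrite fM// lter_normr orbC; have -> : M < - s by lra.
Qed.

Lemma test1_primitive f : test1 f -> \int[l1]_s f s = 0 ->
  test1 (primitive f) /\ derive1 (primitive f) = f.
Proof.
move=> tf f0; have fi := test1_integrable tf; have cf := test1_continuous tf.
have d t := is_derive_primitive t fi cf.
have dE : derive1 (primitive f) = f.
  by apply/funext => t; have [] := d t.
split=> //; have [sf [M M0 fM]] := tf; split.
  case=> [|k]; first by apply: derivable1_continuous => t; have [] := d t.
  by split; [move=> t; have [] := d t|rewrite dE].
by exists M => // t; exact: primitive_out.
Qed.

End smooth_integrals.

(** * Tensor products of one-dimensional test functions *)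

Section product_test_functions.
Context {R : realType} {d : nat}.
Implicit Types (phi : 'I_d -> R -> R).
Local Notation X := 'rV[R]_d.

Definition der_on (u : pred 'I_d) phi i := if u i then derive1 (phi i) else phi i.

Lemma continuous_wprod phi : (forall i, continuous (phi i)) ->
  continuous (wprod phi).
Proof.
move=> cphi; rewrite /wprod.
elim: (index_enum _) => [|i s IH] x.
  rewrite (_ : (fun _ => _) = cst 1); first exact: cst_continuous.
  by apply/funext => y; rewrite big_nil.
rewrite (_ : (fun _ => _) = fun y : X => phi i (y ord0 i) *
    \prod_(j <- s) phi j (y ord0 j)); last first.
  by apply/funext => y; rewrite big_cons.
have c1 : {for x, continuous (fun y : X => phi i (y ord0 i))}.
  by apply: continuous_comp; [exact: coord_continuous|exact: cphi].
exact: (continuousM c1 (IH x)).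
Qed.

Lemma wprod_growth phi (j : 'I_d) (x : X) (h : R) :
  h^-1 *: ((wprod phi \o shift x) (h *: delta_mx ord0 j) - wprod phi x) =
  (\prod_(i < d | i != j) phi i (x ord0 i)) *
  (h^-1 *: ((phi j \o shift (x ord0 j)) (h *: 1) - phi j (x ord0 j))).
Proof.
rewrite /wprod/= (bigD1 j)//= [X in _ - X](bigD1 j)//=.
rewrite (eq_bigr (fun i => phi i (x ord0 i))); last first.
  by move=> i ij; rewrite !mxE eqxx (negbTE ij) mulr0 add0r.
by rewrite !mxE !eqxx -mulrBl /GRing.scale/= mulrA mulrC.
Qed.

Lemma pderiv_wprod phi j : (forall t, derivable (phi j) t 1) ->
  (forall x, derivable (wprod phi) x (delta_mx ord0 j)) /\
  pderiv j (wprod phi) = wprod (der_on (pred1 j) phi).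
Proof.
move=> dphi.
have cv (x : X) : h^-1 *: ((wprod phi \o shift x) (h *: delta_mx ord0 j) - wprod phi x)
    @[h --> (0 : R)^'] --> wprod (der_on (pred1 j) phi) x.
  rewrite (_ : wprod (der_on _ _) x =
      (\prod_(i < d | i != j) phi i (x ord0 i)) * derive1 (phi j) (x ord0 j)).
    rewrite (_ : (fun h => _) = fun h => (\prod_(i < d | i != j) phi i (x ord0 i)) *
      (h^-1 *: ((phi j \o shift (x ord0 j)) (h *: 1) - phi j (x ord0 j)))).
      apply: cvgM; first exact: cvg_cst.
      by rewrite derive1E; exact: dphi.
    by apply/funext => h; exact: wprod_growth.
  rewrite /wprod (bigD1 j)//= mulrC; congr (_ * _).
    by apply: eq_bigr => i ij; rewrite /der_on/= (negbTE ij).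
  by rewrite /der_on/= eqxx.
split=> [x|]; first by apply/cvg_ex; eexists; exact: cv.
by apply/funext => x; apply/cvg_lim => //; exact: cv.
Qed.

Lemma continuously_diff_wprod phi k : (forall i n, Ck n (phi i)) ->
  continuously_diff k (wprod phi).
Proof.
elim: k phi => [|k IH] phi Cphi.
  by split=> //; apply: continuous_wprod => i; exact: (Cphi i 0%N).
split; first by apply: continuous_wprod => i; exact: (Cphi i 0%N).
move=> j; have dphi t : derivable (phi j) t 1 := (Cphi j 1%N).1 t.
have [dw ->] := pderiv_wprod dphi; split=> //; apply: IH => i n.
by rewrite /der_on; case: ifP => // _; exact: (Cphi i n.+1).2.
Qed.

(** [enum u] has no repetition, so each factor is differentiated at most once and the factor met at
    each step is still the original one. *)
Lemma mderiv_wprod (u : {set 'I_d}) phi : (forall i n, Ck n (phi i)) ->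
  mderiv u (wprod phi) = wprod (der_on (mem u) phi).
Proof.
move=> Cphi; rewrite /mderiv.
have -> : der_on (mem u) phi = der_on (mem (enum u)) phi.
  by apply/funext => i; rewrite /der_on/= mem_enum.
elim: (enum u) (enum_uniq u) => [|j s IH]/=.
  by move=> _; congr wprod.
move=> /andP[js us]; rewrite IH//.
have djs : der_on (mem s) phi j = phi j by rewrite /der_on/= (negbTE js).
have dphi t : derivable (der_on (mem s) phi j) t 1.
  by rewrite djs; exact: (Cphi j 1%N).1.
have [_ ->] := pderiv_wprod dphi; congr wprod; apply/funext => i.
rewrite /der_on/= in_cons; case: eqP => [->|//]/=.
by rewrite (negbTE js).
Qed.

Lemma test_function_wprod phi : (forall i, test1 (phi i)) ->
  test_function (wprod phi).
Proof.
move=> tphi; split.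
  by move=> k; apply: continuously_diff_wprod => i n; case: (tphi i).
have /fin_all_exists[M HM] : forall i, exists M : R, 0 < M /\
    forall t, M < `|t| -> phi i t = 0.
  by move=> i; have [_ [M M0 pM]] := tphi i; exists M.
pose K := [set v : X | forall i, (`[- M i, M i]%classic : set R) (v ord0 i)].
have cK : compact K.
  apply: (@rV_compact R d (fun i => `[- M i, M i]%classic)) => i.
  exact: segment_compact.
apply: (subclosed_compact _ cK); first exact: closed_closure.
rewrite [X in _ `<=` X](proj1 (closure_id K)); last exact: compact_closed.
apply: closure_subset => x /= xn0 i; rewrite /= in_itv/= -ler_norml leNgt.
apply/negP => /(proj2 (HM i)) phi0; move: xn0.
by rewrite /wprod (bigD1 i)//= phi0 mul0r eqxx.
Qed.

End product_test_functions.

(** * Functions orthogonal to all tensor products vanish *)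

Section boxes.
Context {R : realType} {d : nat}.
Local Notation X := 'rV[R]_d.
Local Notation mu := (@lebesgue_rV R d).
Implicit Types (a b : 'I_d -> R) (G : X -> R).

Definition box a b : set X := [set x | forall i, a i < x ord0 i < b i].

Definition boxes : set (set X) := [set A | exists a b, A = box a b].

Definition cube (M : R) : set X := box (fun=> - M) (fun=> M).

Lemma indic_box a b (x : X) :
  wprod (fun i => \1_`]a i, b i[%classic) x = \1_(box a b) x :> R.
Proof.
rewrite indicE; have [/set_mem xab|xab] := boolP (x \in box a b).
  rewrite /wprod big1// => i _.
  by rewrite indicE mem_set//= in_itv/= xab.
have /existsNP[i xi] : ~ forall i, a i < x ord0 i < b i.
  by move=> h; move/negP: xab; apply; rewrite inE.
rewrite /wprod (bigD1 i)//= indicE memNset ?mul0r//=.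
Qed.

Lemma measurable_box a b : measurable (box a b).
Proof.
apply/(measurable_indicP R).
rewrite (_ : \1_(box a b) = wprod (fun i => \1_`]a i, b i[%classic)).
  by apply: measurable_wprod => i; exact: measurable_indic.
by apply/funext => x; rewrite indic_box.
Qed.

Lemma boxI a b a' b' :
  box a b `&` box a' b' = box (fun i => Num.max (a i) (a' i)) (fun i => Num.min (b i) (b' i)).
Proof.
apply/seteqP; split => [x [h h'] i|x h].
  by rewrite gt_max lt_min; have /andP[-> ->] := h i; have /andP[-> ->] := h' i.
by split=> i; have := h i; rewrite gt_max lt_min => /andP[/andP[? ?] /andP[? ?]];
  apply/andP.
Qed.

Lemma setI_closed_boxes : setI_closed boxes.
Proof.
by move=> _ _ [a [b ->]] [a' [b' ->]]; rewrite boxI; eexists; eexists.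
Qed.

Lemma cube_cover : \bigcup_n cube n%:R = [set: X].
Proof.
apply/seteqP; split => // x _.
pose M : R := \sum_i `|x ord0 i|.
have [n Mn] : exists n : nat, M < n%:R.
  by exists (Num.bound M); apply: archi_boundP; exact: sumr_ge0.
exists n => // i /=; rewrite -ltr_norml; apply: le_lt_trans Mn.
by rewrite /M (bigD1 i)//= lerDl sumr_ge0.
Qed.

(** A slab bounding a single coordinate is the countable union of the boxes that bound the other
    coordinates by [n]; hence every coordinate is measurable for the sigma-algebra of boxes. *)
Lemma measurable_boxesE : @measurable _ X = <<s boxes >>.
Proof.
apply/seteqP; split; last first.
  apply: smallest_sub; first exact: sigma_algebra_measurable.
  by move=> _ [a [b ->]]; exact: measurable_box.
pose T' := g_sigma_algebraType boxes.
have mid : measurable_fun [set: T'] (id : T' -> X).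
  apply: measurable_fun_rV => i.
  apply: (measurability _ (RGenOpens.measurableE R)).
  move=> _ [_ [s [t ->]] <-]; rewrite setTI.
  pose A n := box (fun k => if k == i then s else - n%:R)
    (fun k => if k == i then t else n%:R).
  have -> : (fun x : T' => (id x : X) ord0 i) @^-1` `]s, t[%classic = \bigcup_n A n.
    apply/seteqP; split => [x|x [n _ /(_ i)]]; last by rewrite /= eqxx in_itv.
    rewrite /= in_itv/= => xst; have [n _ xn] : (\bigcup_n cube n%:R) (x : X) by rewrite cube_cover.
    by exists n => // k; case: eqP => [->//|_]; exact: xn.
  apply: bigcupT_measurable => n; apply: sub_sigma_algebra.
  by eexists; eexists.
move=> A mA; have := mid measurableT A mA.
by rewrite setTI.
Qed.

Definition box_integrable G := measurable_fun setT G /\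
  forall M, mu.-integrable (cube M) (EFin \o G).

(** The products of bumps converge pointwise to the indicator of the box and are dominated by the
    indicator of a cube on which [G] is integrable. *)
Lemma integral_box_eq0 G a b : box_integrable G ->
  (forall phi, (forall i, test1 (phi i)) ->
    (\int[mu]_x (G x * wprod phi x)%:E = 0)%E) ->
  (\int[mu]_(x in box a b) (G x)%:E = 0)%E.
Proof.
move=> [mG iG] G0.
pose M : R := \sum_i (`|a i| + `|b i|).
have boxM : box a b `<=` cube M.
  move=> x xab i; have /andP[ax xb] := xab i; rewrite -ltr_norml.
  apply: (@lt_le_trans _ _ (`|a i| + `|b i|)); last first.
    by rewrite /M (bigD1 i)//= lerDl sumr_ge0.
  have := ler_norm (b i); have := ler_norm (- a i); rewrite normrN => h1 h2.
  have := normr_ge0 (a i); have := normr_ge0 (b i) => h3 h4.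
  by rewrite ltr_norml; apply/andP; split; lra.
pose f_ n (x : X) := (G x * wprod (fun i => bump (a i) (b i) n) x)%:E.
pose f (x : X) := (G x * \1_(box a b) x)%:E.
pose g := (abse \o (EFin \o G)) \_ (cube M).
have wb n (x : X) : 0 <= wprod (fun i => bump (a i) (b i) n) x <= 1.
  apply: (big_ind (fun y : R => 0 <= y <= 1)) => [|u v /andP[u0 u1] /andP[v0 v1]|i _].
  - by rewrite ler01 lexx.
  - by rewrite mulr_ge0// mulr_ile1.
  - by rewrite bump_ge0 bump_le1.
have wb0 n (x : X) : ~ box a b x -> wprod (fun i => bump (a i) (b i) n) x = 0 :> R.
  move=> /existsNP[i xi]; rewrite /wprod (bigD1 i)//= bump_out ?mul0r//.
  exact/negP.
have mw n : measurable_fun setT (wprod (fun i => bump (a i) (b i) n)).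
  by apply: measurable_wprod => i; apply: test1_measurable; exact: test1_bump.
have mcube : measurable (cube M) by exact: measurable_box.
have [] := @dominated_convergence _ _ _ mu setT measurableT f_ f g.
- by move=> n; apply/measurable_EFinP; apply: measurable_funM.
- apply/measurable_EFinP; apply: measurable_funM => //.
  by apply: measurable_indic; exact: measurable_box.
- apply: aeW => x _; apply: cvg_EFin; first exact: nearW.
  apply: cvgM; first exact: cvg_cst.
  rewrite -indic_box /wprod.
  elim: (index_enum _) => [|i s IH].
    by under eq_fun do rewrite big_nil; rewrite big_nil; exact: cvg_cst.
  under eq_fun do rewrite big_cons; rewrite big_cons.
  by apply: cvgM => //; exact: bump_cvg.
- by apply/(integrable_mkcond _ mcube); apply: integrable_abse; exact: iG.
- apply: aeW => x n _; rewrite /f_ /g patchE; case: ifPn => [_|xM].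
    rewrite /= lee_fin normrM ler_piMr//.
    by have /andP[h0 h1] := wb n x; rewrite ger0_norm.
  rewrite /= wb0; last by move=> /boxM xM'; move/negP: xM; apply; rewrite inE.
  by rewrite mulr0 normr0; exact: lexx.
move=> _ _ cvf.
have : (\int[mu]_x f_ n x)%E @[n --> \oo] --> (0 : \bar R).
  apply: cvg_near_cst; apply: nearW => n; apply: G0 => i; exact: test1_bump.
move=> /(cvg_unique _ cvf) => <-//.
rewrite [LHS]integral_mkcond; apply: eq_integral => x _; rewrite /f patchE indicE.
by case: ifPn => _; rewrite ?mulr1 ?mulr0.
Qed.

(** On a cube, the positive and negative parts of [G] are densities of two finite measures. They
    agree on boxes, which are closed under intersection and generate the sigma-algebra, so they
    agree everywhere and [G] has integral 0 over every measurable set. *)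
Lemma ae_eq0_test_functions G : box_integrable G ->
  (forall phi, (forall i, test1 (phi i)) ->
    (\int[mu]_x (G x * wprod phi x)%:E = 0)%E) ->
  {ae mu, forall x, G x = 0}.
Proof.
move=> bG G0; have [mG iG] := bG.
suff aeN n : {ae mu, forall x, cube n%:R x -> G x = 0}.
  have /ae_foralln := aeN; apply: filterS => x h.
  have [n _ xn] : (\bigcup_n cube n%:R) x by rewrite cube_cover.
  exact: h n xn.
have mc : measurable (cube n%:R) by exact: measurable_box.
pose Gn := G \_ (cube n%:R).
have iGn : mu.-integrable setT (EFin \o Gn).
  by have /(integrable_mkcond _ mc) := iG n%:R; rewrite -restrict_EFin.
have mGn : measurable_fun setT Gn by apply/measurable_EFinP; exact: measurable_int iGn.
have mp := measurable_funrpos mGn; have mn := measurable_funrneg mGn.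
pose m1 := density_measure mu (mp, @funrpos_ge0 _ _ Gn).
pose m2 := density_measure mu (mn, @funrneg_ge0 _ _ Gn).
have intE A : measurable A ->
    (\int[mu]_(x in A) (EFin \o Gn) x = m1 A - m2 A)%E.
  by move=> mA; rewrite integralE funerpos funerneg.
have m1fin A : measurable A -> (m1 A < +oo)%E.
  move=> mA; have iA : mu.-integrable A (EFin \o Gn) by exact: integrableS iGn.
  have := integral_funepos_lt_pinfty mA iA.
  by rewrite funerpos.
have m2fin A : measurable A -> (m2 A < +oo)%E.
  move=> mA; have iA : mu.-integrable A (EFin \o Gn) by exact: integrableS iGn.
  have := integral_funeneg_lt_pinfty mA iA.
  by rewrite funerneg.
have m12 A : measurable A -> m1 A = m2 A.
  apply: (measure_unique boxes (fun k => cube k%:R) measurable_boxesE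
    setI_closed_boxes _ cube_cover).
  - by move=> k; eexists; eexists.
  - move=> _ [a [b ->]]; have mab := measurable_box a b.
    have : (\int[mu]_(x in box a b) (EFin \o Gn) x = 0)%E.
      transitivity (\int[mu]_(x in cube n%:R `&` box a b) (G x)%:E)%E.
        rewrite [RHS]integral_mkcondl; apply: eq_integral => x _.
        by rewrite /Gn -restrict_EFin.
      by rewrite /cube boxI; exact: integral_box_eq0.
    have f1 : m1 (box a b) \is a fin_num by rewrite ge0_fin_numE ?m1fin.
    have f2 : m2 (box a b) \is a fin_num by rewrite ge0_fin_numE ?m2fin.
    rewrite intE// -(fineK f1) -(fineK f2) -EFinB => -[/eqP].
    rewrite subr_eq0 => /eqP fm.
    by rewrite -[LHS]/(m1 _) -[RHS]/(m2 _) -(fineK f1) -(fineK f2) fm.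
  - by move=> k; apply: m1fin; exact: measurable_box.
have : ae_eq mu setT (EFin \o Gn) (cst 0%E).
  apply: integral_ae_eq => // A _ mA.
  rewrite intE// m12// integral0 subee//.
  by rewrite ge0_fin_numE ?m2fin.
apply: filterS => x /(_ I) + cx.
by rewrite /= /Gn patchE mem_set// => -[].
Qed.

End boxes.

(** * The weighted Poincare inequality on the line *)

Section poincare.
Context {R : realType}.
Variables (rho psi : R -> R).
Hypothesis rho_density : is_density rho.
Hypothesis psi_weight : is_weight psi.
Hypothesis tail : tail_condition rho psi.
Local Notation l1 := (@lebesgue_measure R).
Local Notation Phi := (distr_fun rho).

Lemma is_density_measurable : measurable_fun setT rho.
Proof. by case: rho_density. Qed.

Lemma is_density_ge0 t : 0 <= rho t.
Proof. by apply: ltW; case: rho_density. Qed.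

Lemma weight_gt0 t : 0 < psi t.
Proof. by case: psi_weight. Qed.

Lemma measurable_weight : measurable_fun setT psi.
Proof. by case: psi_weight => _ []. Qed.

Lemma measurable_weightV : measurable_fun setT (fun t => (psi t)^-1).
Proof. by case: psi_weight => _ _ []. Qed.

Definition dens : set (measurableTypeR R) -> \bar R :=
  density_measure l1 (is_density_measurable, is_density_ge0).

HB.instance Definition _ := Measure.on dens.

Let dens_setT : dens setT = 1%E.
Proof. by case: rho_density. Qed.

HB.instance Definition _ := @Measure_isProbability.Build _ _ R dens dens_setT.

Lemma distr_funE t : (Phi t)%:E = dens `]-oo, t]%classic.
Proof.
by rewrite [LHS]fineK// ge0_fin_numE ?integral_ge0//;
  [exact: (le_lt_trans (@probability_le1 _ _ _ dens _ _) (ltry _))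
  |move=> x _; rewrite lee_fin is_density_ge0].
Qed.

Lemma distr_fun_ge0 t : 0 <= Phi t.
Proof. by rewrite -lee_fin distr_funE. Qed.

Lemma distr_fun_le1 t : Phi t <= 1.
Proof. by rewrite -lee_fin distr_funE; exact: probability_le1. Qed.

Lemma measurable_distr_fun : measurable_fun setT Phi.
Proof.
apply: nondecreasing_measurable => // s t st.
rewrite -lee_fin !distr_funE; apply: le_measure; rewrite ?inE//.
by apply: subset_itvl; rewrite bnd_simp.
Qed.

(** The product Phi (1 - Phi) is at most Phi to the left of 0 and at most 1 - Phi to the right, so
    the two tail integrals at [c = 0] suffice. *)
Lemma C_const_fin : (C_const rho psi < +oo)%E.
Proof.
have [tl tr] := tail 0.
pose Fl := (fun t => (Phi t / psi t)%:E) \_ `]-oo, 0]%classic.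
pose Fr := (fun t => ((1 - Phi t) / psi t)%:E) \_ `[0, +oo[%classic.
have P0 := distr_fun_ge0; have P1 := distr_fun_le1.
have psi0 t : 0 <= (psi t)^-1 by rewrite invr_ge0 ltW// weight_gt0.
have mP := measurable_distr_fun; have mpsi := measurable_weightV.
have ml : measurable_fun setT (fun t => (Phi t / psi t)%:E).
  by apply/measurable_EFinP; apply: measurable_funM.
have mr : measurable_fun setT (fun t => ((1 - Phi t) / psi t)%:E).
  by apply/measurable_EFinP; apply: measurable_funM => //; exact: measurable_funB.
have mFl : measurable_fun setT Fl.
  by apply/(measurable_restrictT _ _).1 => //; exact: measurable_funTS.
have mFr : measurable_fun setT Fr.
  by apply/(measurable_restrictT _ _).1 => //; exact: measurable_funTS.
have Fl0 t : (0 <= Fl t)%E.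
  rewrite /Fl patchE; case: ifP => // _; rewrite ?lexx// lee_fin.
  by rewrite mulr_ge0.
have Fr0 t : (0 <= Fr t)%E.
  rewrite /Fr patchE; case: ifP => // _; rewrite ?lexx// lee_fin.
  by rewrite mulr_ge0// subr_ge0.
apply: (@le_lt_trans _ _ (\int[l1]_t (Fl t + Fr t))%E); last first.
  rewrite ge0_integralD// /Fl /Fr -!integral_mkcond.
  exact: lte_add_pinfty.
apply: ge0_le_integral => //.
- move=> t _; rewrite lee_fin mulr_ge0// mulr_ge0// subr_ge0//.
- apply/measurable_EFinP; apply: measurable_funM => //.
  by apply: measurable_funM => //; exact: measurable_funB.
- exact: emeasurable_funD.
- move=> t _; have [t0|t0] := leP t 0.
    apply: le_trans (leeDl _ (Fr0 t)).
    rewrite /Fl patchE mem_set ?lee_fin /= ?in_itv//=.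
    by rewrite ler_wpM2r// ler_piMr// gerBl.
  apply: le_trans (leeDr _ (Fl0 t)).
  rewrite /Fr patchE mem_set; last by rewrite /= in_itv/= andbT ltW.
  by rewrite lee_fin ler_wpM2r// ler_piMl// subr_ge0.
Qed.

(** The indicator of min(a, b) < s <= max(a, b). As an absolute difference it is also the difference
    of two values of the step kernel, which is how it enters [sepE]. *)
Definition separates (a b s : R) : R := `|(a < s)%R%:R - (b < s)%R%:R|.

Lemma separates_ge0 a b s : 0 <= separates a b s.
Proof. exact: normr_ge0. Qed.

Lemma measurable_separates : measurable_fun setT
  (fun p : (R * R) * R => separates p.1.1 p.1.2 p.2).
Proof.
have mlt (f : (R * R) * R -> R) : measurable_fun setT f ->
    measurable_fun setT (fun p : (R * R) * R => (f p < p.2)%R%:R : R).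
  move=> mf; rewrite (_ : (fun _ => _) = (fun b : bool => b%:R) \o (fun p => f p < p.2))//.
  apply: measurableT_comp => //.
  by apply: measurable_fun_ltr => //; exact: measurable_snd.
apply: measurableT_comp => //; apply: measurable_funB; apply: mlt.
  exact: measurableT_comp measurable_fst measurable_fst.
exact: measurableT_comp measurable_snd measurable_fst.
Qed.

Lemma separatesE a b s : separates a b s =
  \1_`]-oo, s[%classic a * \1_`[s, +oo[%classic b +
  \1_`[s, +oo[%classic a * \1_`]-oo, s[%classic b.
Proof.
have lE u : \1_`]-oo, s[%classic u = (u < s)%R%:R :> R.
  by rewrite indicE mem_setE in_itv.
have rE u : \1_`[s, +oo[%classic u = (~~ (u < s)%R)%:R :> R.
  by rewrite indicE mem_setE in_itv/= andbT leNgt.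
rewrite !lE !rE /separates.
by case: (a < s); case: (b < s); rewrite /= ?subrr ?subr0 ?sub0r ?normrN ?normr0
  ?normr1 ?mulr0 ?mul0r ?mulr1 ?addr0 ?add0r.
Qed.

(** The events a < s <= b and b < s <= a are disjoint and each has probability Phi(s)(1 - Phi(s)),
    there being no atom at [s]. *)
Lemma integral_separates s :
  (\int[dens]_a \int[dens]_b (separates a b s)%:E = (2 * (Phi s * (1 - Phi s)))%:E)%E.
Proof.
have El : dens `]-oo, s[%classic = (Phi s)%:E.
  rewrite distr_funE; apply: integral_itv_bndo_bndc.
  by apply: measurable_funTS; apply/measurable_EFinP; exact: is_density_measurable.
have Er : dens `[s, +oo[%classic = (1 - Phi s)%:E.
  rewrite EFinB -El -(@probability_setC _ _ _ dens)// setCitvl//.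
pose L (u : R) : \bar R := (\1_`]-oo, s[%classic u)%:E.
pose U (u : R) : \bar R := (\1_`[s, +oo[%classic u)%:E.
have mL : measurable_fun setT L.
  by apply/measurable_EFinP; exact: measurable_indic.
have mU : measurable_fun setT U.
  by apply/measurable_EFinP; exact: measurable_indic.
have L0 u : (0 <= L u)%E by rewrite lee_fin.
have U0 u : (0 <= U u)%E by rewrite lee_fin.
have iL : (\int[dens]_u L u = (Phi s)%:E)%E.
  by rewrite integral_indic// setIT.
have iU : (\int[dens]_u U u = (1 - Phi s)%:E)%E.
  by rewrite integral_indic// setIT.
have P0 : (0 <= (Phi s)%:E)%E by rewrite lee_fin distr_fun_ge0.
have P1 : (0 <= (1 - Phi s)%:E)%E by rewrite lee_fin subr_ge0 distr_fun_le1.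
transitivity (\int[dens]_a (L a * (1 - Phi s)%:E + U a * (Phi s)%:E))%E.
  apply: eq_integral => a _.
  transitivity (\int[dens]_b (L a * U b + U a * L b))%E.
    by apply: eq_integral => b _; rewrite separatesE EFinD !EFinM.
  rewrite ge0_integralD//.
  - by rewrite !ge0_integralZl// iL iU.
  - by move=> b _; rewrite mule_ge0.
  - exact: emeasurable_funM.
  - by move=> b _; rewrite mule_ge0.
  - exact: emeasurable_funM.
rewrite ge0_integralD//.
- rewrite !ge0_integralZr// iL iU -!EFinM -EFinD; congr EFin; ring.
- by move=> a _; rewrite mule_ge0.
- exact: emeasurable_funM.
- by move=> a _; rewrite mule_ge0.
- exact: emeasurable_funM.
Qed.

(** Two applications of Tonelli bring the integral over [s] to the outside; this is the origin of
    [C_const]. *)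
Lemma integral_separates_weight :
  (\int[dens]_a \int[dens]_b \int[l1]_s (separates a b s / psi s)%:E =
   2%:E * C_const rho psi)%E.
Proof.
have mP := measurable_distr_fun; have mpsi := measurable_weightV.
have psi0 t : 0 <= (psi t)^-1 by rewrite invr_ge0 ltW// weight_gt0.
have mF : measurable_fun setT (fun p : (R * R) * R =>
    (separates p.1.1 p.1.2 p.2 / psi p.2)%:E).
  apply/measurable_EFinP; apply: measurable_funM; first exact: measurable_separates.
  exact: measurableT_comp mpsi measurable_snd.
have F0 (a b s : R) : (0 <= (separates a b s / psi s)%:E)%E.
  by rewrite lee_fin mulr_ge0// separates_ge0.
transitivity (\int[dens]_a \int[l1]_s \int[dens]_b (separates a b s / psi s)%:E)%E.
  apply: eq_integral => a _.
  apply: (fubini_tonelli (m1 := dens) (m2 := l1)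
    (fun p => (separates a p.1 p.2 / psi p.2)%:E)) => //.
  apply: (measurableT_comp mF (g := fun p : R * R => ((a, p.1), p.2))).
  by apply: measurable_fun_pair => //; apply: measurable_fun_pair.
transitivity (\int[l1]_s \int[dens]_a \int[dens]_b (separates a b s / psi s)%:E)%E.
  apply: (fubini_tonelli (m1 := dens) (m2 := l1)
    (fun p => \int[dens]_b (separates p.1 b p.2 / psi p.2)%:E)%E).
  - apply: (measurable_fun_integral2 dens
      (F := fun q : (R * R) * R => (separates q.1.1 q.2 q.1.2 / psi q.1.2)%:E)).
    apply: (measurableT_comp mF (g := fun q : (R * R) * R => ((q.1.1, q.2), q.1.2))).
    apply: measurable_fun_pair; last exact: measurableT_comp measurable_snd measurable_fst.
    apply: measurable_fun_pair => //.
    exact: measurableT_comp measurable_fst measurable_fst.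
  - by move=> p; exact: integral_ge0.
rewrite -ge0_integralZl//; last 2 first.
- apply/measurable_EFinP; apply: measurable_funM => //.
  by apply: measurable_funM => //; exact: measurable_funB.
- move=> t _; rewrite lee_fin mulr_ge0// mulr_ge0 ?distr_fun_ge0//.
  by rewrite subr_ge0 distr_fun_le1.
have msep s : measurable_fun setT (fun p : R * R => (separates p.1 p.2 s)%:E).
  apply/measurable_EFinP.
  apply: (measurableT_comp measurable_separates (g := fun p : R * R => (p, s))).
  exact: measurable_fun_pair.
apply: eq_integral => s _.
transitivity (\int[dens]_a (\int[dens]_b (separates a b s)%:E * (psi s)^-1%:E))%E.
  apply: eq_integral => a _.
  under eq_integral do rewrite EFinM.
  rewrite ge0_integralZr//.
  - apply: (measurableT_comp (msep s) (g := fun b : R => (a, b))).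
    exact: measurable_fun_pair.
  - by move=> b _; rewrite lee_fin separates_ge0.
  - by rewrite lee_fin.
rewrite ge0_integralZr ?lee_fin//.
- rewrite integral_separates -!EFinM; congr EFin; ring.
- exact: (measurable_fun_integral2 dens (msep s)).
- by move=> a _; apply: integral_ge0 => b _; rewrite lee_fin separates_ge0.
Qed.

(** The discriminant argument for Cauchy-Schwarz; positive [e] suffice because [I] is
    nonnegative. *)
Lemma discriminant_le (A I Q : R) : 0 <= A -> 0 <= I -> 0 <= Q ->
  (forall e, 0 < e -> 2 * e * I <= e ^+ 2 * A + Q) -> I ^+ 2 <= A * Q.
Proof.
move=> A0 I0 Q0 h; have [->|In0] := eqVneq I 0.
  by rewrite expr0n/= mulr_ge0.
have {I0 In0}I0 : 0 < I by rewrite lt_def In0.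
have [A00|An0] := eqVneq A 0.
  (* With [A = 0] the hypothesis says 2 e I <= Q for all e > 0, and this value of [e] contradicts
     it. *)
  have := h ((Q + 1) / I); rewrite divr_gt0 ?ltr_wpDl// A00 mulr0 add0r.
  have -> : 2 * ((Q + 1) / I) * I = 2 * (Q + 1) by field; rewrite gt_eqF.
  by move=> /(_ isT); lra.
have {A0 An0}A0 : 0 < A by rewrite lt_def An0.
(* The minimiser of e^2 A - 2 e I. *)
have := h (I / A); rewrite divr_gt0// => /(_ isT).
have -> : 2 * (I / A) * I = 2 * (I ^+ 2 / A) by field; rewrite gt_eqF.
have -> : (I / A) ^+ 2 * A = I ^+ 2 / A by field; rewrite gt_eqF.
move=> h2; have {}h2 : I ^+ 2 / A <= Q by lra.
by rewrite mulrC -ler_pdivrMr.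
Qed.

End poincare.

Section poincare_inequality.
Context {R : realType}.
Variables (rho psi : R -> R).
Hypothesis rho_density : is_density rho.
Hypothesis psi_weight : is_weight psi.
Hypothesis tail : tail_condition rho psi.
Local Notation l1 := (@lebesgue_measure R).
Local Notation nu := (dens rho_density).
Variables (k g h : R -> R) (m : R).
Hypotheses (mg : measurable_fun setT g)
  (mh : measurable_fun setT h).
Hypothesis h_fin : (\int[l1]_s (h s ^+ 2 * psi s)%:E < +oo)%E.
(** [k] is arbitrary: it does not depend on [t], so it cancels, together with [m], in a difference
    of two values of [g]. Only the jump at [t] matters. *)
Let represented t :=
  l1.-integrable setT (fun s => ((k s - (t < s)%R%:R) * h s)%:E) /\
  g t = m + \int[l1]_s ((k s - (t < s)%R%:R) * h s).

Let Q := (\int[l1]_s (h s ^+ 2 * psi s)%:E)%E.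
Let A a b := (\int[l1]_s (separates a b s / psi s)%:E)%E.

Let psi0 := weight_gt0 psi_weight.
Let mpsi := measurable_weight psi_weight.
Let mpsiV := measurable_weightV psi_weight.

Let hpsi0 s : 0 <= h s ^+ 2 * psi s.
Proof. by rewrite mulr_ge0 ?sqr_ge0// ltW. Qed.

Let mhpsi : measurable_fun setT (fun s => (h s ^+ 2 * psi s)%:E).
Proof.
by apply/measurable_EFinP; apply: measurable_funM => //; exact: measurable_funX.
Qed.

Let msep a b : measurable_fun setT (fun s : R => separates a b s).
Proof.
apply: (measurableT_comp measurable_separates (g := fun s : R => ((a, b), s))).
by apply: measurable_fun_pair.
Qed.

Let sep0 a b s : 0 <= separates a b s / psi s.
Proof. by rewrite mulr_ge0 ?separates_ge0// invr_ge0 ltW. Qed.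

Let msepV a b : measurable_fun setT (fun s : R => (separates a b s / psi s)%:E).
Proof. by apply/measurable_EFinP; exact: measurable_funM. Qed.

Let A_fin a b : (A a b < +oo)%E.
Proof.
have [_ _ [_ _ /(_ `[Num.min a b, Num.max a b]%classic)]] := psi_weight.
move=> /(_ (@subsetT _ _) (@segment_compact _ _ _)).
apply: le_lt_trans; rewrite [leRHS]integral_mkcond.
apply: ge0_le_integral => //.
- by move=> s _; rewrite lee_fin.
- exact: msepV.
- apply/(measurable_restrictT _ _).1 => //; apply: measurable_funTS.
  by apply/measurable_EFinP; apply: measurableT_comp.
- move=> s _; rewrite patchE; case: ifPn => sab.
    have p0 : 0 <= (psi s)^-1 by rewrite invr_ge0 ltW.
    rewrite lee_fin ger0_norm//; apply: ler_piMl => //.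
    rewrite /separates; case: (a < s); case: (b < s);
    by rewrite /= ?subrr ?subr0 ?sub0r ?normrN ?normr0 ?normr1.
  rewrite (_ : separates a b s = 0) ?mul0r; first exact: lexx.
  move: sab; rewrite notin_setE/= in_itv/= => /negP.
  rewrite ge_min le_max negb_and !negb_or -!ltNge /separates.
  move=> /orP[/andP[sa sb]|/andP[as_ bs]].
    by rewrite !ltNge !ltW//= subrr normr0.
  by rewrite as_ bs subrr normr0.
Qed.

Let sepE a b s : separates a b s * `|h s| =
  `|(k s - (b < s)%R%:R) * h s - (k s - (a < s)%R%:R) * h s|.
Proof.
rewrite -mulrBl normrM /separates; congr (`|_| * _); ring.
Qed.

(** The difference g(b) - g(a) is at most the integral of |h| between a and b; Cauchy-Schwarz splits
    it with the weights 1/psi and psi. *)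
Lemma sqr_difference_le a b : represented a -> represented b ->
  (((g b - g a) ^+ 2)%:E <= A a b * Q)%E.
Proof.
move=> [ia ga] [ib gb].
have iab : l1.-integrable setT (fun s => (separates a b s * `|h s|)%:E).
  have := integrable_abse (integrableB measurableT ib ia).
  by apply: eq_integrable => // s _; rewrite /= sepE.
pose I := \int[l1]_s (separates a b s * `|h s|).
have I0 : 0 <= I.
  by apply: Rintegral_ge0 => s _; rewrite mulr_ge0 ?separates_ge0.
have IE : (I%:E = \int[l1]_s (separates a b s * `|h s|)%:E)%E.
  by rewrite /I /Rintegral fineK//; exact: integrable_fin_num.
have gI : `|g b - g a| <= I.
  rewrite ga gb opprD addrACA subrr add0r -RintegralB//.
  apply: le_trans (le_normr_Rintegral measurableT _) _.
    by have := integrableB measurableT ib ia; apply: eq_integrable.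
  by rewrite le_eqVlt; apply/orP; left; apply/eqP; apply: eq_Rintegral => s _; rewrite sepE.
have A0 : (0 <= A a b)%E by apply: integral_ge0 => s _; rewrite lee_fin.
have Q0 : (0 <= Q)%E by apply: integral_ge0 => s _; rewrite lee_fin.
have Af : A a b \is a fin_num by rewrite ge0_fin_numE// A_fin.
have Qf : Q \is a fin_num by rewrite ge0_fin_numE.
rewrite -(fineK Af) -(fineK Qf) -EFinM lee_fin.
apply: (@le_trans _ _ (I ^+ 2)).
  by rewrite -[leLHS]real_normK ?num_real// ler_sqr ?nnegrE.
apply: discriminant_le => //; rewrite ?fine_ge0// => e e0.
rewrite -lee_fin.
have -> : (2 * e * I)%:E = ((2 * e)%:E * \int[l1]_s (separates a b s * `|h s|)%:E)%E.
  by rewrite -IE -EFinM.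
have -> : (e ^+ 2 * fine (A a b) + fine Q)%:E = ((e ^+ 2)%:E * A a b + Q)%E.
  by rewrite EFinD EFinM !fineK.
have msh : measurable_fun setT (fun s => (separates a b s * `|h s|)%:E).
  by apply/measurable_EFinP; apply: measurable_funM => //; apply: measurableT_comp.
have sh0 s : (0 <= (separates a b s * `|h s|)%:E)%E.
  by rewrite lee_fin mulr_ge0 ?separates_ge0.
have se0 s : (0 <= (separates a b s / psi s)%:E)%E by rewrite lee_fin.
have he0 s : (0 <= (h s ^+ 2 * psi s)%:E)%E by rewrite lee_fin.
have e20 : (0 <= (2 * e)%:E)%E by rewrite lee_fin mulr_ge0 ?ltW.
have ee0 : (0 <= (e ^+ 2)%:E)%E by rewrite lee_fin sqr_ge0.
have -> : ((2 * e)%:E * \int[l1]_s (separates a b s * `|h s|)%:E =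
    \int[l1]_s ((2 * e)%:E * (separates a b s * `|h s|)%:E))%E.
  by rewrite ge0_integralZl.
have -> : ((e ^+ 2)%:E * A a b + Q = \int[l1]_s ((e ^+ 2)%:E *
    (separates a b s / psi s)%:E + (h s ^+ 2 * psi s)%:E))%E.
  rewrite ge0_integralD//; last 2 first.
  - by move=> s _; exact: mule_ge0.
  - by apply: emeasurable_funM => //; exact: msepV.
  by rewrite ge0_integralZl//; exact: msepV.
apply: ge0_le_integral => //.
- by move=> s _; exact: mule_ge0.
- exact: emeasurable_funM.
- by apply: emeasurable_funD => //; apply: emeasurable_funM => //; exact: msepV.
move=> s _; rewrite -!EFinM -EFinD lee_fin.
set c := separates a b s.
(* [c] takes only the values 0 and 1; replacing it by its square turns the pointwise inequality into
   a perfect square divided by [psi s]. *)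
have cc : c ^+ 2 = c.
  rewrite /c /separates; case: (a < s); case: (b < s);
  by rewrite /= ?subrr ?subr0 ?sub0r ?normrN ?normr0 ?normr1 ?expr0n ?expr1n.
have -> : h s ^+ 2 = `|h s| ^+ 2 by rewrite real_normK// num_real.
rewrite -subr_ge0 -[X in X / psi s]cc.
have -> : e ^+ 2 * (c ^+ 2 / psi s) + `|h s| ^+ 2 * psi s - 2 * e * (c * `|h s|) =
    (e * c - `|h s| * psi s) ^+ 2 / psi s.
  by field; rewrite gt_eqF.
by rewrite mulr_ge0 ?sqr_ge0// invr_ge0 ltW.
Qed.

Hypothesis rep : {ae l1, forall t, represented t}.
Hypothesis ig : nu.-integrable setT (EFin \o g).

Let ae_dens (P : R -> Prop) : {ae l1, forall t, P t} -> {ae nu, forall t, P t}.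
Proof.
move=> [N [mN N0 PN]]; exists N; split => //.
apply: null_set_integral => //; apply: measurable_funTS.
by apply/measurable_EFinP; case: rho_density.
Qed.

(** Twice the variance of [g], but meaningful before [g] is known to be square integrable. *)
Let D2 := (\int[nu]_a \int[nu]_b ((g b - g a) ^+ 2)%:E)%E.

Let mD : measurable_fun setT (fun p : R * R => ((g p.2 - g p.1) ^+ 2)%:E).
Proof.
apply/measurable_EFinP; apply: measurable_funX; apply: measurable_funB.
  exact: measurableT_comp measurable_snd.
exact: measurableT_comp measurable_fst.
Qed.

Let mDa a : measurable_fun setT (fun b => ((g b - g a) ^+ 2)%:E).
Proof.
by apply/measurable_EFinP; apply: measurable_funX; exact: measurable_funB.
Qed.

Let D2_le : (D2 <= 2%:E * C_const rho psi * Q)%E.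
Proof.
have Q0 : (0 <= Q)%E by apply: integral_ge0 => s _; rewrite lee_fin.
rewrite -(integral_separates_weight rho_density psi_weight).
have mA2 : measurable_fun setT (fun p : R * R => A p.1 p.2).
  apply: (measurable_fun_integral2 l1
    (F := fun q : (R * R) * R => (separates q.1.1 q.1.2 q.2 / psi q.2)%:E)).
  apply/measurable_EFinP; apply: measurable_funM; first exact: measurable_separates.
  exact: (measurableT_comp mpsiV measurable_snd).
have mAa a : measurable_fun setT (A a).
  apply: (measurableT_comp mA2 (g := fun b : R => (a, b))).
  exact: measurable_fun_pair.
have A0 a b : (0 <= A a b)%E by apply: integral_ge0 => s _; rewrite lee_fin.
rewrite -ge0_integralZr//; last 2 first.
- exact: (measurable_fun_integral2 nu mA2).
- by move=> a _; apply: integral_ge0 => b _; exact: A0.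
apply: ae_ge0_le_integral => //.
- by move=> a _; apply: integral_ge0 => b _; rewrite lee_fin sqr_ge0.
- exact: (measurable_fun_integral2 nu mD).
- by move=> a _; rewrite mule_ge0//; apply: integral_ge0 => b _; exact: A0.
- apply: emeasurable_funM => //; exact: (measurable_fun_integral2 nu mA2).
have aer := ae_dens rep.
apply: (@filterS _ _ (ae_filter_ringOfSetsType nu) _ _ _ aer) => a ra _.
rewrite -ge0_integralZr//; last 2 first.
- exact: mAa.
- by move=> b _; exact: A0.
apply: ae_ge0_le_integral => //.
- by move=> b _; rewrite lee_fin sqr_ge0.
- exact: mDa.
- by move=> b _; apply: mule_ge0 => //; exact: A0.
- by apply: emeasurable_funM => //; exact: mAa.
apply: (@filterS _ _ (ae_filter_ringOfSetsType nu) _ _ _ aer) => b rb _.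
exact: sqr_difference_le.
Qed.

(** Square integrability of [g] is derived, not assumed: [D2] is finite, so [g] is square integrable
    after subtraction of some constant. Expanding the square then gives [D2] as twice the second
    moment minus twice the squared mean. *)
Lemma poincare :
  (\int[nu]_t (g t ^+ 2)%:E <=
   ((\int[nu]_t g t) ^+ 2)%:E + C_const rho psi * Q)%E.
Proof.
have nu1 : nu setT = 1%E by exact: probability_setT.
have C0 : (0 <= C_const rho psi)%E.
  apply: integral_ge0 => t _; rewrite lee_fin mulr_ge0 ?invr_ge0 ?(ltW (psi0 t))//.
  by rewrite mulr_ge0 ?subr_ge0 ?(distr_fun_ge0 rho_density) ?(distr_fun_le1 rho_density).
have Cfin : C_const rho psi \is a fin_num.
  by rewrite ge0_fin_numE//; exact: C_const_fin.
have Q0 : (0 <= Q)%E by apply: integral_ge0 => s _; rewrite lee_fin.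
have Qf : Q \is a fin_num by rewrite ge0_fin_numE.
have D2fin : (D2 < +oo)%E.
  by apply: le_lt_trans D2_le _; rewrite -(fineK Cfin) -(fineK Qf) -!EFinM ltry.
have mD2 : measurable_fun setT (fun a => \int[nu]_b ((g b - g a) ^+ 2)%:E)%E.
  exact: (measurable_fun_integral2 nu mD).
(* If every inner integral were infinite, [D2] would be the integral of +oo against a
   probability. *)
have [b0 b0fin] : exists b, (\int[nu]_a ((g a - g b) ^+ 2)%:E < +oo)%E.
  apply: contrapT => /forallNP noa.
  suff : D2 = +oo%E by move=> D2oo; rewrite D2oo ltxx in D2fin.
  rewrite /D2 (_ : (fun a => _) = cst +oo%E) ?integral_cst//; first by rewrite [X in (_ * X)%E]nu1 mule1.
  apply/funext => a; apply/eqP; rewrite eq_le leey/= leNgt; apply/negP.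
  exact: noa.
have mg2 : measurable_fun setT (fun t => (g t ^+ 2)%:E).
  by apply/measurable_EFinP; exact: measurable_funX.
have ig2 : nu.-integrable setT (fun t => (g t ^+ 2)%:E).
  have ib : nu.-integrable setT
      (fun t => (2 * (g t - g b0) ^+ 2 + 2 * g b0 ^+ 2)%:E).
    under eq_fun do rewrite EFinD EFinM.
    apply: integrableD => //; last exact: finite_measure_integrable_cst.
    apply: integrableZl => //; apply/integrableP; split; first exact: mDa.
    apply: le_lt_trans b0fin; rewrite le_eqVlt; apply/orP; left; apply/eqP.
    by apply: eq_integral => t _; rewrite gee0_abs// lee_fin sqr_ge0.
  apply: (le_integrable measurableT _ _ ib) => // t _.
  rewrite /= lee_fin ger0_norm ?sqr_ge0//.
  rewrite ger0_norm; last by rewrite addr_ge0// mulr_ge0// sqr_ge0.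
  rewrite -subr_ge0.
  have -> : 2 * (g t - g b0) ^+ 2 + 2 * g b0 ^+ 2 - g t ^+ 2 = (g t - 2 * g b0) ^+ 2.
    by ring.
  exact: sqr_ge0.
pose S := \int[nu]_t (g t ^+ 2); pose mean := \int[nu]_t g t.
have SE : (\int[nu]_t (g t ^+ 2)%:E = S%:E)%E.
  by rewrite /S /Rintegral fineK//; exact: integrable_fin_num.
have meanE : (\int[nu]_t (g t)%:E = mean%:E)%E.
  by rewrite /mean /Rintegral fineK//; exact: integrable_fin_num.
have ic (c : R) : (\int[nu]__ c%:E = c%:E)%E.
  by rewrite integral_cst// [X in (_ * X)%E]nu1 mule1.
have inner a : (\int[nu]_b ((g b - g a) ^+ 2)%:E =
    (S + - (2 * mean) * g a + g a ^+ 2)%:E)%E.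
  have E b : ((g b - g a) ^+ 2)%:E = ((g b ^+ 2)%:E + (- (2 * g a))%:E * (g b)%:E +
      (g a ^+ 2)%:E)%E.
    by rewrite -EFinM -!EFinD; congr EFin; ring.
  under eq_integral do rewrite E.
  have i1 : nu.-integrable setT (fun b => (- (2 * g a))%:E * (g b)%:E)%E.
    exact: integrableZl.
  rewrite integralD//; last 2 first.
  - exact: integrableD.
  - exact: finite_measure_integrable_cst.
  rewrite integralD// integralZl// SE [X in (_ * X)%E]meanE.
  rewrite [X in (_ + X)%E]ic -EFinM -!EFinD.
  by congr EFin; ring.
have D2E : D2 = (2 * S - 2 * mean ^+ 2)%:E.
  rewrite /D2; under eq_integral do rewrite inner EFinD EFinD EFinM.
  have i1 : nu.-integrable setT (fun b => (- (2 * mean))%:E * (g b)%:E)%E.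
    exact: integrableZl.
  rewrite integralD//; last first.
  - by apply: integrableD => //; exact: finite_measure_integrable_cst.
  rewrite integralD//; last exact: finite_measure_integrable_cst.
  rewrite integralZl// SE [X in (_ * X)%E]meanE.
  rewrite [X in (X + _ + _)%E]ic -EFinM -!EFinD.
  by congr EFin; ring.
have := D2_le; rewrite D2E SE -[\int[nu]_t g t]/mean.
rewrite -(fineK Cfin) -(fineK Qf) -!EFinM -EFinD !lee_fin.
lra.
Qed.

End poincare_inequality.

(** * Weak derivatives along a coordinate direction *)

Section scaling.
Context dT (T : measurableType dT) {R : realType} (m : {measure set T -> \bar R}).

(** Integrability is assumed of the product only. For [c = 0] this says nothing about [g], but both
    sides are then 0 whatever real value the integral of [g] receives. *)
Lemma integral_scale (c : R) (g : T -> R) :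
  m.-integrable setT (fun s => (c * g s)%:E) ->
  (\int[m]_s (c * g s)%:E = (c * \int[m]_s g s)%:E)%E.
Proof.
move=> icg; have [->|c0] := eqVneq c 0.
  rewrite mul0r integral0_eq// => s _; by rewrite mul0r.
have ig : m.-integrable setT (EFin \o g).
  have := integrableZl measurableT c^-1 icg.
  by apply: eq_integrable => // s _; rewrite /= -EFinM mulKf.
rewrite -RintegralZl// /Rintegral fineK//.
exact: integrable_fin_num.
Qed.

Lemma ae_eq_integrable (f g : T -> \bar R) : measurable_fun setT g ->
  ae_eq m setT f g -> m.-integrable setT f -> m.-integrable setT g.
Proof.
move=> mg fg /integrableP[mf foo]; apply/integrableP; split => //.
rewrite -(ge0_ae_eq_integral _ _ _ _ _ (f := fun x => `|f x|%E))//.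
- exact: measurableT_comp.
- exact: measurableT_comp.
- by apply: filterS fg => x /(_ I) + _ => ->.
Qed.

End scaling.

Section coordinate_kernel.
Context {R : realType} {d : nat}.
Local Notation X := 'rV[R]_d.
Local Notation mu := (@lebesgue_rV R d).
Local Notation l1 := (@lebesgue_measure R).
Implicit Types (j : 'I_d) (F w : X -> R).

Lemma upd_upd j (x : X) s t : upd j (upd j x s) t = upd j x t.
Proof. by apply/rowP => i; rewrite [LHS]mxE [RHS]mxE; case: eqP => // /eqP/negbTE ij; rewrite mxE ij. Qed.

Lemma upd_coord j (x : X) s : upd j x s ord0 j = s.
Proof. by rewrite mxE eqxx. Qed.

Lemma upd_id j (x : X) : upd j x (x ord0 j) = x.
Proof. by apply/rowP => i; rewrite mxE; case: eqP => // ->. Qed.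

Let swap j (p : X * R) : X * R := (upd j p.1 p.2, p.1 ord0 j).

Let mswap j : measurable_fun setT (swap j).
Proof. by apply: measurable_fun_pair; mfun. Qed.

Let swap_preserving j (A : set (X * R)) : measurable A ->
  (mu \x l1)%E (swap j @^-1` A) = (mu \x l1)%E A.
Proof.
move=> mA.
pose G (p : X * R) : \bar R := (\1_A p)%:E.
have mG : measurable_fun setT G.
  by apply/measurable_EFinP; exact: measurable_indic.
have G0 p : (0 <= G p)%E by rewrite lee_fin.
transitivity (\int[mu \x l1]_p G (swap j p))%E.
  rewrite -[RHS]/(\int[mu \x l1]_p (\1_(swap j @^-1` A) p)%:E)%E.
  rewrite integral_indic ?setIT//.
  by rewrite -[X in measurable X]setTI; exact: mswap.
transitivity (\int[mu \x l1]_p G p)%E; last by rewrite integral_indic// setIT.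
have mGs : measurable_fun setT (fun p => G (swap j p)).
  exact: (measurableT_comp mG (mswap j)).
transitivity (\int[mu]_x \int[l1]_t G (swap j (x, t)))%E.
  by apply: (fubini_tonelli1 (m1 := mu) (m2 := l1)) => //.
transitivity (\int[mu]_x \int[l1]_t G (x, t))%E.
  exact: (integral_swap_coord j mG G0).
by apply/esym; apply: (fubini_tonelli1 (m1 := mu) (m2 := l1)) => //.
Qed.

Let integral_swap j (F : X * R -> \bar R) : measurable_fun setT F ->
  (\int[mu \x l1]_p F (swap j p) = \int[mu \x l1]_p F p)%E.
Proof.
exact: (@integral_preserving _ _ (X * measurableTypeR R)%type (X * measurableTypeR R)%type R (mu \x l1)%E (mu \x l1)%E
  (swap j) (mswap j) (@swap_preserving j)).
Qed.

(** For almost every pair (x, t) the property holds at [x]; exchanging [t] with the [j]-th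
    coordinate preserves the measure and turns [x] into [upd j x t]. *)
Lemma ae_upd j (Q : X -> Prop) : {ae mu, forall x, Q x} ->
  {ae mu, forall x, {ae l1, forall t, Q (upd j x t)}}.
Proof.
move=> [N [mN N0 QN]].
have aeQ1 : {ae (mu \x l1)%E, forall p : X * R, Q p.1}.
  exists (N `*` setT); split; first exact: measurableX.
    transitivity (mu N * l1 setT)%E; first exact: product_measure1E.
    by rewrite [X in (X * _)%E]N0 mul0e.
  by move=> p /= nQ; split => //; exact: QN.
have := @ae_preserving _ _ (X * measurableTypeR R)%type
  (X * measurableTypeR R)%type R (mu \x l1)%E (mu \x l1)%E
  (swap j) (mswap j) (@swap_preserving j) _ aeQ1.
exact: (ae_product (m1 := mu) (m2 := l1) (Q := fun p => Q (upd j p.1 p.2))).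
Qed.

(** The radius exceeds 1 so that the cube contains the support of [eta] in each direction; the
    vanishing hypothesis [k0] on kernels is available only for such radii. *)
Definition cube_dominated w :=
  exists B M, [/\ 0 <= B, 1 < M & forall x, `|w x| <= B * \1_(cube M) x].

Lemma box_integrable_mul F w : box_integrable F -> measurable_fun setT w ->
  cube_dominated w -> mu.-integrable setT (fun x => (F x * w x)%:E).
Proof.
move=> [mF iF] mw [B [M [B0 M1 wB]]].
have mc : measurable (cube M : set X) by exact: measurable_box.
have iB : mu.-integrable setT (fun x => B%:E * ((EFin \o F) \_ (cube M)) x)%E.
  by apply: integrableZl => //; apply/(integrable_mkcond _ mc); exact: iF.
apply: (le_integrable measurableT _ _ iB).
  by apply/measurable_EFinP; exact: measurable_funM.
move=> x _; rewrite patchE; have := wB x; rewrite indicE.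
case: (x \in cube M) => /= wx.
  rewrite lee_fin !normrM (ger0_norm B0) mulrC ler_wpM2r//.
  by rewrite mulr1 in wx.
rewrite mulr0 normr_le0 in wx; rewrite (eqP wx) mulr0 normr0.
by rewrite lee_fin normr_ge0.
Qed.

Section kernel.
Variables (j : 'I_d) (k : R -> R -> R) (Bk : R).
Hypothesis mk : measurable_fun setT (fun p : R * R => k p.1 p.2).
Hypothesis kB : forall s t, `|k s t| <= Bk.
Hypothesis k0 : forall M s t, 1 < M -> `|s| < M -> M <= `|t| -> k s t = 0.
Variables (F w : X -> R).
Hypotheses (bF : box_integrable F) (mw : measurable_fun setT w).
Hypothesis dw : cube_dominated w.

Let A (p : X * R) := k (p.1 ord0 j) p.2 * F (upd j p.1 p.2) * w p.1.

Let mF : measurable_fun setT F. Proof. by case: bF. Qed.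

Let mA : measurable_fun setT (fun p : X * R => (A p)%:E).
Proof.
apply/measurable_EFinP; apply: measurable_funM; last exact: measurableT_comp mw _.
apply: measurable_funM; last by apply: (measurableT_comp mF); mfun.
by apply: (measurableT_comp mk (g := fun p : X * R => (p.1 ord0 j, p.2))); mfun.
Qed.

(** After the exchange of x_j with [t], the function [F] is evaluated at [x] itself. Then [w]
    confines [t] and the coordinates other than [j] to the cube, and [k0] confines x_j, so the
    integrand is at most a constant times |F| on the cube times the indicator of an interval in
    [t]. *)
Let iA : (mu \x l1)%E.-integrable setT (fun p => (A p)%:E).
Proof.
have [B [M [B0 M1 wB]]] := dw.
apply/integrableP; split => //.
rewrite fubini_tonelli1//; last exact: measurableT_comp mA.
rewrite /fubini_F /=.
pose G (p : X * R) := (`|k p.2 (p.1 ord0 j) * F p.1 * w (upd j p.1 p.2)|)%:E.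
have mG : measurable_fun setT G.
  apply/measurable_EFinP; apply: measurableT_comp => //.
  apply: measurable_funM; last by apply: (measurableT_comp mw); mfun.
  apply: measurable_funM; last exact: measurableT_comp mF _.
  by apply: (measurableT_comp mk (g := fun p : X * R => (p.2, p.1 ord0 j))); mfun.
have G0 p : (0 <= G p)%E by rewrite lee_fin.
rewrite (_ : (fun x => _) = fun x => \int[l1]_t G (upd j x t, x ord0 j))%E; last first.
  apply/funext => x; apply: eq_integral => t _.
  by rewrite /G/= upd_coord upd_upd upd_id.
rewrite (integral_swap_coord j mG G0).
have mc : measurable (cube M : set X) by exact: measurable_box.
pose N x : \bar R := ((Bk * B)%:E * `|((EFin \o F) \_ (cube M)) x|)%E.
have Bk0 : 0 <= Bk by apply: le_trans (kB 0 0).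
have N0 x : (0 <= N x)%E by rewrite mule_ge0// lee_fin mulr_ge0.
have mN : measurable_fun setT N.
  apply: emeasurable_funM => //; apply: measurableT_comp => //.
  apply/(measurable_restrictT _ _).1 => //; apply: measurable_funTS.
  exact/measurable_EFinP.
pose I (t : R) : \bar R := (\1_`]- M, M[%classic t)%:E.
have mI : measurable_fun setT I by apply/measurable_EFinP; exact: measurable_indic.
have GN x t : (G (x, t) <= N x * I t)%E.
  rewrite /G/= /N /I patchE indicE.
  have [tM|tM] := boolP (t \in `]- M, M[%classic); last first.
    rewrite mule0 lee_fin (_ : w _ = 0) ?mulr0 ?normr0//.
    apply/eqP; rewrite -normr_le0; apply: le_trans (wB _) _.
    rewrite indicE memNset ?mulr0// => /(_ j); rewrite upd_coord => tM'.
    by move/negP: tM; apply; rewrite inE/= in_itv.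
  move: tM; rewrite inE/= in_itv/= -ltr_norml => tM; rewrite mule1.
  have [xM|xM] := boolP (x \in cube M).
    rewrite /= -EFinM lee_fin 2!normrM -mulrA mulrCA [leRHS]mulrC.
    rewrite ler_wpM2l// ler_pM//.
    by apply: le_trans (wB _) _; rewrite ler_piMr// indicE; case: (_ \in _).
  have [xj|xj] := ltP `|x ord0 j| M; last first.
    by rewrite (k0 M1 tM xj) !mul0r normr0 mule_ge0// lee_fin mulr_ge0.
  rewrite (_ : w _ = 0); first by rewrite mulr0 normr0 mule_ge0// lee_fin mulr_ge0.
  apply/eqP; rewrite -normr_le0; apply: le_trans (wB _) _.
  rewrite indicE memNset ?mulr0// => h; move/negP: xM; apply; rewrite inE => i.
  have := h i; rewrite mxE; case: eqP => [->|//] _.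
  by rewrite -ltr_norml.
apply: (@le_lt_trans _ _ (\int[mu]_x \int[l1]_t (N x * I t)))%E.
  apply: ge0_le_integral => //.
  - by move=> x _; apply: integral_ge0.
  - exact: (measurable_fun_integral2 l1 mG).
  - apply: (measurable_fun_integral2 l1 (F := fun p : X * R => N p.1 * I p.2)%E).
    apply: emeasurable_funM; first exact: measurableT_comp mN _.
    exact: measurableT_comp mI _.
  move=> x _; apply: ge0_le_integral => //.
  - by apply: (measurableT_comp mG (g := fun t : R => (x, t))); mfun.
  - by apply: emeasurable_funM.
have intI : (\int[l1]_t I t = (2 * M)%:E)%E.
  rewrite integral_indic// setIT [LHS]lebesgue_measure_itv/= lte_fin.
  have -> : - M < M by lra.
  by rewrite -EFinB; congr EFin; ring.
rewrite (_ : (fun x => _) = fun x => (N x * (2 * M)%:E)%E); last first.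
  apply/funext => x; rewrite ge0_integralZl// ?intI//.
  by move=> t _; rewrite lee_fin.
rewrite ge0_integralZr//; last by rewrite lee_fin; lra.
rewrite /N ge0_integralZl//; last 2 first.
- apply: measurableT_comp => //.
  apply/(measurable_restrictT _ _).1 => //; apply: measurable_funTS.
  exact/measurable_EFinP.
- by rewrite lee_fin mulr_ge0.
have /(integrable_mkcond _ mc)/integrableP[_] := bF.2 M.
set J := (\int[mu]_x _)%E => Joo.
have J0 : (0 <= J)%E by exact: integral_ge0.
have Jf : J \is a fin_num by rewrite ge0_fin_numE.
by rewrite -(fineK Jf) -!EFinM ltry.
Qed.

(** Where [w x] is nonzero it can be divided out; with the indicators of growing cubes for [w],
    almost every point is reached. *)
Lemma ae_kernel_integrable : {ae mu, forall x : X, w x != 0 ->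
  l1.-integrable setT (fun s => (k (x ord0 j) s * F (upd j x s))%:E)}.
Proof.
apply: filterS (ae_integrable1 iA) => x ix wx.
have := integrableZl measurableT (w x)^-1 ix.
apply: eq_integrable => // s _.
by rewrite /A/= -EFinM mulrC mulrK ?unitfE.
Qed.

Lemma measurable_kernel :
  measurable_fun setT (fun x : X => \int[l1]_s (k (x ord0 j) s * F (upd j x s))).
Proof.
apply: (measurableT_comp (f := fine)) => //.
apply: (measurable_fun_integral2 l1
  (F := fun p : X * R => (k (p.1 ord0 j) p.2 * F (upd j p.1 p.2))%:E)).
apply/measurable_EFinP.
apply: measurable_funM; last by apply: (measurableT_comp mF); mfun.
by apply: (measurableT_comp mk (g := fun p : X * R => (p.1 ord0 j, p.2))); mfun.
Qed.

Let mLHS : measurable_fun setT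
  (fun x : X => ((\int[l1]_s (k (x ord0 j) s * F (upd j x s))) * w x)%:E).
Proof.
by apply/measurable_EFinP; apply: measurable_funM => //; exact: measurable_kernel.
Qed.

Let aeLHS : {ae mu, forall x : X, setT x -> (\int[l1]_s (A (x, s))%:E)%E =
  ((\int[l1]_s (k (x ord0 j) s * F (upd j x s))) * w x)%:E}.
Proof.
apply: filterS (ae_integrable1 iA) => x ix _.
rewrite mulrC -integral_scale.
  by apply: eq_integral => s _; rewrite /A mulrC.
by move: ix; apply: eq_integrable => // s _; rewrite /A mulrC.
Qed.

Lemma kernel_integrable : mu.-integrable setT
  (fun x : X => ((\int[l1]_s (k (x ord0 j) s * F (upd j x s))) * w x)%:E).
Proof.
exact: ae_eq_integrable mLHS aeLHS (integrable_fubini_F iA).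
Qed.

(** The measure-preserving exchange of x_j with [s] moves the kernel from [F] to [w] and transposes
    its arguments; Fubini on both sides is licensed by [iA]. *)
Lemma kernel_adjoint :
  (\int[mu]_x ((\int[l1]_s (k (x ord0 j) s * F (upd j x s))) * w x)%:E =
   \int[mu]_x (F x * \int[l1]_s (k s (x ord0 j) * w (upd j x s)))%:E)%E.
Proof.
transitivity (\int[mu]_x (fubini_F l1 (fun p => (A p)%:E) x))%E.
  apply: ae_eq_integral => //; first exact: measurable_int (integrable_fubini_F iA).
  by apply: filterS aeLHS => x h xT; rewrite -h.
rewrite (integral12_prod_meas1 iA).
rewrite -(integral_swap j mA).
have iAs : (mu \x l1)%E.-integrable setT (fun p => (A (swap j p))%:E).
  apply/integrableP; split; first exact: (measurableT_comp mA (mswap j)).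
  have /integrableP[_] := iA; apply: le_lt_trans.
  rewrite (integral_swap j (F := fun p => `|(A p)%:E|%E))//.
  by apply: measurableT_comp => //; exact: mA.
rewrite -(integral12_prod_meas1 iAs).
have AE x s : A (swap j (x, s)) = F x * (k s (x ord0 j) * w (upd j x s)).
  by rewrite /A/= upd_coord upd_upd upd_id; ring.
apply: ae_eq_integral => //.
- exact: measurable_int (integrable_fubini_F iAs).
- apply/measurable_EFinP; apply: measurable_funM => //.
  apply: (measurableT_comp (f := fine)) => //.
  apply: (measurable_fun_integral2 l1
    (F := fun p : X * R => (k p.2 (p.1 ord0 j) * w (upd j p.1 p.2))%:E)).
  apply/measurable_EFinP.
  apply: measurable_funM; last by apply: (measurableT_comp mw); mfun.
  by apply: (measurableT_comp mk (g := fun p : X * R => (p.2, p.1 ord0 j))); mfun.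
apply: filterS (ae_integrable1 iAs) => x ix _.
rewrite -integral_scale; first by apply: eq_integral => s _; rewrite AE.
by move: ix; apply: eq_integrable => // s _; rewrite AE.
Qed.

End kernel.
End coordinate_kernel.

(** * The difference between a smoothed and a sharp step *)

Section smoothed_step.
Context {R : realType}.
Local Notation l1 := (@lebesgue_measure R).

Definition eta (t : R) : R := (\int[l1]_s bump 0 1 0 s)^-1 * bump 0 1 0 t.

(** Its derivative in [s] is eta minus the point mass at [t], so for smooth g the integral of K(t,
    s) g'(s) ds is g(t) minus the eta-mean of g. Both steps equal 0 far to the left and 1 far to the
    right, hence compact support in [s]. *)
Definition step_kernel (t s : R) : R := primitive eta s - (t < s)%R%:R.

Let c0 : 0 < \int[l1]_s bump 0 1 0 s :> R.
Proof. exact: Rintegral_bump_gt0. Qed.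

Lemma eta_ge0 t : 0 <= eta t.
Proof. by rewrite mulr_ge0 ?bump_ge0// invr_ge0 ltW. Qed.

Lemma eta_out t : ~~ (0 < t < 1) -> eta t = 0.
Proof. by move=> t01; rewrite /eta bump_out ?mulr0. Qed.

Lemma test1_eta : test1 eta.
Proof.
have [Cb [M M0 bM]] := test1_bump (0 : R) 1 0.
split; first by move=> k; exact: Ck_Z.
by exists M => // t Mt; rewrite /eta bM ?mulr0.
Qed.

Lemma Rintegral_eta : \int[l1]_t eta t = 1.
Proof.
rewrite RintegralZl//; first by rewrite mulVf ?gt_eqF.
exact: (test1_integrable (test1_bump 0 1 0)).
Qed.

Lemma eta_bounded : exists2 B, 0 < B & forall t, `|eta t| <= B.
Proof. exact: test1_bounded test1_eta. Qed.

Lemma primitive_eta_0 t : t <= 0 -> primitive eta t = 0.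
Proof.
move=> t0; rewrite /primitive Rintegral_mkcond /Rintegral integral0_eq// => s _.
rewrite patchE; case: ifPn => //; rewrite inE/= in_itv/= => st.
rewrite eta_out//; apply/negP; lra.
Qed.

Lemma primitive_eta_1 t : 1 <= t -> primitive eta t = 1.
Proof.
move=> t1; rewrite -Rintegral_eta /primitive Rintegral_mkcond.
apply: eq_Rintegral => s _; rewrite patchE; case: ifPn => //.
rewrite notin_setE/= in_itv/= => /negP; rewrite -ltNge => ts.
rewrite eta_out//; apply/negP; lra.
Qed.

Lemma continuous_primitive_eta : continuous (primitive eta).
Proof.
apply: derivable1_continuous => t; apply: (is_derive_primitive t _ _).1.
  exact: test1_integrable test1_eta.
exact: test1_continuous test1_eta.
Qed.

Lemma primitive_eta_ge0 t : 0 <= primitive eta t.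
Proof. by apply: Rintegral_ge0 => s _; exact: eta_ge0. Qed.

Lemma primitive_eta_le1 t : primitive eta t <= 1.
Proof.
rewrite -Rintegral_eta /primitive Rintegral_mkcond.
have ie := test1_integrable test1_eta.
apply: le_Rintegral => //.
  have mt : measurable (`]-oo, t]%classic : set (measurableTypeR R)) by [].
  have iet : l1.-integrable `]-oo, t]%classic (EFin \o eta) by exact: integrableS ie.
  by have /(integrable_mkcond _ mt) := iet; rewrite -restrict_EFin.
by move=> s _; rewrite patchE; case: ifP => // _; exact: eta_ge0.
Qed.

Lemma step_kernel_bounded t s : `|step_kernel t s| <= 1.
Proof.
have := primitive_eta_ge0 s; have := primitive_eta_le1 s; rewrite /step_kernel.
by case: (t < s) => /= h1 h2; rewrite ler_norml; apply/andP; split; lra.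
Qed.

Lemma step_kernel_supp (t s : R) :
  `|step_kernel t s| <= \1_`[- (`|t| + 1), `|t| + 1]%classic s.
Proof.
rewrite indicE; have [sA|sA] := boolP (s \in _); first exact: step_kernel_bounded.
rewrite normr_le0; apply/eqP; move: sA; rewrite notin_setE/= in_itv/= => /negP sA.
have := normr_ge0 t; have := ler_norm t; have := ler_norm (- t); rewrite normrN => h1 h2 h3.
rewrite /step_kernel; have [s0|s0] := ltP s 0%R.
  have ts : (s < - (`|t| + 1))%R.
    by rewrite ltNge; apply/negP => h; move: sA; rewrite h/= => /negP; apply; lra.
  rewrite primitive_eta_0; last exact: ltW.
  by rewrite ltNge (_ : (s <= t)%R) ?subr0//; lra.
have ts : (`|t| + 1 < s)%R.
  by rewrite ltNge; apply/negP => h; move: sA; rewrite h andbT => /negP; apply; lra.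
rewrite primitive_eta_1; last by lra.
by rewrite (_ : (t < s)%R) ?subrr//; lra.
Qed.

(** Beyond radius M > 1 the point [t] lies on the same side of [s] as of the support of [eta], where
    the two steps coincide. *)
Lemma step_kernel_out M s t : 1 < M -> `|s| < M -> M <= `|t| ->
  step_kernel s t = 0.
Proof.
move=> M1; rewrite ltr_norml lter_normr /step_kernel => /andP[Ms sM] /orP[Mt|Mt].
  rewrite primitive_eta_1; last lra.
  by rewrite (lt_le_trans sM Mt) subrr.
rewrite primitive_eta_0; last lra.
by rewrite ltNge (_ : t <= s) ?subr0//; lra.
Qed.

Lemma measurable_step_kernel :
  measurable_fun setT (fun p : R * R => step_kernel p.1 p.2).
Proof.
apply: measurable_funB.
  apply: (measurableT_comp (f := primitive eta)); last exact: measurable_snd.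
  apply: continuous_measurable_fun; exact: continuous_primitive_eta.
rewrite (_ : (fun _ => _) =
  (fun b : bool => b%:R) \o (fun p : R * R => p.1 < p.2))//.
apply: measurableT_comp => //.
by apply: measurable_fun_ltr; mfun.
Qed.

(* Pairing the kernel in its second variable integrates a test function once,
   after its mean has been moved to [eta]. *)
Lemma integral_step_kernel (f : R -> R) t : test1 f ->
  \int[l1]_s (step_kernel s t * f s) =
  - primitive (fun s => f s - (\int[l1]_s f s) * eta s) t.
Proof.
move=> tf; have it := test1_integrable tf; have ie := test1_integrable test1_eta.
set a := \int[l1]_s f s.
have i1 : l1.-integrable setT (fun s => (primitive eta t * f s)%:E).
  exact: (integrableZl measurableT (primitive eta t) it).
have mt : measurable (`]-oo, t[%classic : set (measurableTypeR R)) by [].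
have i2 : l1.-integrable setT (EFin \o (f \_ `]-oo, t[)).
  have itt : l1.-integrable `]-oo, t[%classic (EFin \o f) by exact: integrableS it.
  by have /(integrable_mkcond _ mt) := itt; rewrite -restrict_EFin.
transitivity (\int[l1]_s (primitive eta t * f s - (f \_ `]-oo, t[) s)).
  apply: eq_Rintegral => s _; rewrite /step_kernel mulrBl patchE; congr (_ - _).
  by rewrite mem_setE in_itv/=; case: (s < t); rewrite ?mul1r ?mul0r.
rewrite RintegralB// RintegralZl//.
rewrite -Rintegral_mkcond -/a.
have -> : \int[l1]_(s in `]-oo, t[) f s = primitive f t.
  by rewrite /primitive Rintegral_itv_bndo_bndc//; exact: integrableS it.
rewrite [in RHS]/primitive RintegralB//; last 2 first.
- exact: integrableS it.
- apply: (integrableS measurableT) => //.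
  exact: (integrableZl measurableT a ie).
rewrite RintegralZl//; last exact: integrableS ie.
rewrite /primitive; ring.
Qed.

End smoothed_step.

(** Integrability is part of the statement because the real-valued integral is a truncation by
    [fine], which sends infinite values to 0. *)
Definition represented (R : realType) d (j : 'I_d) (F F' M : 'rV[R]_d -> R)
    (x : 'rV[R]_d) : Prop :=
  (@lebesgue_measure R).-integrable setT
    (fun s => (step_kernel (x ord0 j) s * F' (upd j x s))%:E) /\
  F x = M x + \int[@lebesgue_measure R]_s
    (step_kernel (x ord0 j) s * F' (upd j x s)).

(** * Almost everywhere representation by the weak derivative *)

Section weak_representation.
Context {R : realType} {d : nat}.
Local Notation X := 'rV[R]_d.
Local Notation mu := (@lebesgue_rV R d).
Local Notation l1 := (@lebesgue_measure R).
Variables (j : 'I_d) (F F' : X -> R).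
Hypotheses (bF : box_integrable F) (bF' : box_integrable F').
Hypothesis FF' : forall phi, (forall i, test1 (phi i)) ->
  (\int[mu]_x (F x * wprod (der_on (pred1 j) phi) x)%:E =
   - \int[mu]_x (F' x * wprod phi x)%:E)%E.

Implicit Types phi : 'I_d -> R -> R.

(** The eta-mean viewed as a kernel that ignores its first argument, so that the lemmas on
    [step_kernel] and on the mean are the same. *)
Let keta (t s : R) := eta s.

Let mketa : measurable_fun setT (fun p : R * R => keta p.1 p.2).
Proof.
apply: (measurableT_comp (f := eta)); last exact: measurable_snd.
exact: test1_measurable test1_eta.
Qed.

Let keta_out (M s t : R) : 1 < M -> `|s| < M -> M <= `|t| -> keta s t = 0.
Proof.
move=> M1 _ Mt; rewrite /keta eta_out//; apply/negP => /andP[t0 t1].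
by move: Mt; rewrite lter_normr => /orP[]; lra.
Qed.

Let cube_dominated_cube M : cube_dominated (\1_(cube M) : X -> R).
Proof.
(* The radius is raised to at least 2 to meet the requirement that it exceed 1. *)
exists 1, (Num.max M 2); split => //; first by rewrite lt_max ltr1n orbT.
move=> x; rewrite mul1r ger0_norm// !indicE ler_nat.
case: (boolP (x \in cube M)) => // xM; rewrite mem_set//=.
move: xM; rewrite inE => xM i; have /andP[h1 h2] := xM i.
have MM : M <= Num.max M 2 by rewrite le_max lexx.
by rewrite (lt_le_trans h2)// andbT (le_lt_trans _ h1)// lerN2.
Qed.

Lemma cube_dominated_wprod phi : (forall i, test1 (phi i)) ->
  cube_dominated (wprod phi : X -> R).
Proof.
move=> tphi.
have /choice[B hB] i : exists B, 0 < B /\ forall t, `|phi i t| <= B.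
  by have [B B0 pB] := test1_bounded (tphi i); exists B.
have /choice[M hM] i : exists M, 0 < M /\ forall t, M < `|t| -> phi i t = 0.
  by have [_ [M M0 pM]] := tphi i; exists M.
pose N : R := 2 + \sum_i M i.
have MN i : M i < N.
  rewrite /N (bigD1 i)//= addrCA ltrDl ltr_pwDl// sumr_ge0// => k _.
  by apply: ltW; case: (hM k).
exists (\prod_i B i), N; split.
- by apply: prodr_ge0 => i _; apply: ltW; case: (hB i).
- rewrite /N (lt_le_trans (ltr1n R 2 : 1 < 2))// lerDl.
  by apply: sumr_ge0 => k _; apply: ltW; case: (hM k).
move=> x; rewrite indicE; have [xN|xN] := boolP (x \in cube N).
  rewrite mulr1 normr_prod; apply: ler_prod => i _.
  by rewrite normr_ge0/=; have [_ ->] := hB i.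
have [i hi] : exists i, ~~ (- N < x ord0 i < N).
  apply: contrapT => /forallNP h; move/negP: xN; apply; rewrite inE => i.
  by apply/negPn/negP; exact: h.
rewrite mulr0 /wprod (bigD1 i)//= (hM i).2 ?mul0r ?normr0//.
move: hi; rewrite -ltr_norml -leNgt; exact: lt_le_trans.
Qed.

Let c (phi : 'I_d -> R -> R) (x : X) : R := \prod_(i < d | i != j) phi i (x ord0 i).

Let wprod_updE (phi : 'I_d -> R -> R) x s :
  wprod phi (upd j x s) = phi j s * c phi x.
Proof.
rewrite /wprod (bigD1 j)//= mxE eqxx; congr (_ * _).
by apply: eq_bigr => i ij; rewrite mxE (negbTE ij).
Qed.

Let wprodE (phi : 'I_d -> R -> R) x : wprod phi x = phi j (x ord0 j) * c phi x.
Proof. by rewrite -{1}(upd_id j x) wprod_updE. Qed.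

Let mean (x : X) := \int[l1]_s (eta s * F (upd j x s)).
Let incr (x : X) := \int[l1]_s (step_kernel (x ord0 j) s * F' (upd j x s)).
Let G x := F x - mean x - incr x.

Let m_mean : measurable_fun setT mean.
Proof. exact: (measurable_kernel j mketa bF). Qed.

Let m_incr : measurable_fun setT incr.
Proof. exact: (measurable_kernel j measurable_step_kernel bF'). Qed.

Let box_integrable_kernel (k : R -> R -> R) (B : R) (E : X -> R) :
  measurable_fun setT (fun p : R * R => k p.1 p.2) ->
  (forall s t, `|k s t| <= B) ->
  (forall M s t, 1 < M -> `|s| < M -> M <= `|t| -> k s t = 0) ->
  box_integrable E ->
  box_integrable (fun x : X => \int[l1]_s (k (x ord0 j) s * E (upd j x s))).
Proof.
move=> mk kB k0 bE; split; first exact: (measurable_kernel j mk bE).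
move=> M; have mc : measurable (cube M : set X) by exact: measurable_box.
apply/(integrable_mkcond _ mc).
have := kernel_integrable j mk kB k0 bE (measurable_indic mc)
  (cube_dominated_cube M).
apply: eq_integrable => // x _; rewrite patchE indicE.
by case: ifP => _; rewrite ?mulr1 ?mulr0.
Qed.

Let eta_wprod phi (x : X) : (forall i, test1 (phi i)) ->
  \int[l1]_s (keta s (x ord0 j) * wprod phi (upd j x s)) =
  eta (x ord0 j) * (\int[l1]_s phi j s) * c phi x.
Proof.
move=> tphi; have it := test1_integrable (tphi j).
rewrite [RHS]mulrAC -RintegralZl//.
by apply: eq_Rintegral => s _; rewrite wprod_updE /keta; ring.
Qed.

Let step_wprod phi (x : X) : (forall i, test1 (phi i)) ->
  \int[l1]_s (step_kernel s (x ord0 j) * wprod phi (upd j x s)) =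
  - primitive (fun s => phi j s - (\int[l1]_s phi j s) * eta s) (x ord0 j)
    * c phi x.
Proof.
move=> tphi; rewrite -integral_step_kernel// -RintegralZr//; last first.
  have [B B0 pB] := test1_bounded (tphi j).
  have it := test1_integrable (tphi j).
  apply: le_integrable it => //.
    apply/measurable_EFinP; apply: measurable_funM.
      by apply: (measurableT_comp measurable_step_kernel (g := fun s : R => (s, x ord0 j))); mfun.
    exact: test1_measurable.
  move=> s _; rewrite lee_fin normrM ler_piMl//; exact: step_kernel_bounded.
by apply: eq_Rintegral => s _; rewrite wprod_updE; ring.
Qed.

(** Write a for the integral of phi_j, V for the primitive of q = phi_j - a eta, and c for the
    product of the other factors. By adjointness the mean pairs [F] with a eta c, and the increment
    pairs [F'] with -V c. What remains is [F] against q c = d_j(V c) plus [F'] against V c, and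
    these cancel by [FF'], since V c is again a tensor product of test functions. *)
Let G_wprod phi : (forall i, test1 (phi i)) ->
  (\int[mu]_x (G x * wprod phi x)%:E = 0)%E.
Proof.
move=> tphi.
have mw : measurable_fun setT (wprod phi).
  by apply: measurable_wprod => i; exact: test1_measurable.
have dw := cube_dominated_wprod tphi.
have [Be Be0 eB] := @eta_bounded R.
pose a : R := \int[l1]_s phi j s.
pose q := fun s => phi j s - a * eta s.
have tq : test1 q by apply: test1_lincomb => //; exact: test1_eta.
have q0 : \int[l1]_s q s = 0.
  have it := test1_integrable (tphi j); have ie := test1_integrable (@test1_eta R).
  have iae : l1.-integrable setT (EFin \o (fun s => a * eta s)).
    exact: (integrableZl measurableT a ie).
  by rewrite RintegralB// RintegralZl// Rintegral_eta mulr1 subrr.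
have [tV dV] := test1_primitive tq q0.
pose phi' i := if i == j then primitive q else phi i.
have tphi' i : test1 (phi' i) by rewrite /phi'; case: ifP.
have cphi' x : c phi' x = c phi x.
  by apply: eq_bigr => i /negbTE ij; rewrite /phi' ij.
have cder x : c (der_on (pred1 j) phi') x = c phi x.
  by rewrite -cphi'; apply: eq_bigr => i ij; rewrite /der_on /= (negbTE ij).
have dw' := cube_dominated_wprod tphi'.
have mw' : measurable_fun setT (wprod phi').
  by apply: measurable_wprod => i; exact: test1_measurable.
have iF := box_integrable_mul bF mw dw.
have iM := kernel_integrable j mketa (fun _ s => eB s) keta_out bF mw dw.
have iI := kernel_integrable j measurable_step_kernel step_kernel_bounded
  step_kernel_out bF' mw dw.
have adjM := kernel_adjoint j mketa (fun _ s => eB s) keta_out bF mw dw.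
have adjI := kernel_adjoint j measurable_step_kernel step_kernel_bounded
  step_kernel_out bF' mw dw.
transitivity (\int[mu]_x ((F x * wprod phi x)%:E - (mean x * wprod phi x)%:E
   - (incr x * wprod phi x)%:E))%E.
  by apply: eq_integral => x _; rewrite -!EFinB /G !mulrBl.
have iM' : mu.-integrable setT (fun x => (mean x * wprod phi x)%:E) := iM.
have iI' : mu.-integrable setT (fun x => (incr x * wprod phi x)%:E) := iI.
rewrite integralB//; last exact: integrableB.
rewrite integralB//.
have fF := integrable_fin_num measurableT iF.
have fM := integrable_fin_num measurableT iM.
rewrite [X in (_ - X - _)%E]adjM [X in (_ - X)%E]adjI.
have iS : mu.-integrable setT (fun x =>
    (F x * \int[l1]_s (keta s (x ord0 j) * wprod phi (upd j x s)))%:E).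
  pose phi1 i := if i == j then fun s => a * eta s else phi i.
  have tphi1 i : test1 (phi1 i).
    rewrite /phi1; case: ifP => // _; have [Ce [N N0 Ne]] := @test1_eta R.
    split=> [k|]; first exact: Ck_Z.
    by exists N => // t Nt; rewrite Ne ?mulr0.
  have mw1 : measurable_fun setT (wprod phi1 : X -> R).
    by apply: measurable_wprod => i; exact: test1_measurable.
  have := box_integrable_mul bF mw1 (cube_dominated_wprod tphi1).
  apply: eq_integrable => // x _; rewrite eta_wprod// wprodE /phi1 eqxx.
  rewrite (_ : c phi1 x = c phi x); first by congr (_ * _)%:E; rewrite /a; ring.
  by apply: eq_bigr => i /negbTE ij; rewrite /phi1 ij.
rewrite -integralB//.
transitivity (\int[mu]_x (F x * wprod (der_on (pred1 j) phi') x)%:E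
   + \int[mu]_x (F' x * wprod phi' x)%:E)%E.
  congr (_ + _)%E.
    apply: eq_integral => x _; rewrite -EFinB -mulrBr; congr (_ * _)%:E.
    rewrite eta_wprod// !wprodE cder /der_on /= eqxx /phi' eqxx dV /q -/a.
    ring.
  have iF' := box_integrable_mul bF' mw' dw'.
  transitivity (- ((-1)%:E * \int[mu]_x (F' x * wprod phi' x)%:E))%E.
    rewrite -integralZl//; congr (- _)%E; apply: eq_integral => x _.
    rewrite -EFinM step_wprod// wprodE cphi' /phi' eqxx /q -/a; congr EFin; ring.
  by rewrite mulN1e oppeK.
rewrite FF'// addeC subee//.
exact: (integrable_fin_num measurableT (box_integrable_mul bF' mw' dw')).
Qed.

Lemma weak_mean_upd t (x : X) :
  \int[l1]_s (eta s * F (upd j (upd j x t) s)) =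
  \int[l1]_s (eta s * F (upd j x s)).
Proof. by apply: eq_Rintegral => s _; rewrite upd_upd. Qed.

Lemma measurable_weak_mean :
  measurable_fun setT (fun x : X => \int[l1]_s (eta s * F (upd j x s))).
Proof. exact: (measurable_kernel j mketa bF). Qed.

Lemma weak_representation : {ae mu, forall x : X, represented j F F'
  (fun y => \int[l1]_s (eta s * F (upd j y s))) x}.
Proof.
rewrite -[fun _ => _]/mean.
have [Be Be0 eB] := @eta_bounded R.
have bM := box_integrable_kernel mketa (fun _ s => eB s) keta_out bF.
have bI := box_integrable_kernel measurable_step_kernel step_kernel_bounded
  step_kernel_out bF'.
have bG : box_integrable G.
  split; first by apply: measurable_funB => //; apply: measurable_funB => //; case: bF.
  move=> M; have mc : measurable (cube M : set X) by exact: measurable_box.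
  have := integrableB mc (integrableB mc (bF.2 M) (bM.2 M)) (bI.2 M).
  exact: eq_integrable.
(* Integrability along the fibre is first obtained on each cube, with its indicator as weight; the
   countably many exceptional null sets are then united. *)
have ae1 : {ae mu, forall x : X, forall n, x \in cube n%:R ->
  l1.-integrable setT (fun s => (step_kernel (x ord0 j) s * F' (upd j x s))%:E)}.
  apply: ae_foralln => n.
  have mc : measurable (cube n%:R : set X) by exact: measurable_box.
  have := ae_kernel_integrable j measurable_step_kernel step_kernel_bounded
    step_kernel_out bF' (measurable_indic mc) (cube_dominated_cube n%:R).
  by apply: filterS => x h xn; apply: h; rewrite indicE xn oner_eq0.
have := ae_eq0_test_functions bG G_wprod.
apply: filterS2 ae1 => x ix Gx; split.
  have [n _ xn] : (\bigcup_n cube n%:R) x by rewrite cube_cover.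
  by apply: (ix n); rewrite inE.
by apply/eqP; rewrite -subr_eq0 opprD addrA; apply/eqP.
Qed.

End weak_representation.

Section weak_derivatives.
Context {R : realType} {d : nat}.
Local Notation X := 'rV[R]_d.
Local Notation mu := (@lebesgue_rV R d).
Implicit Types (phi : 'I_d -> R -> R) (u : {set 'I_d}) (f g F : X -> R).

Lemma test1_derive1 (f : R -> R) : test1 f -> test1 (derive1 f).
Proof.
move=> [Cf [M M0 fM]]; split=> [k|]; first by have [] := Cf k.+1.
exists M => // t Mt; rewrite derive1E.
rewrite (@near_eq_derive _ _ _ f (cst 0))//.
  exact: derive_cst.
have oM : open [set s : R | M < `|s|].
  apply: (@open_comp _ _ (fun s : R => `|s|) [set s | M < s]).
    by move=> s _; exact: norm_continuous.
  exact: open_gt.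
have : nbhs t [set s : R | M < `|s|] by exact: open_nbhs_nbhs.
by apply: filterS => s; exact: fM.
Qed.

Lemma locally_integrable_box_integrable g :
  locally_integrable_rV g -> box_integrable g.
Proof.
move=> [mg ig]; split => // M.
pose K : set X := [set x | forall i, `[- M, M]%classic (x ord0 i)].
have cK : compact K.
  by apply: (@rV_compact R d (fun=> `[- M, M]%classic)) => i; exact: segment_compact.
have mK : measurable K.
  rewrite (_ : K = \bigcap_(i in [set: 'I_d]) ((fun x : X => x ord0 i) @^-1` `[- M, M]%classic)).
    apply: fin_bigcap_measurable => // i _.
    rewrite -[X in measurable X]setTI.
    by apply: (measurable_rV_coord i) => //; exact: measurable_itv.
  by apply/seteqP; split => x /= h i => [_|]; exact: h.
have mc : measurable (cube M : set X) by exact: measurable_box.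
apply: (@integrableS _ _ _ mu K) => //.
  move=> x h i /=; rewrite in_itv/=; have /andP[/ltW-> /ltW->//] := h i.
apply/integrableP; split; last exact: ig.
by apply: measurable_funTS; exact/measurable_EFinP.
Qed.

Lemma integral_wprod_fine F phi : box_integrable F -> (forall i, test1 (phi i)) ->
  (\int[mu]_x (F x * wprod phi x)%:E = (\int[mu]_x (F x * wprod phi x))%:E)%E.
Proof.
move=> bF tphi; rewrite /Rintegral fineK//.
apply: (integrable_fin_num measurableT); apply: box_integrable_mul => //.
  by apply: measurable_wprod => i; exact: test1_measurable.
exact: cube_dominated_wprod.
Qed.

(** Testing [F] against the [j]-th derivative of a tensor product, and [F'] against the product
    itself, gives the same integral of [f], with signs that differ by -1. So d^(u+j) f is the weak
    derivative of d^u f in direction [j], at least against tensor products. *)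
Lemma weak_deriv_step f u j F F' : j \notin u ->
  is_weak_deriv u f F -> is_weak_deriv (j |: u) f F' ->
  forall phi, (forall i, test1 (phi i)) ->
  (\int[mu]_x (F x * wprod (der_on (pred1 j) phi) x)%:E =
   - \int[mu]_x (F' x * wprod phi x)%:E)%E.
Proof.
move=> ju [lF wF] [lF' wF'] phi tphi.
have tder i : test1 (der_on (pred1 j) phi i).
  by rewrite /der_on; case: ifP => // _; exact: test1_derive1.
rewrite !integral_wprod_fine//; try exact: locally_integrable_box_integrable.
rewrite wF; last exact: test_function_wprod.
rewrite wF'; last exact: test_function_wprod.
rewrite !mderiv_wprod; last 2 first.
- by move=> i n; have [] := tphi i.
- by move=> i n; have [] := tder i.
rewrite cardsU1 ju exprS mulN1r mulNr EFinN oppeK.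
congr (_ * _)%:E; apply: eq_Rintegral => x _; congr (_ * _).
rewrite /wprod; apply: eq_bigr => i _; rewrite /der_on !inE.
case: (eqVneq i j) => [->|ij] /=; first by rewrite (negbTE ju).
by case: (i \in u).
Qed.

(** Needed because [wderiv] chooses a representative even for the empty set, and it need not be [f]
    itself. *)
Lemma weak_deriv0 f F : locally_integrable_rV f -> is_weak_deriv finset.set0 f F ->
  {ae mu, forall x, F x = f x}.
Proof.
move=> lf [lF wF].
have bF := locally_integrable_box_integrable lF.
have bf := locally_integrable_box_integrable lf.
have bG : box_integrable (fun x => F x - f x).
  split; first by apply: measurable_funB; [case: bF|case: bf].
  move=> M; have mc : measurable (cube M : set X) by exact: measurable_box.
  have := integrableB mc (bF.2 M) (bf.2 M).
  exact: eq_integrable.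
have := ae_eq0_test_functions bG; case=> [phi tphi|N [mN N0 QN]]; last first.
  exists N; split => // x /= nFf; apply: QN => /= /eqP; rewrite subr_eq0.
  by move/eqP.
have mw : measurable_fun setT (wprod phi : X -> R).
  by apply: measurable_wprod => i; exact: test1_measurable.
have dw := cube_dominated_wprod tphi.
transitivity (\int[mu]_x ((F x * wprod phi x)%:E - (f x * wprod phi x)%:E))%E.
  by apply: eq_integral => x _; rewrite -EFinB mulrBl.
rewrite integralB//; try exact: box_integrable_mul.
rewrite !integral_wprod_fine// wF; last exact: test_function_wprod.
rewrite cards0 expr0 mul1r mderiv_wprod; last by move=> i n; have [] := tphi i.
rewrite -EFinB (_ : wprod _ = wprod phi) ?subrr//.
by apply/funext => x; apply: eq_bigr => i _; rewrite /der_on /= inE.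
Qed.

Lemma wderivP u f : (exists g, is_weak_deriv u f g) ->
  is_weak_deriv u f (wderiv u f).
Proof. exact: xgetPex. Qed.

End weak_derivatives.

(** * Integrating out coordinates *)

Section conditional_expectation.
Context {R : realType}.
Variables (d : nat) (rho psi : 'I_d -> R -> R).
Hypothesis rho_density : forall j, is_density (rho j).
Hypothesis psi_weight : forall j, is_weight (psi j).
Local Notation X := 'rV[R]_d.
Local Notation l1 := (@lebesgue_measure R).
Local Notation mu := (@lebesgue_rV R d).
Local Notation P := (prodP rho_density).
Local Notation cexp := (cexp rho_density).
Implicit Types (r u : {set 'I_d}) (F : X -> R) (G : X -> \bar R) (x z : X).

Lemma mix_upd r j x z s : j \notin r -> upd j (mix r x z) s = mix r (upd j x s) z.
Proof.
move=> jr; apply/rowP => i; rewrite !mxE; case: eqP => // ->.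
by rewrite (negbTE jr).
Qed.

Lemma mix_coord r j x z : j \notin r -> mix r x z ord0 j = x ord0 j.
Proof. by move=> jr; rewrite mxE (negbTE jr). Qed.

(** The density with respect to the product probability of the measure with density psi_i in the
    directions of [u] and rho_i in the others. *)
Definition weight u x : R := \prod_(i in u) (psi i (x ord0 i) / rho i (x ord0 i)).

Lemma weight_pos u x : 0 < weight u x.
Proof.
apply: prodr_gt0 => i _; apply: divr_gt0; last exact: density_gt0.
exact: weight_gt0.
Qed.

Lemma measurable_weight_prod u : measurable_fun setT (weight u).
Proof.
pose q i := if i \in u then fun t : R => psi i t / rho i t else fun=> 1.
rewrite (_ : weight u = wprod q).
  apply: measurable_wprod => i; rewrite /q; case: ifP => // _.
  apply: measurable_funM; first exact: measurable_weight.
  rewrite (_ : (fun t => _) = fun t => rho i t `^ (-1)).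
    apply: (measurableT_comp (@measurable_powR _ _)).
    exact: measurable_density.
  by apply/funext => t; rewrite powR_inv1// ltW// density_gt0.
apply/funext => x; rewrite /weight big_mkcond; apply: eq_bigr => i _.
by rewrite /q; case: ifP.
Qed.

Lemma weight_upd u j x t : j \notin u -> weight u (upd j x t) = weight u x.
Proof.
move=> ju; apply: eq_bigr => i iu; rewrite !mxE; case: eqP => // ij.
by move: ju; rewrite -ij iu.
Qed.

Lemma weight_mix u r x z : (forall i, i \in u -> i \notin r) ->
  weight u (mix r x z) = weight u x.
Proof.
by move=> ur; apply: eq_bigr => i /ur ir; rewrite mix_coord.
Qed.

Lemma weightU1 u j x : j \notin u ->
  weight (j |: u) x = psi j (x ord0 j) / rho j (x ord0 j) * weight u x.
Proof. by move=> ju; rewrite /weight big_setU1. Qed.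

Local Open Scope ereal_scope.

Lemma ae_lty_integral G : measurable_fun setT G -> (forall x, 0 <= G x) ->
  \int[P]_x G x < +oo -> {ae P, forall x, G x < +oo}.
Proof.
move=> mG G0 Goo.
have iG : P.-integrable setT G.
  apply/integrableP; split => //.
  by under eq_integral do rewrite gee0_abs//.
apply: filterS (integrable_ae measurableT iG) => x /(_ I).
by rewrite ge0_fin_numE.
Qed.

(** On almost every fibre [G] is integrable, hence almost everywhere finite; so the set where [G] is
    infinite has conditional probability 0, and therefore probability 0. This passes finiteness from
    larger to smaller sets of averaged coordinates. *)
Lemma ae_lty_cexp s G : measurable_fun setT G -> (forall x, 0 <= G x) ->
  {ae P, forall x, cexp s G x < +oo} -> {ae P, forall x, G x < +oo}.
Proof.
move=> mG G0 aeG.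
pose A := [set x | G x = +oo].
have mA : measurable A.
  by rewrite (_ : A = G @^-1` [set +oo]) // -[X in measurable X]setTI; exact: mG.
pose I x : \bar R := (\1_A x)%:E.
have mI : measurable_fun setT I by apply/measurable_EFinP; exact: measurable_indic.
have I0 x : 0 <= I x by rewrite lee_fin.
have cI : {ae P, forall x, cexp s I x = 0}.
  apply: filterS aeG => x Gx.
  have mGx : measurable_fun setT (fun z => G (mix s x z)).
    by apply: (measurableT_comp mG); mfun.
  have iG : P.-integrable setT (fun z => G (mix s x z)).
    by apply/integrableP; split => //; under eq_integral do rewrite gee0_abs//.
  rewrite /cexp/= -[RHS](@integral0 _ _ _ P setT).
  apply: ae_eq_integral => //; first by apply: (measurableT_comp mI); mfun.
  apply: filterS (integrable_ae measurableT iG) => z /(_ Logic.I) Gz _.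
  rewrite /I indicE memNset// /A /= => Goo; by rewrite Goo in Gz.
have PA : P A = 0.
  rewrite -(setIT A) -integral_indic// -/(\int[P]_x I x) -(integral_cexp _ s mI)//.
  rewrite -[RHS](@integral0 _ _ _ P setT).
  apply: ae_eq_integral => //; first exact: measurable_cexp.
  by apply: filterS cI => x -> _.
exists A; split => // x /= /negP; rewrite -leNgt leye_eq => /eqP//.
Qed.

(** The value is a true average only where the average of |F| is finite; elsewhere [fine] may put 0.
    [expectE] records the condition. *)
Definition expect r F x : R := fine (cexp r (EFin \o F) x).

Lemma measurable_expect r F : measurable_fun setT F ->
  measurable_fun setT (expect r F).
Proof.
move=> mF; apply: (measurableT_comp (f := fine)) => //.
by apply: measurable_cexp; exact/measurable_EFinP.
Qed.

(** This is N(r, u), with an arbitrary [F] in the place of d^u f. *)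
Definition energy r u F : \bar R :=
  \int[P]_x (expect r F x ^+ 2 * weight u x)%:E.

Lemma expect_set0 F x : expect finset.set0 F x = F x.
Proof.
rewrite /expect /cexp (eq_integral (cst (F x)%:E)).
  by rewrite integral_cst// [X in _ * X](@probability_setT _ _ _ P) mule1.
by move=> z _ /=; congr (F _)%:E; apply/rowP => i; rewrite mxE inE.
Qed.

Let absE F := fun x => `|F x|%:E.

Lemma integrable_mix r F x : measurable_fun setT F ->
  cexp r (absE F) x < +oo -> P.-integrable setT (fun z => (F (mix r x z))%:E).
Proof.
move=> mF Fx; apply/integrableP; split => //.
by apply/measurable_EFinP; apply: (measurableT_comp mF); mfun.
Qed.

Lemma expectE r F x : measurable_fun setT F -> cexp r (absE F) x < +oo ->
  (expect r F x)%:E = cexp r (EFin \o F) x.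
Proof.
move=> mF Fx; rewrite /expect fineK//.
exact: (integrable_fin_num measurableT (integrable_mix mF Fx)).
Qed.

Lemma le_expect r F x : measurable_fun setT F ->
  `|expect r F x|%:E <= cexp r (absE F) x.
Proof.
move=> mF; apply: (@le_trans _ _ `|cexp r (EFin \o F) x|).
  by rewrite /expect; case: (cexp _ _ _) => [a| |]//=; rewrite normr0 leey.
apply: le_abse_integral => //.
by apply/measurable_EFinP; apply: (measurableT_comp mF); mfun.
Qed.

(** For nonnegative functions this is [cexp_cexp] together with [cexp1]. The signed case is the
    difference of the two parts, each dominated by the average of |F|. *)
Lemma expect_tower r j F x : measurable_fun setT F ->
  cexp (j |: r) (absE F) x < +oo ->
  (dens (rho_density j)).-integrable setT
    (fun t => (expect r F (upd j x t))%:E) /\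
  \int[dens (rho_density j)]_t (expect r F (upd j x t))%:E =
    (expect (j |: r) F x)%:E.
Proof.
move=> mF Fx.
have tower G : measurable_fun setT G -> (forall x, 0 <= G x) ->
    \int[dens (rho_density j)]_t cexp r G (upd j x t) = cexp (j |: r) G x.
  move=> mG G0; have mc := measurable_cexp rho_density r mG.
  rewrite -(cexp_cexp rho_density)// cexp1//; last exact: cexp_ge0.
  rewrite integral_density//; first by apply: (measurableT_comp mc); mfun.
  by move=> t; apply: cexp_ge0.
pose nu := dens (rho_density j).
have mEF : measurable_fun setT (EFin \o F) by exact/measurable_EFinP.
have mabs : measurable_fun setT (absE F).
  by apply/measurable_EFinP; exact: measurableT_comp.
have mupd (G : X -> \bar R) : measurable_fun setT G ->
    measurable_fun setT (fun t : R => cexp r G (upd j x t)).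
  move=> mG; have mc := measurable_cexp rho_density r mG.
  by apply: (measurableT_comp mc); mfun.
have iG (G : X -> \bar R) : measurable_fun setT G -> (forall x, 0 <= G x) ->
    (forall y, G y <= absE F y) ->
    nu.-integrable setT (fun t => cexp r G (upd j x t)).
  move=> mG G0 GF; apply/integrableP; split; first exact: mupd.
  under eq_integral do rewrite gee0_abs ?cexp_ge0//.
  rewrite tower//; apply: le_lt_trans Fx.
  apply: ge0_le_integral => //.
  - by apply: (measurableT_comp mG); mfun.
  - by apply: (measurableT_comp mabs); mfun.
have iabs : nu.-integrable setT (fun t => cexp r (absE F) (upd j x t)).
  by apply: iG => // y; rewrite lee_fin.
split.
  apply: le_integrable iabs => //.
    apply/measurable_EFinP.
    by apply: (measurableT_comp (measurable_expect r mF)); mfun.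
  move=> t _; rewrite [leRHS]gee0_abs ?cexp_ge0//; first exact: le_expect.
  by move=> y; rewrite lee_fin.
pose p := (EFin \o F)^\+; pose n := (EFin \o F)^\-.
have mp : measurable_fun setT p by exact: measurable_funepos.
have mn : measurable_fun setT n by exact: measurable_funeneg.
have p0 y : 0 <= p y by exact: funepos_ge0.
have n0 y : 0 <= n y by exact: funeneg_ge0.
have pF y : p y <= absE F y.
  by rewrite /p funeposE ge_max !lee_fin ler_norm normr_ge0.
have nF y : n y <= absE F y.
  by rewrite /n funenegE ge_max -EFinN !lee_fin /absE -normrN ler_norm normr_ge0.
have cE s y : cexp s (EFin \o F) y = cexp s p y - cexp s n y.
  rewrite /cexp/= integralE; congr (_ - _); apply: eq_integral => z _.
    by rewrite /p !funeposE.
  by rewrite /n !funenegE.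
have ip := iG _ mp p0 pF; have in_ := iG _ mn n0 nF.
transitivity (\int[nu]_t (cexp r p (upd j x t) - cexp r n (upd j x t))).
  (* The averages of the two parts may be infinite for exceptional [t], where [fine] spoils the
     difference formula; integrability makes these [t] a null set. *)
  apply: ae_eq_integral => //.
  - apply/measurable_EFinP.
    by apply: (measurableT_comp (measurable_expect r mF)); mfun.
  - exact: measurable_int (integrableB _ ip in_).
  have f1 := integrable_ae measurableT ip.
  have f2 := integrable_ae measurableT in_.
  apply: (@filterS2 _ _ (ae_filter_ringOfSetsType nu) _ _ _ _ f1 f2).
  move=> t /(_ I) h1 /(_ I) h2 _.
  by rewrite /expect cE fineK// fin_numB h1 h2.
by rewrite integralB// !tower// expectE// cE.
Qed.

End conditional_expectation.

(** * Trading one averaged coordinate for one derivative *)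

Section expectation_step.
Context {R : realType}.
Variables (d : nat) (rho psi : 'I_d -> R -> R).
Hypothesis rho_density : forall j, is_density (rho j).
Hypothesis psi_weight : forall j, is_weight (psi j).
Hypothesis tail : forall j, tail_condition (rho j) (psi j).
Local Notation X := 'rV[R]_d.
Local Notation l1 := (@lebesgue_measure R).
Local Notation mu := (@lebesgue_rV R d).
Local Notation P := (prodP rho_density).
Local Notation cexp := (cexp rho_density).
Local Notation expect := (expect rho_density).
Local Notation weight := (weight rho psi).
Local Notation energy := (energy psi rho_density).
Local Open Scope ereal_scope.

Variables (r u : {set 'I_d}) (j : 'I_d) (F F' M : X -> R).
Hypotheses (jr : j \notin r) (ju : j \notin u)
  (ur : forall i, i \in u -> i \notin r).
Hypotheses (mF : measurable_fun setT F) (mF' : measurable_fun setT F')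
  (mM : measurable_fun setT M).
Hypothesis M_upd : forall x t, M (upd j x t) = M x.

(** The average over [r] must be interchanged with the integral over [s]. The third hypothesis
    concerns the average of the square of [F'], not the square of its average: absolute
    integrability of the kernel times [F'] cannot be read off after averaging. *)
Lemma represented_expect y :
  {ae P, forall z, represented j F F' M (mix r y z)} ->
  cexp r (fun x => `|F x|%:E) y < +oo ->
  \int[l1]_s (cexp r (fun x => (F' x ^+ 2)%:E) (upd j y s) * (psi j s)%:E) < +oo ->
  represented j (expect r F) (expect r F') (expect r M) y.
Proof.
move=> rep Fy F'y.
pose K (s : R) := step_kernel (y ord0 j) s.
pose B (p : X * R) := (K p.2 * F' (mix r (upd j y p.2) p.1))%R.
have mK : measurable_fun setT K.
  apply: (measurableT_comp (measurable_step_kernel) (g := fun s : R => (y ord0 j, s))).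
  by mfun.
have mB : measurable_fun setT (EFin \o B).
  apply/measurable_EFinP; apply: measurable_funM.
    by apply: (measurableT_comp mK); mfun.
  by apply: (measurableT_comp mF'); mfun.
have psi0 s : (0 < psi j s)%R by exact: weight_gt0.
have mpsi := measurable_weight (psi_weight j).
have mpsiV := measurable_weightV (psi_weight j).
have m2 : measurable_fun setT (fun x : X => (F' x ^+ 2)%:E).
  by apply/measurable_EFinP; exact: measurable_funX.
have mc := measurable_cexp rho_density r m2.
have c0 x : 0 <= cexp r (fun x => (F' x ^+ 2)%:E) x.
  by apply: cexp_ge0 => z; rewrite lee_fin sqr_ge0.
(* By [step_kernel_supp], the kernel at x_j vanishes outside this compact interval, on which 1/psi_j
   is integrable. *)
pose J := `[(- (`|y ord0 j| + 1))%R, (`|y ord0 j| + 1)%R]%classic : set R.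
pose h1 (s : R) : \bar R := (\1_J s / psi j s)%:E.
pose h2 (s : R) : \bar R :=
  cexp r (fun x => (F' x ^+ 2)%:E) (upd j y s) * (psi j s)%:E.
have h10 s : 0 <= h1 s by rewrite lee_fin mulr_ge0// invr_ge0 ltW.
have h20 s : 0 <= h2 s by rewrite mule_ge0// lee_fin ltW.
have mJ : measurable (J : set (measurableTypeR R)) by exact: measurable_itv.
have mh1 : measurable_fun setT h1.
  by apply/measurable_EFinP; apply: measurable_funM => //; exact: measurable_indic.
have mh2 : measurable_fun setT h2.
  apply: emeasurable_funM; first by apply: (measurableT_comp mc); mfun.
  exact/measurable_EFinP.
have h1oo : \int[l1]_s h1 s < +oo.
  have [_ _ lV] := psi_weight j.
  have [_ _ /(_ J (@subsetT _ J) (@segment_compact _ _ _))] := lV.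
  apply: le_lt_trans; rewrite [leRHS]integral_mkcond.
  rewrite le_eqVlt; apply/orP; left; apply/eqP; apply: eq_integral => s _.
  rewrite patchE /h1 indicE; case: (s \in J); last by rewrite mul0r.
  by rewrite mul1r ger0_norm// invr_ge0 ltW.
have iB : (P \x l1).-integrable setT (EFin \o B).
  apply/integrable21ltyP => //=.
  apply: (@le_lt_trans _ _ (\int[l1]_s (h1 s + h2 s))); last first.
    by rewrite ge0_integralD// lte_add_pinfty.
  apply: ge0_le_integral => //.
  - by move=> s _; apply: integral_ge0.
  - have mB' : measurable_fun setT (fun p : R * X => `|B (p.2, p.1)|%:E).
      apply/measurable_EFinP; apply: measurableT_comp => //.
      apply: measurable_funM; first by apply: (measurableT_comp mK); mfun.
      by apply: (measurableT_comp mF'); mfun.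
    exact: (measurable_fun_integral2 P mB').
  - exact: emeasurable_funD.
  move=> s _.
  have mFs : measurable_fun setT (fun z : X => F' (mix r (upd j y s) z)).
    by apply: (measurableT_comp mF'); mfun.
  have ic (c : R) : \int[P]__ c%:E = c%:E.
    by rewrite integral_cst// [X in _ * X](@probability_setT _ _ _ P) mule1.
  rewrite -[h1 s]ic /h2 -ge0_integralZr//; last 3 first.
  - by apply/measurable_EFinP; exact: measurable_funX.
  - by move=> z _; rewrite lee_fin sqr_ge0.
  - by rewrite lee_fin ltW.
  rewrite -ge0_integralD//; last 3 first.
  - by move=> z _; exact: h10.
  - by move=> z _; rewrite mule_ge0// lee_fin ?sqr_ge0// ltW.
  - apply: emeasurable_funM => //; apply/measurable_EFinP; exact: measurable_funX.
  apply: ge0_le_integral => //.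
  - apply/measurable_EFinP; apply: measurableT_comp => //.
    exact: (measurable_funM (measurable_cst (K s)) mFs).
  - apply: emeasurable_funD => //; apply: emeasurable_funM => //.
    by apply/measurable_EFinP; exact: measurable_funX.
  move=> z _; rewrite -EFinM -EFinD lee_fin /B/= normrM.
  have := step_kernel_supp (y ord0 j) s; rewrite -/(K s) -/J indicE.
  set f := F' _; have := psi0 s; move: (psi j s) => q q0.
  case: (s \in J) => /= Ks; last first.
    have -> : `|K s|%R = 0%R by apply/eqP; rewrite eq_le Ks normr_ge0.
    by rewrite mul0r addr_ge0// ?mul0r// mulr_ge0 ?sqr_ge0// ltW.
  apply: (@le_trans _ _ `|f|%R); first by rewrite ler_piMl.
  (* The claim is a <= 1/q + a^2 q, which is a q <= 1 + (a q)^2 divided by q. *)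
  rewrite mul1r -(real_normK (num_real f)); move: (normr_ge0 f); move: `|f|%R => a a0.
  have aq : (a = q^-1 * (a * q))%R by rewrite mulrCA mulVf ?mulr1 ?gt_eqF.
  have -> : (q^-1 + a ^+ 2 * q = q^-1 * (1 + (a * q) ^+ 2))%R.
    by field; rewrite gt_eqF.
  rewrite {1}aq ler_wpM2l// ?invr_ge0 ?ltW//; nra.
(* The representation is solved for [M], so that the integrability of [M] along the fibre follows
   from that of the other two terms. *)
have repE : {ae P, forall z, (M (mix r y z))%:E =
    (F (mix r y z))%:E - (\int[l1]_s (B (z, s)))%:E}.
  apply: filterS rep => z [_ ->].
  rewrite -EFinB; congr EFin; rewrite mix_coord//.
  rewrite (_ : (fun s => _) = fun s => B (z, s)) ?addrK//.
  by apply/funext => s; rewrite /B mix_upd.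
have aeK : {ae l1, forall s, setT s ->
    fubini_G P (EFin \o B) s = (K s * expect r F' (upd j y s))%:E}.
  apply: filterS (ae_integrable2 iB) => s is_ _.
  exact: (@integral_scale _ _ _ P (K s) (fun z => F' (mix r (upd j y s) z)) is_).
have mKE : measurable_fun setT (fun s => (K s * expect r F' (upd j y s))%:E).
  apply/measurable_EFinP; apply: measurable_funM => //.
  by apply: (measurableT_comp (measurable_expect rho_density r mF')); mfun.
have mBs : measurable_fun setT (fun p : R * X => (B (p.2, p.1))%:E).
  apply/measurable_EFinP; apply: measurable_funM.
    by apply: (measurableT_comp mK); mfun.
  by apply: (measurableT_comp mF'); mfun.
have iG : l1.-integrable setT (fubini_G P (EFin \o B)).
  have iBs : (l1 \x P).-integrable setT (fun p : R * X => (B (p.2, p.1))%:E).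
    apply/(@integrable12ltyP _ _ _ _ _ l1 P _ mBs).
    exact: ((@integrable21ltyP _ _ _ _ _ P l1 _ mB).1 iB).
  exact: (integrable_fubini_F iBs).
have iKE : l1.-integrable setT (fun s => (K s * expect r F' (upd j y s))%:E).
  exact: (@ae_eq_integrable _ (measurableTypeR R) R l1 _ _ mKE aeK iG).
split => //.
have iF := integrable_mix mF Fy.
have aeI : {ae P, forall z, setT z -> fubini_F l1 (EFin \o B) z =
    (\int[l1]_s B (z, s))%:E}.
  apply: filterS (ae_integrable1 iB) => z iz _.
  by rewrite /fubini_F /Rintegral fineK//; exact: integrable_fin_num.
have mI : measurable_fun setT (fun z : X => (\int[l1]_s B (z, s))%:E).
  apply/measurable_EFinP; apply: (measurableT_comp (f := fine)) => //.
  exact: (measurable_fun_integral2 l1 mB).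
have iI := @ae_eq_integrable _ X R P _ _ mI aeI (integrable_fubini_F iB).
apply/eqP; rewrite -subr_eq; apply/eqP; apply: EFin_inj.
rewrite EFinB expectE//.
transitivity (\int[P]_z ((F (mix r y z))%:E - (\int[l1]_s B (z, s))%:E)).
  rewrite integralB//; congr (_ - _).
  transitivity (\int[P]_z fubini_F l1 (EFin \o B) z).
    transitivity (\int[l1]_s fubini_G P (EFin \o B) s).
      rewrite /Rintegral fineK; first by apply/esym; apply: ae_eq_integral aeK => //; exact: measurable_int iG.
      apply: (integrable_fin_num measurableT iKE).
    by rewrite integral21_prod_meas1// integral12_prod_meas1.
  by apply: ae_eq_integral aeI => //; exact: measurable_int (integrable_fubini_F iB).
have eqM : \int[P]_z ((F (mix r y z))%:E - (\int[l1]_s B (z, s))%:E) =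
    cexp r (EFin \o M) y.
  apply/esym; apply: ae_eq_integral => //.
  - by apply/measurable_EFinP; apply: (measurableT_comp mM); mfun.
  - exact: measurable_int (integrableB _ iF iI).
  - by apply: filterS repE => z h _; exact: h.
rewrite /expect fineK -eqM//.
exact: (integrable_fin_num measurableT (integrableB _ iF iI)).
Qed.

Hypothesis rep : {ae P, forall x, represented j F F' M x}.
Hypothesis F_lty : {ae P, forall x, cexp (j |: r) (fun z => `|F z|%:E) x < +oo}.
Hypothesis F'_lty : energy finset.set0 (j |: u) F' < +oo.
Hypothesis eF'_lty : energy r (j |: u) F' < +oo.

Let integral_fiber (G : X -> \bar R) : measurable_fun setT G ->
  (forall x, 0 <= G x) ->
  \int[P]_x G x = \int[P]_x \int[l1]_t (G (upd j x t) * (rho j t)%:E).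
Proof.
move=> mG G0; rewrite -(integral_cexp rho_density [set j]%SET mG G0).
by apply: eq_integral => x _; exact: cexp1.
Qed.

(** Along the [j]-th fibre the density rho_j cancels the denominator that [j] contributes to the
    weight, leaving psi_j ds. *)
Let integral_fiber_weight (H : X -> \bar R) : measurable_fun setT H ->
  (forall x, 0 <= H x) ->
  \int[P]_x (H x * (weight (j |: u) x)%:E) =
  \int[P]_x ((weight u x)%:E *
    \int[l1]_s (H (upd j x s) * (psi j s)%:E)).
Proof.
move=> mH H0.
have w0 v x : (0 <= weight v x)%R by apply: ltW; exact: weight_pos.
rewrite integral_fiber; last 2 first.
- apply: emeasurable_funM => //; apply/measurable_EFinP.
  exact: measurable_weight_prod.
- by move=> x; rewrite mule_ge0// lee_fin.
apply: eq_integral => x _.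
have mHx : measurable_fun setT (fun s : R => H (upd j x s) * (psi j s)%:E).
  apply: emeasurable_funM; first by apply: (measurableT_comp mH); mfun.
  apply/measurable_EFinP; exact: measurable_weight.
rewrite -ge0_integralZl//; last 2 first.
- move=> s _; rewrite mule_ge0// lee_fin ltW//; exact: weight_gt0.
- by rewrite lee_fin.
apply: eq_integral => s _; rewrite weightU1// upd_coord weight_upd//.
rewrite -muleA -EFinM muleCA -EFinM; congr (_ * _%:E).
by rewrite -!mulrA mulrC mulrA; field; rewrite gt_eqF// density_gt0.
Qed.

Let mE' : measurable_fun setT (fun x => (expect r F' x ^+ 2)%:E).
Proof.
by apply/measurable_EFinP; apply: measurable_funX; exact: measurable_expect.
Qed.

Let Q (x : X) := \int[l1]_s (expect r F' (upd j x s) ^+ 2 * psi j s)%:E.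

Let mQ : measurable_fun setT Q.
Proof.
apply: (measurable_fun_integral2 l1
  (F := fun p : X * R => (expect r F' (upd j p.1 p.2) ^+ 2 * psi j p.2)%:E)).
apply/measurable_EFinP; apply: measurable_funM.
  apply: measurable_funX.
  by apply: (measurableT_comp (measurable_expect rho_density r mF')); mfun.
by apply: (measurableT_comp (measurable_weight (psi_weight j))); mfun.
Qed.

Let Q0 x : 0 <= Q x.
Proof.
apply: integral_ge0 => s _; rewrite lee_fin mulr_ge0 ?sqr_ge0// ltW//.
exact: weight_gt0.
Qed.

Let energy_Q : energy r (j |: u) F' = \int[P]_x ((weight u x)%:E * Q x).
Proof.
rewrite /energy; under eq_integral do rewrite EFinM.
rewrite integral_fiber_weight//; last by move=> x; rewrite lee_fin sqr_ge0.
Qed.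

Let ae_lty_weighted (H : X -> \bar R) : measurable_fun setT H ->
  (forall x, 0 <= H x) -> \int[P]_x ((weight u x)%:E * H x) < +oo ->
  {ae P, forall x, H x < +oo}.
Proof.
move=> mH H0 Hoo.
have w0 x : (0 < weight u x)%R by exact: weight_pos.
have mwH : measurable_fun setT (fun x => (weight u x)%:E * H x).
  apply: emeasurable_funM => //; apply/measurable_EFinP.
  exact: measurable_weight_prod.
have := ae_lty_integral mwH _ Hoo; case=> [x|N [mN N0 HN]].
  by rewrite mule_ge0// lee_fin ltW.
exists N; split => // x /= nH; apply: HN => /= wH; apply: nH.
by move: wH; case: (H x) => [a| |]; rewrite ?ltry// gt0_muley ?lte_fin// ltxx.
Qed.

Let Q_lty : {ae P, forall x, Q x < +oo}.
Proof. by apply: ae_lty_weighted => //; rewrite -energy_Q. Qed.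

Let m2 : measurable_fun setT (fun x => (F' x ^+ 2)%:E).
Proof. by apply/measurable_EFinP; exact: measurable_funX. Qed.

Let S (x : X) := \int[l1]_s
  (cexp r (fun x => (F' x ^+ 2)%:E) (upd j x s) * (psi j s)%:E).

(** The weight depends on no coordinate in [r], so averaging the square of [F'] over [r] keeps its
    weighted integral, which [F'_lty] bounds. *)
Let S_lty : {ae P, forall x, S x < +oo}.
Proof.
have mc := measurable_cexp rho_density r m2.
have c0 x : 0 <= cexp r (fun x => (F' x ^+ 2)%:E) x.
  by apply: cexp_ge0 => z; rewrite lee_fin sqr_ge0.
have w0 x : (0 <= weight (j |: u) x)%R by apply: ltW; exact: weight_pos.
apply: ae_lty_weighted.
- apply: (measurable_fun_integral2 l1 (F := fun p : X * R =>
    cexp r (fun x => (F' x ^+ 2)%:E) (upd j p.1 p.2) * (psi j p.2)%:E)).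
  apply: emeasurable_funM; first by apply: (measurableT_comp mc); mfun.
  apply/measurable_EFinP.
  by apply: (measurableT_comp (measurable_weight (psi_weight j))); mfun.
- move=> x; apply: integral_ge0 => s _; rewrite mule_ge0// lee_fin ltW//.
  exact: weight_gt0.
rewrite -integral_fiber_weight//.
have mG : measurable_fun setT (fun x => (F' x ^+ 2 * weight (j |: u) x)%:E).
  apply/measurable_EFinP; apply: measurable_funM; first exact: measurable_funX.
  exact: measurable_weight_prod.
have := F'_lty; rewrite /energy; under eq_integral do rewrite expect_set0.
rewrite -(integral_cexp rho_density r mG); last first.
  by move=> x; rewrite lee_fin mulr_ge0// sqr_ge0.
apply: le_lt_trans; rewrite le_eqVlt; apply/orP; left; apply/eqP.
apply: eq_integral => x _; rewrite -ge0_integralZr//; last 3 first.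
- by apply: (measurableT_comp m2); mfun.
- by move=> z _; rewrite lee_fin sqr_ge0.
- by rewrite lee_fin.
apply: eq_integral => z _; rewrite -EFinM weight_mix// => i.
by rewrite inE => /orP[/set1P ->|/ur].
Qed.

Let F_lty_r : {ae P, forall x, cexp r (fun z => `|F z|%:E) x < +oo}.
Proof.
have mabs : measurable_fun setT (fun z => `|F z|%:E).
  by apply/measurable_EFinP; exact: measurableT_comp.
apply: (ae_lty_cexp (s := [set j]%SET)).
- exact: measurable_cexp.
- by move=> x; apply: cexp_ge0 => z; rewrite lee_fin.
apply: filterS F_lty => x; rewrite cexp_cexp// => z; by rewrite lee_fin.
Qed.

(** [represented_expect] holds at almost every point for the product probability. The passage to
    almost every point of almost every fibre is made for Lebesgue measure, which has the same null
    sets. *)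
Let rep_fiber : {ae P, forall x, {ae l1, forall t,
  represented j (expect r F) (expect r F') (expect r M) (upd j x t)}}.
Proof.
apply/ae_prodP; apply: ae_upd; apply/(ae_prodP rho_density).
apply: filterS3 (ae_mix r rep) F_lty_r S_lty => y; exact: represented_expect.
Qed.

Let expect_M_upd (x : X) t : expect r M (upd j x t) = expect r M x.
Proof.
rewrite /expect; congr fine; apply: eq_integral => z _ /=; congr EFin.
by rewrite -mix_upd// M_upd.
Qed.

Let fiber_poincare : {ae P, forall x,
  \int[dens (rho_density j)]_t (expect r F (upd j x t) ^+ 2)%:E <=
  (expect (j |: r) F x ^+ 2)%:E + C_const (rho j) (psi j) * Q x}.
Proof.
apply: filterS3 rep_fiber F_lty Q_lty => x rx Fx Qx.
have [ig intg] := expect_tower mF Fx.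
have -> : expect (j |: r) F x =
    (\int[dens (rho_density j)]_t expect r F (upd j x t))%R.
  by rewrite /Rintegral intg.
pose g (t : R) := expect r F (upd j x t).
pose h (s : R) := expect r F' (upd j x s).
have mg : measurable_fun setT g.
  by apply: (measurableT_comp (measurable_expect rho_density r mF)); mfun.
have mh : measurable_fun setT h.
  by apply: (measurableT_comp (measurable_expect rho_density r mF')); mfun.
have rg : {ae l1, forall t, l1.-integrable setT
      (fun s => ((primitive eta s - (t < s)%R%:R) * h s)%:E) /\
    g t = (expect r M x +
      \int[l1]_s ((primitive eta s - (t < s)%R%:R) * h s))%R}.
  apply: (@filterS _ _ (ae_filter_ringOfSetsType l1) _ _ _ rx) => t.
  rewrite /represented expect_M_upd upd_coord.
  have -> : (fun s => step_kernel t s * expect r F' (upd j (upd j x t) s))%R =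
      (fun s => (primitive eta s - (t < s)%R%:R) * h s)%R.
    by apply/funext => s; rewrite upd_upd.
  move=> [irt rt]; split => //.
  by move: irt; apply: eq_integrable => // s _; rewrite upd_upd.
exact: (@poincare R (rho j) (psi j) (rho_density j) (psi_weight j) (tail j)
  (primitive eta) g h (expect r M x) mg mh Qx rg ig).
Qed.

(** The one-dimensional inequality on each fibre is multiplied by the weight of [u], constant along
    the fibre since [j] is not in [u], and integrated over the rest. *)
Lemma energy_step : energy r u F <=
  energy (j |: r) u F + C_const (rho j) (psi j) * energy r (j |: u) F'.
Proof.
have C0 : 0 <= C_const (rho j) (psi j).
  apply: integral_ge0 => t _; rewrite lee_fin mulr_ge0//.
    by rewrite mulr_ge0 ?subr_ge0 ?distr_fun_ge0 ?distr_fun_le1.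
  by rewrite invr_ge0 ltW//; exact: weight_gt0.
have w0 v x : (0 <= weight v x)%R by apply: ltW; exact: weight_pos.
have mw v : measurable_fun setT (fun x => (weight v x)%:E).
  by apply/measurable_EFinP; exact: measurable_weight_prod.
have mE s : measurable_fun setT (fun x => (expect s F x ^+ 2)%:E).
  by apply/measurable_EFinP; apply: measurable_funX; exact: measurable_expect.
have mwQ : measurable_fun setT (fun x => (weight u x)%:E * Q x).
  exact: emeasurable_funM.
have mA s : measurable_fun setT (fun x => (expect s F x ^+ 2 * weight u x)%:E).
  by under eq_fun do rewrite EFinM; exact: emeasurable_funM.
have A0 s x : 0 <= (expect s F x ^+ 2 * weight u x)%:E.
  by rewrite lee_fin mulr_ge0// sqr_ge0.
have wQ0 x : 0 <= (weight u x)%:E * Q x by rewrite mule_ge0// lee_fin.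
have mCQ : measurable_fun setT
    (fun x => C_const (rho j) (psi j) * ((weight u x)%:E * Q x)).
  exact: emeasurable_funM.
have CQ0 x : 0 <= C_const (rho j) (psi j) * ((weight u x)%:E * Q x).
  exact: mule_ge0.
rewrite energy_Q -ge0_integralZl// /energy -ge0_integralD//.
rewrite (integral_fiber (mA r) (A0 r)).
apply: ae_ge0_le_integral => //.
- move=> x _; apply: integral_ge0 => t _; rewrite mule_ge0// lee_fin ltW//.
  exact: density_gt0.
- apply: (measurable_fun_integral2 l1 (F := fun p : X * R =>
    (expect r F (upd j p.1 p.2) ^+ 2 * weight u (upd j p.1 p.2))%:E *
    (rho j p.2)%:E)).
  apply: emeasurable_funM; first by apply: (measurableT_comp (mA r)); mfun.
  apply/measurable_EFinP.
  by apply: (measurableT_comp (measurable_density rho_density j)); mfun.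
- by move=> x _; rewrite adde_ge0.
- exact: emeasurable_funD.
apply: filterS fiber_poincare => x ineq _.
have C0Q : 0 <= C_const (rho j) (psi j) * Q x by exact: mule_ge0.
have mEx : measurable_fun setT (fun t : R => (expect r F (upd j x t) ^+ 2)%:E).
  by apply: (measurableT_comp (mE r)); mfun.
have mrho := measurable_density rho_density j.
have rho0 t : (0 <= rho j t)%R by apply: ltW; exact: density_gt0.
apply: (@le_trans _ _ ((weight u x)%:E *
    \int[dens (rho_density j)]_t (expect r F (upd j x t) ^+ 2)%:E)); last first.
  apply: le_trans (lee_wpmul2l _ ineq) _; first by rewrite lee_fin.
  rewrite ge0_muleDr//; last by rewrite lee_fin sqr_ge0.
  by rewrite muleCA -EFinM mulrC.
rewrite le_eqVlt; apply/orP; left; apply/eqP.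
rewrite [in RHS]integral_density//; last by move=> t; rewrite lee_fin sqr_ge0.
rewrite -ge0_integralZl//; last 3 first.
- by apply: emeasurable_funM => //; exact/measurable_EFinP.
- by move=> t _; rewrite mule_ge0// lee_fin ?sqr_ge0.
- by rewrite lee_fin.
by apply: eq_integral => t _; rewrite weight_upd// -!EFinM; congr EFin; ring.
Qed.

End expectation_step.

(** * Fully averaged energies as terms of the norm *)

Section projected_energy.
Context {R : realType}.
Variables (d : nat) (rho psi : 'I_d -> R -> R).
Hypothesis rho_density : forall j, is_density (rho j).
Hypothesis psi_weight : forall j, is_weight (psi j).
Local Notation X := 'rV[R]_d.
Local Notation leb n := (@lebesgue_rV R n).
Local Notation P := (prodP rho_density).
Local Notation cexp := (cexp rho_density).
Local Notation expect := (expect rho_density).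
Local Notation weight := (weight rho psi).
Local Notation energy := (energy psi rho_density).
Variable u : {set 'I_d}.
Local Notation proj := (@proj_coord R _ _ (@enum_val _ (mem u))).
Local Notation projC := (@proj_coord R _ _ (@enum_val _ (mem (~: u)))).

Lemma extend0E (v : {set 'I_d}) (y : 'rV[R]_#|v|) i (iv : i \in v) :
  extend0 y ord0 i = y ord0 (enum_rank_in iv i).
Proof.
rewrite /extend0 summxE (bigD1 (enum_rank_in iv i))//= !mxE enum_rankK_in//.
rewrite !eqxx mulr1 big1 ?addr0// => k ki; rewrite !mxE eqxx/=.
have [e|] := eqVneq; last by rewrite mulr0.
by move/eqP: ki; case; apply: enum_val_inj; rewrite enum_rankK_in// e.
Qed.

Lemma extend0_out (v : {set 'I_d}) (y : 'rV[R]_#|v|) i : i \notin v ->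
  extend0 y ord0 i = 0.
Proof.
move=> iv; rewrite /extend0 summxE big1// => k _; rewrite !mxE eqxx/=.
case: eqP => [e|_]; last by rewrite mulr0.
by move: iv; rewrite e enum_valP.
Qed.

Lemma mix_join_coord (x z : X) :
  mix (~: u) x z = join_coord (proj x) (projC z).
Proof.
apply/rowP => i; rewrite /join_coord [LHS]mxE [RHS]mxE inE.
case: (boolP (i \in u)) => iu /=.
  by rewrite extend0E mxE enum_rankK_in// extend0_out ?addr0// inE iu.
rewrite extend0_out// add0r.
have iu' : i \in ~: u by rewrite inE.
by rewrite extend0E mxE enum_rankK_in.
Qed.

Lemma measurable_extend0 (v : {set 'I_d}) dT (T : measurableType dT)
    (g : T -> 'rV[R]_#|v|) : measurable_fun setT g ->
  measurable_fun setT (fun t => extend0 (g t)).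
Proof.
move=> mg; apply: measurable_fun_rV => i.
have [iv|iv] := boolP (i \in v).
  by under eq_fun do rewrite extend0E; exact: measurable_coord_comp.
by under eq_fun do rewrite extend0_out//; exact: measurable_cst.
Qed.

Lemma measurable_join_coord dT (T : measurableType dT)
    (g : T -> 'rV[R]_#|u|) (h : T -> 'rV[R]_#|~: u|) :
  measurable_fun setT g -> measurable_fun setT h ->
  measurable_fun setT (fun t => join_coord (g t) (h t)).
Proof.
move=> mg mh; apply: measurable_fun_rV => i.
under eq_fun do rewrite mxE.
by apply: measurable_funD; apply: measurable_coord_comp;
  exact: measurable_extend0.
Qed.

Lemma tensorE (v : {set 'I_d}) (h : 'I_d -> R -> R) :
  tensor h = wprod (h \o @enum_val _ (mem v)).
Proof. by []. Qed.

Lemma tensor_rho_gt0 (v : {set 'I_d}) (y : 'rV[R]_#|v|) : 0 < tensor rho y.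
Proof. by apply: prodr_gt0 => i _; exact: density_gt0. Qed.

Lemma measurable_tensor (v : {set 'I_d}) (h : 'I_d -> R -> R) :
  (forall i, measurable_fun setT (h i)) ->
  measurable_fun setT (tensor h : 'rV[R]_#|v| -> R).
Proof. by move=> mh; rewrite tensorE; apply: measurable_wprod => i; exact: mh. Qed.

Lemma weight_tensor (x : X) :
  weight u x = tensor psi (proj x) / tensor rho (proj x).
Proof.
rewrite /weight /tensor -prodf_div big_enum_val/=.
by apply: eq_bigr => i _; rewrite !mxE.
Qed.

Local Open Scope ereal_scope.

Lemma ae_proj (Q : 'rV[R]_#|u| -> Prop) :
  {ae leb #|u|, forall y, Q y} -> {ae P, forall x, Q (proj x)}.
Proof.
move=> [N [mN N0 QN]]; exists (proj @^-1` N).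
have mp : measurable_fun setT (fun x : X => proj x) by mfun.
have mNp : measurable ((fun x : X => proj x) @^-1` N).
  by rewrite -[X in measurable X]setTI; exact: mp.
split => //; last by move=> x /= nQ; exact: QN.
pose I (y : 'rV[R]_#|u|) : \bar R := (\1_N y)%:E.
have mI : measurable_fun setT I by apply/measurable_EFinP; exact: measurable_indic.
rewrite -(setIT (_ @^-1` _)) -integral_indic//.
transitivity (\int[P]_x I (proj x)) => //.
rewrite (integral_prodP_proj rho_density enum_val_inj mI); last first.
  by move=> y; rewrite lee_fin.
rewrite -tensorE -[RHS](@integral0 _ _ _ (leb #|u|) setT).
apply: ae_eq_integral => //.
  apply: emeasurable_funM => //; apply/measurable_EFinP.
  by apply: measurable_tensor => i; exact: measurable_density.
exists N; split => // y /= h; apply: contrapT => yN; apply: h => _.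
by rewrite /I indicE memNset// mul0e.
Qed.

Let integral_projC (H : 'rV[R]_#|~: u| -> R) : measurable_fun setT H ->
  \int[P]_z (H (projC z))%:E = \int[leb #|~: u|]_z (H z * tensor rho z)%:E.
Proof.
move=> mH.
have mEH : measurable_fun setT (EFin \o H) by exact/measurable_EFinP.
have t0 (y : 'rV[R]_#|~: u|) : (0 <= tensor rho y)%R by apply: ltW; exact: tensor_rho_gt0.
rewrite integralE [RHS]integralE; congr (_ - _).
- transitivity (\int[P]_z ((EFin \o H)^\+ (projC z))).
    by apply: eq_integral => z _; rewrite !funeposE.
  rewrite (integral_prodP_proj rho_density enum_val_inj)//.
    apply: eq_integral => z _; rewrite -tensorE !funeposE/=.
    by rewrite EFinM maxeMl ?mul0e// lee_fin.
  exact: measurable_funepos.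
- transitivity (\int[P]_z ((EFin \o H)^\- (projC z))).
    by apply: eq_integral => z _; rewrite !funenegE.
  rewrite (integral_prodP_proj rho_density enum_val_inj)//.
    apply: eq_integral => z _; rewrite -tensorE !funenegE/=.
    rewrite -mulNr EFinM -[(- H z)%:E]/(- H z)%R%:E.
    by rewrite maxeMl ?mul0e// lee_fin.
  exact: measurable_funeneg.
Qed.

Let inner (F : X -> R) (y : 'rV[R]_#|u|) : R :=
  (\int[leb #|~: u|]_z (F (join_coord y z) * tensor rho z))%R.

Lemma expect_inner F x : measurable_fun setT F ->
  expect (~: u) F x = inner F (proj x).
Proof.
move=> mF; rewrite /expect /inner /Rintegral; congr fine.
rewrite -(integral_projC (H := fun z => F (join_coord (proj x) z))).
  by apply: eq_integral => z _; rewrite /= mix_join_coord.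
by apply: (measurableT_comp mF); apply: measurable_join_coord; mfun.
Qed.

Lemma measurable_inner F : measurable_fun setT F ->
  measurable_fun setT (inner F).
Proof.
move=> mF; apply: (measurableT_comp (f := fine)) => //.
apply: (measurable_fun_integral2 (leb #|~: u|)
  (F := fun p => (F (join_coord p.1 p.2) * tensor rho p.2)%:E)).
apply/measurable_EFinP; apply: measurable_funM.
  by apply: (measurableT_comp mF); apply: measurable_join_coord; mfun.
apply: (measurableT_comp (f := tensor rho)); last exact: measurable_snd.
by apply: measurable_tensor => i; exact: measurable_density.
Qed.

(** The average over the complement of [u] depends on the projection to R^u alone; the marginal
    there has density [tensor rho], which cancels the denominator of the weight. *)
Lemma energy_inner F : measurable_fun setT F ->
  energy (~: u) u F =
  \int[leb #|u|]_y (`|inner F y| ^+ 2 * tensor psi y)%:E.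
Proof.
move=> mF.
have mi := measurable_inner mF.
pose H y : \bar R := (`|inner F y| ^+ 2 * (tensor psi y / tensor rho y))%:E.
have tpsi0 (y : 'rV[R]_#|u|) : (0 <= tensor psi y)%R.
  by apply: prodr_ge0 => i _; apply: ltW; exact: weight_gt0.
transitivity (\int[P]_x H (proj x)).
  apply: eq_integral => x _; rewrite expect_inner// weight_tensor.
  by rewrite /H real_normK// num_real.
rewrite (integral_prodP_proj rho_density enum_val_inj).
- apply: eq_integral => y _; rewrite -tensorE -EFinM -mulrA divfK//.
  by rewrite gt_eqF// tensor_rho_gt0.
- apply/measurable_EFinP; apply: measurable_funM.
    by apply: measurable_funX; exact: measurableT_comp.
  apply: measurable_funM.
    by apply: measurable_tensor => i; exact: measurable_weight.
  rewrite (_ : (fun y => _) = fun y : 'rV[R]_#|u| => (tensor rho y `^ (-1))%R).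
    apply: (measurableT_comp (@measurable_powR _ _)).
    by apply: measurable_tensor => i; exact: measurable_density.
  by apply/funext => y; rewrite powR_inv1// ltW// tensor_rho_gt0.
- move=> y; rewrite lee_fin mulr_ge0// mulr_ge0// invr_ge0 ltW//.
  exact: tensor_rho_gt0.
Qed.

(** Carries the absolute convergence demanded by [W_space] over to the product probability. *)
Lemma cexp_lty (F : X -> R) : measurable_fun setT F ->
  {ae leb #|u|, forall y, (leb #|~: u|).-integrable setT
    (fun z => (F (join_coord y z) * tensor rho z)%:E)} ->
  {ae P, forall x, cexp (~: u) (fun z => `|F z|%:E) x < +oo}.
Proof.
move=> mF /ae_proj; apply: filterS => x /integrableP[_].
apply: le_lt_trans; rewrite le_eqVlt; apply/orP; left; apply/eqP.
transitivity (\int[P]_z `|F (join_coord (proj x) (projC z))|%:E).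
  by apply: eq_integral => z _; rewrite mix_join_coord.
rewrite (integral_projC (H := fun z => `|F (join_coord (proj x) z)|%R)).
  apply: eq_integral => z _; rewrite /= normrM; congr (_ * _)%:E.
  by rewrite ger0_norm// ltW// tensor_rho_gt0.
apply: measurableT_comp => //.
by apply: (measurableT_comp mF); apply: measurable_join_coord; mfun.
Qed.

End projected_energy.

(** * The embedding *)

Section embedding.
Context {R : realType}.
Variables (d : nat) (rho psi : 'I_d -> R -> R) (gamma : {set 'I_d} -> R).
Hypothesis rho_density : forall j, is_density (rho j).
Hypothesis psi_weight : forall j, is_weight (psi j).
Hypothesis gamma_gt0 : forall u, 0 < gamma u.
Hypothesis tail : forall j, tail_condition (rho j) (psi j).
Local Notation X := 'rV[R]_d.
Local Notation leb n := (@lebesgue_rV R n).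
Local Notation P := (prodP rho_density).
Local Notation C j := (C_const (rho j) (psi j)).
Local Notation energy := (energy psi rho_density).
Local Open Scope ereal_scope.

Lemma C_const_ge0 j : 0 <= C j.
Proof.
apply: integral_ge0 => t _; rewrite lee_fin mulr_ge0//.
  by rewrite mulr_ge0 ?subr_ge0 ?distr_fun_ge0 ?distr_fun_le1.
by rewrite invr_ge0 ltW//; exact: weight_gt0.
Qed.

Lemma prod_C_const_ge0 (v : {set 'I_d}) : 0 <= \prod_(j in v) C j.
Proof. by apply: prode_ge0 => j _; exact: C_const_ge0. Qed.

Lemma prod_C_const_lty (v : {set 'I_d}) : \prod_(j in v) C j < +oo.
Proof.
suff /andP[] : (0 <= \prod_(j in v) C j) && (\prod_(j in v) C j < +oo) by [].
elim/big_ind : _ => [|a b /andP[a0 aoo] /andP[b0 boo]|j _].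
- by rewrite lee_fin ler01 ltry.
- by rewrite mule_ge0//= lte_mul_pinfty// ge0_fin_numE.
- by rewrite C_const_ge0 C_const_fin.
Qed.

Lemma embedding_const_lty : embedding_const rho psi gamma < +oo.
Proof.
apply: lte_sum_pinfty => u _.
apply: lte_mul_pinfty => //; first by rewrite lee_fin ltW.
exact: prod_C_const_lty.
Qed.

Lemma sum_subset_setU1 (a : {set 'I_d} -> \bar R) j (w : {set 'I_d}) :
  j \notin w ->
  \sum_(v : {set 'I_d} | v \subset j |: w) a v =
  \sum_(v : {set 'I_d} | v \subset w) a v +
  \sum_(v : {set 'I_d} | v \subset w) a (j |: v).
Proof.
move=> jw; rewrite (bigID (fun v : {set 'I_d} => j \in v))/= addeC; congr (_ + _).
  apply: eq_bigl => v; apply/andP/idP => [[vjw jv]|vw].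
    apply/fintype.subsetP => i iv; have := fintype.subsetP vjw i iv.
    by rewrite !inE => /orP[/eqP ij|//]; move: jv; rewrite -ij iv.
  split; first exact: fintype.subset_trans vw (finset.subsetUr _ _).
  by apply: contra jw => jv; exact: fintype.subsetP vw j jv.
rewrite (reindex_onto (fun v => j |: v) (fun v => v :\ j)%SET)/=; last first.
  by move=> v /andP[_ jv]; exact: finset.setD1K.
apply: eq_bigl => v; rewrite setU11 andbT.
apply/andP/idP => [[vw /eqP e]|vw].
  apply/fintype.subsetP => i; rewrite -e !inE => /andP[ij iv].
  have := fintype.subsetP vw i; rewrite !inE; move=> /(_ iv).
  by rewrite (negbTE ij).
split; first exact: finset.setUS.
apply/eqP/finset.setU1K; apply: contra jw => jv; exact: fintype.subsetP vw j jv.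
Qed.

Variable f : X -> R.
Hypothesis Wf : W_space rho psi gamma f.
Local Notation df u := (wderiv u f).

Let wd u : is_weak_deriv u f (df u).
Proof. by case: Wf => _ h _ _; apply: wderivP; exact: h. Qed.

Let bdf u : box_integrable (df u).
Proof. by apply: locally_integrable_box_integrable; case: (wd u). Qed.

Let mdf u : measurable_fun setT (df u).
Proof. by case: (bdf u). Qed.

Let N0 u := energy (~: u) u (df u).

Let N0_ge0 r u F : 0 <= energy r u F.
Proof.
apply: integral_ge0 => x _; rewrite lee_fin mulr_ge0 ?sqr_ge0// ltW//.
exact: weight_pos.
Qed.

Let W_sqnormE : W_sqnorm rho psi gamma f = \sum_u (gamma u)^-1%:E * N0 u.
Proof.
by apply: eq_bigr => u _; rewrite /N0 energy_inner.
Qed.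

Let N0_lty u : N0 u < +oo.
Proof.
have [_ _ _] := Wf; rewrite W_sqnormE (bigD1 u)//= => Woo.
have : (gamma u)^-1%:E * N0 u < +oo.
  apply: le_lt_trans Woo; rewrite leeDl// sume_ge0// => v _.
  by rewrite mule_ge0 ?N0_ge0// lee_fin invr_ge0 ltW.
rewrite /N0; move: (N0_ge0 (~: u) u (df u)); case: (energy _ _ _) => [a| |]//.
  by move=> _ _; rewrite ltry.
by rewrite gt0_muley ?lte_fin ?invr_gt0// ltxx.
Qed.

Let df_lty (r u : {set 'I_d}) : r \subset ~: u ->
  {ae P, forall x, cexp rho_density r (fun z => `|df u z|%:E) x < +oo}.
Proof.
move=> ru; have [_ _ /(_ u) iu _] := Wf.
have mabs : measurable_fun setT (fun z => `|df u z|%:E).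
  by apply/measurable_EFinP; exact: measurableT_comp.
apply: (ae_lty_cexp (s := ~: u)).
- exact: measurable_cexp.
- by move=> x; apply: cexp_ge0 => z; rewrite lee_fin.
have := cexp_lty rho_density (mdf u) iu; apply: filterS => x.
rewrite cexp_cexp// ?(finset.setUidPl ru)// => z; by rewrite lee_fin.
Qed.

(** The recursion unrolled over the coordinates of [w]: each is either averaged out or, at the price
    of its constant, differentiated; [v] collects the latter. [boundU1] is the recursion for this
    sum, with equality. *)
Let bound (u w : {set 'I_d}) := \sum_(v : {set 'I_d} | v \subset w)
  (\prod_(j in v) C j) * N0 (u :|: v).

Let bound_lty u w : bound u w < +oo.
Proof.
apply: lte_sum_pinfty => v _; apply: lte_mul_pinfty => //.
- exact: prod_C_const_ge0.
- by rewrite ge0_fin_numE ?prod_C_const_lty ?prod_C_const_ge0.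
Qed.

Let boundU1 (u w : {set 'I_d}) (j : 'I_d) : j \notin w ->
  bound u (j |: w) = bound u w + C j * bound (j |: u) w.
Proof.
move=> jw; rewrite /bound sum_subset_setU1//; congr (_ + _).
rewrite ge0_sume_distrr; last first.
  by move=> v _; apply: mule_ge0; [exact: prod_C_const_ge0|exact: N0_ge0].
apply: eq_bigr => v vw; rewrite muleA; congr (_ * N0 _).
  rewrite big_setU1//; apply: contra jw => jv; exact: fintype.subsetP vw j jv.
by rewrite finset.setUCA finset.setUA.
Qed.

Let energy_bound0 u : energy (~: (u :|: finset.set0)) u (df u) <= bound u finset.set0.
Proof.
rewrite finset.setU0 /bound (big_pred1 finset.set0) => [|v].
  by rewrite big_set0 mul1e finset.setU0.
exact: finset.subset0.
Qed.

(** [w] is the set of coordinates not yet averaged or differentiated. Removing [j] from [w] leaves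
    two smaller problems: same [u] with fewer free coordinates, settled by the inner induction, and
    [u] enlarged by [j], settled by the outer one. *)
Let energy_bound n (u w : {set 'I_d}) : (#|~: u| <= n)%N -> w \subset ~: u ->
  energy (~: (u :|: w)) u (df u) <= bound u w.
Proof.
elim: n u w => [|n IHn] u w un wu.
  have -> : w = finset.set0; last exact: energy_bound0.
  apply/eqP; rewrite -finset.subset0; move: un; rewrite leqn0 cards_eq0.
  by move/eqP => <-.
have [k] := ubnP #|w|; elim: k w wu => // k IHk w wu wk.
have [->|[j jw]] := set_0Vmem w; first exact: energy_bound0.
pose w' := (w :\ j)%SET.
have wE : w = j |: w' by rewrite finset.setD1K.
have jw' : j \notin w' by rewrite !inE eqxx.
have ju : j \notin u by have := fintype.subsetP wu j jw; rewrite inE.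
have w'u : w' \subset ~: u.
  by apply: fintype.subset_trans wu; exact: finset.subD1set.
have w'k : (#|w'| < k)%N by move: wk; rewrite (cardsD1 j w) jw.
have jun : (#|~: (j |: u)| <= n)%N.
  move: un; rewrite (cardsD1 j (~: u)) inE ju add1n ltnS.
  apply: leq_trans; apply: subset_leq_card; apply/fintype.subsetP => i.
  by rewrite !inE negb_or.
have w'ju : w' \subset ~: (j |: u).
  apply/fintype.subsetP => i iw'; rewrite !inE negb_or.
  have := fintype.subsetP w'u i iw'; rewrite inE => ->; rewrite andbT.
  by apply: contraNneq jw' => <-.
pose r := ~: (u :|: w).
have jr : j \notin r by rewrite !inE negbK jw orbT.
have rE : j |: r = ~: (u :|: w').
  apply/setP => i; rewrite !inE; case: (eqVneq i j) => [->|ij] //=.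
  by rewrite (negbTE ju).
have rE' : r = ~: (j |: u :|: w').
  by rewrite /r wE finset.setUCA finset.setUA.
have rep : {ae P, forall x, represented j (df u) (df (j |: u))
    (fun y => (\int[@lebesgue_measure R]_s (eta s * df u (upd j y s)))%R) x}.
  apply/ae_prodP; apply: weak_representation (bdf u) (bdf _) _.
  exact: weak_deriv_step ju (wd u) (wd _).
have IH1 := IHk w' w'u w'k.
have IH2 := IHn (j |: u) w' jun w'ju.
(* With every remaining coordinate free nothing is averaged: this is the finiteness of N({}, u + j)
   on which Fubini depends, and the reason why the induction hypothesis must range over all [w]. *)
have IH3 := IHn (j |: u) (~: (j |: u)) jun (fintype.subxx _).
rewrite wE boundU1// -wE.
apply: le_trans (leeD IH1 (lee_wpmul2l (C_const_ge0 j) IH2)).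
rewrite -rE -rE' -/r.
apply: (energy_step psi_weight tail jr ju _ (mdf u) (mdf _)
  (measurable_weak_mean j (bdf u))) => //.
- by move=> i iu; rewrite !inE iu.
- by move=> x t; exact: weak_mean_upd.
- by apply: df_lty; rewrite rE finset.setCS; exact: finset.subsetUl.
- apply: le_lt_trans (bound_lty (j |: u) (~: (j |: u))).
  by move: IH3; rewrite finset.setUCr finset.setCT.
- by apply: le_lt_trans (bound_lty (j |: u) w'); rewrite rE'.
Qed.

(** [energy_bound] with no derivative and all coordinates free bounds the squared L^2 norm by the
    sum of C_u N(D \ u, u), with C_u the product of the constants over [u]. It remains to compare
    with the product of two sums. *)
Lemma W_space_L2 : L2_space rho f /\
  L2_sqnorm rho f <= embedding_const rho psi gamma * W_sqnorm rho psi gamma f.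
Proof.
have [lf _ _ Woo] := Wf.
have mf : measurable_fun setT f by case: lf.
have L2E : L2_sqnorm rho f = energy finset.set0 finset.set0 (df finset.set0).
  transitivity (\int[P]_x (f x ^+ 2)%:E).
    rewrite integral_prodP//; last by move=> x; rewrite lee_fin sqr_ge0.
      by apply: eq_integral => x _; rewrite /= real_normK ?num_real// EFinM.
    by apply/measurable_EFinP; exact: measurable_funX.
  have := weak_deriv0 lf (wd finset.set0) => /(ae_prodP rho_density) ff.
  apply: ae_eq_integral => //.
  - by apply/measurable_EFinP; exact: measurable_funX.
  - apply/measurable_EFinP; apply: measurable_funM.
      by apply: measurable_funX; exact: measurable_expect.
    exact: measurable_weight_prod.
  apply: filterS ff => x fx _.
  by rewrite expect_set0 fx /weight big_set0 mulr1.
suff main : L2_sqnorm rho f <=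
    embedding_const rho psi gamma * W_sqnorm rho psi gamma f.
  split => //; split => //; apply: le_lt_trans main _.
  have e0 : 0 <= embedding_const rho psi gamma.
    by apply: sume_ge0 => u _; rewrite mule_ge0 ?prod_C_const_ge0// lee_fin ltW.
  by rewrite lte_mul_pinfty// ge0_fin_numE// embedding_const_lty.
have := @energy_bound _ finset.set0 [set: 'I_d]%SET (leqnn _).
rewrite finset.setC0 fintype.subxx finset.set0U finset.setCT -L2E => /(_ isT).
move=> /le_trans; apply; rewrite /bound W_sqnormE /embedding_const.
rewrite ge0_sume_distrl; last first.
  by move=> u _; rewrite mule_ge0 ?prod_C_const_ge0// lee_fin ltW.
under eq_bigl do rewrite finset.subsetT.
apply: lee_sum => u _; rewrite finset.set0U.
(* The weight gamma_u and its inverse are inserted, after which the second factor is a single term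
   of the squared norm of W_d and is bounded by the whole of it. *)
rewrite [leLHS](_ : _ = (gamma u)%:E * \prod_(j in u) C j *
    ((gamma u)^-1%:E * N0 u)); last first.
  rewrite (muleC (gamma u)%:E) -muleA; congr (_ * _).
  by rewrite muleA -EFinM mulfV ?mul1e// gt_eqF.
apply: lee_wpmul2l; first by rewrite mule_ge0 ?prod_C_const_ge0// lee_fin ltW.
rewrite (bigD1 u)//= leeDl// sume_ge0// => v _.
by rewrite mule_ge0 ?N0_ge0// lee_fin invr_ge0 ltW.
Qed.

End embedding.

(** The constant is an extended real, so its finiteness is asserted alongside the inequality. *)
Theorem lemma12 (R : realType) (d : nat) (d_ge1 : (1 <= d)%N)
    (rho psi : 'I_d -> R -> R) (gamma : {set 'I_d} -> R)
    (rho_density : forall j, is_density (rho j))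
    (psi_weight : forall j, is_weight (psi j))
    (gamma_gt0 : forall u, (0 < gamma u)%R)
    (tail : forall j, tail_condition (rho j) (psi j)) :
  (embedding_const rho psi gamma < +oo)%E /\
  forall f : 'rV[R]_d -> R, W_space rho psi gamma f ->
    L2_space rho f /\
    (L2_sqnorm rho f <= embedding_const rho psi gamma * W_sqnorm rho psi gamma f)%E.
Proof.
split; first exact: embedding_const_lty.
by move=> f; exact: W_space_L2.
Qed.
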